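(* Let $\mathbb{X}$ be a weighted projective line over a finite field $\mathbf{k}=\mathbb{F}_q$. Let $L$ be a line bundle on $\mathbb{X}$, let $\vec{x},\vec{y}\in\mathbb{L}$, and let $S=\bigoplus_k S_k$ be a torsion sheaf, where all $S_k$ are indecomposable. Then there exists an exact sequence $$0\longrightarrow L(\vec{x})\longrightarrow L(\vec{y})\longrightarrow S\longrightarrow 0$$ if and only if the following three conditions hold: (1) $[L(\vec{x})]+[S]=[L(\vec{y})]$ in $K_0(\mathbb{X})$; (2) the $S_k$ lie in pairwise distinct tubes; (3) $\mathrm{Hom}(L(\vec{y}),\mathrm{top}\,S_k)\neq0$ for each $k$. Moreover, in this case, $F_{S\,L(\vec{x})}^{L(\vec{y})}=1$.
   Context: Weighted projective line $\mathbb{X}$ over a field $\mathbf{k}$: given by a weight sequence $(p_1,\dots,p_t)$ of positive integers and distinct points $\lambda_1,\dots,\lambda_t\in\mathbb{P}^1(\mathbf{k})$ normalized so that $\lambda_1=\infty,\lambda_2=0,\lambda_3=1$. $\mathbb{L}$ is the abelian group with generators $\vec{x}_1,\dots,\vec{x}_t$ and relations $p_1\vec{x}_1=\cdots=p_t\vec{x}_t=:\vec{c}$. Let $A=\mathbf{k}[X_1,\dots,X_t]/(f_3,\dots,f_t)$ with $f_i=X_i^{p_i}-X_2^{p_2}+\lambda_iX_1^{p_1}$, $\mathbb{L}$-graded by $\deg X_i=\vec{x}_i$. Then $\mathrm{coh}\,\mathbb{X}=\mathrm{mod}^{\mathbb{L}}(A)/\mathrm{mod}_0^{\mathbb{L}}(A)$,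 the quotient of finitely generated $\mathbb{L}$-graded $A$-modules by those of finite length; it is a hereditary abelian category. The structure sheaf $\mathcal{O}$ is the image of $A$, the line bundles are the grading shifts $\mathcal{O}(\vec{x})$, $\vec{x}\in\mathbb{L}$, and $L(\vec{x})$ denotes the shift of $L$ by $\vec{x}$. Torsion sheaves are the finite length objects of $\mathrm{coh}\,\mathbb{X}$. They form a direct product of pairwise orthogonal tubes, one for each closed point of $\mathbb{P}^1(\mathbf{k})$: the tube at the exceptional point $\lambda_i$ is equivalent to nilpotent representations of the cyclic quiver with $p_i$ vertices over $\mathbf{k}$, and the tube at an ordinary point $z$ is equivalent to nilpotent representations of the Jordan quiver over the residue field $\mathbf{k}_z$. Each indecomposable torsion sheaf lies in one tube and is uniserial with simple top. $[X]$ denotes the class of $X$ in the Grothendieck group $K_0(\mathbb{X})$ of $\mathrm{coh}\,\mathbb{X}$. Hall number: $F_{AB}^{M}=|\{X\subseteq M\mid X\cong B,\ M/X\cong A\}|$. *)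

(* Defs.v *)
From HB Require Import structures.
From mathcomp Require Import all_boot all_order all_algebra.
From mathcomp Require Import ring_quotient mpoly.
From mathcomp Require Import boolp.

Set Implicit Arguments.
Unset Strict Implicit.
Unset Printing Implicit Defensive.

Import GRing.Theory.
Local Open Scope ring_scope.
Local Open Scope quotient_scope.

(* The number of marked points is t = npt.+2, and the marked points are        *)
(* numbered from 0. P^1(k) is represented by option k, with None for infinity. *)
Record wpl (k : fieldType) := Wpl {
  npt : nat;
  weight : 'I_npt.+2 -> nat;
  point : 'I_npt.+2 -> option k;
  weight_gt0 : forall i, (0 < weight i)%N;
  point_inj : injective point;
  point_fst : forall i : 'I_npt.+2, i = 0%N :> nat -> point i = None;
  point_snd : forall i : 'I_npt.+2, i = 1%N :> nat -> point i = Some 0;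
  point_trd : forall i : 'I_npt.+2, i = 2%N :> nat -> point i = Some 1
}.

Section GradingGroup.
Variables (k : fieldType) (X : wpl k).
Local Notation t := (npt X).+2.

Definition Lrel : {pred 'rV[int]_t} := fun v =>
  `[< exists a : 'I_t -> 'I_t -> int, v = \sum_i \sum_j
        (delta_mx 0 i *+ weight i - delta_mx 0 j *+ weight j) *~ a i j >].

Lemma Lrel_zmod_closed : zmod_closed Lrel.
Proof.
split=> [|u v].
  by apply/asboolP; exists (fun _ _ => 0); rewrite big1 // => i _; rewrite big1.
move=> /asboolP[a ->] /asboolP[b ->]; apply/asboolP.
exists (fun i j => a i j - b i j); rewrite -sumrB; apply: eq_bigr => i _.
by rewrite -sumrB; apply: eq_bigr => j _; rewrite mulrzBr.
Qed.

HB.instance Definition _ :=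
  GRing.isZmodClosed.Build 'rV[int]_t Lrel Lrel_zmod_closed.

Definition Lgrp : zmodType := Quotient.quot Lrel.

Definition xvec (i : 'I_t) : Lgrp := \pi_(Quotient.quot Lrel) (delta_mx 0 i).
Definition cvec : Lgrp := xvec ord0 *+ weight (ord0 : 'I_t).

Lemma xvec_weight i : xvec i *+ weight i = cvec.
Proof.
rewrite /cvec /xvec -!raddfMn /=; apply/eqP; rewrite -subr_eq0 -raddfB /=.
have -> : (0 : Lgrp) = \pi_(Quotient.quot Lrel) 0 by rewrite raddf0.
rewrite -Quotient.idealrBE subr0; apply/asboolP.
exists (fun a b => ((a == i) && (b == ord0))%:R).
rewrite (bigD1 i) //= (bigD1 ord0) //= !eqxx /= mulr1z.
rewrite big1 ?addr0; last by move=> j /negbTE ->.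
by rewrite big1 ?addr0 // => a /negbTE ->; rewrite big1.
Qed.

End GradingGroup.

Section CoordinateAlgebra.
Variables (k : fieldType) (X : wpl k).
Local Notation t := (npt X).+2.
Local Notation P := {mpoly k[t]}.
Local Notation L := (Lgrp X).

Definition ord_snd : 'I_t := @Ordinal t 1 isT.

Definition frel (i : 'I_t) : P :=
  'X_i ^+ weight i - 'X_ord_snd ^+ weight ord_snd
  + odflt 0 (point i) *: 'X_ord0 ^+ weight (ord0 : 'I_t).

Definition relI : {pred P} := fun p =>
  `[< exists g : 'I_t -> P, p = \sum_(i < t | (2 <= i)%N) g i * frel i >].

Lemma frel_at0 i : (frel i).@[fun=> 0] = 0.
Proof.
rewrite /frel mevalD mevalB mevalZ !rmorphXn /= !mevalXU !expr0n.
by rewrite !eqn0Ngt !weight_gt0 /= subrr mulr0 addr0.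
Qed.

Lemma relI_idealr_closed : idealr_closed relI.
Proof.
split.
- by apply/asboolP; exists (fun=> 0); rewrite big1 // => i _; rewrite mul0r.
- apply/negP => /asboolP[g] /(congr1 (fun p : P => p.@[fun=> 0])).
  rewrite meval1 raddf_sum /= big1 ?mevalM; last first.
    by move=> i _; rewrite mevalM frel_at0 mulr0.
  by move/eqP; rewrite oner_eq0.
- move=> a u v /asboolP[g ->] /asboolP[h ->]; apply/asboolP.
  exists (fun i => a * g i + h i); rewrite mulr_sumr -big_split /=.
  by apply: eq_bigr => i _; rewrite mulrDl mulrA.
Qed.

HB.instance Definition _ := isIdealr.Build P relI relI_idealr_closed.

Definition Aalg : comNzRingType := {ideal_quot relI}.

Definition Apr (p : P) : Aalg := \pi_({ideal_quot relI}) p.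

Definition wdeg (m : 'X_{1..t}) : L := \sum_i xvec i *+ m i.

Definition phomog (d : L) (p : P) := forall m, m \in msupp p -> wdeg m = d.

Definition Ahomog (d : L) (a : Aalg) := exists2 p, phomog d p & a = Apr p.

Definition pcomp (d : L) (p : P) : P :=
  \sum_(m <- msupp p | wdeg m == d) p@_m *: 'X_[m].

Definition Acomp (d : L) (a : Aalg) : Aalg := Apr (pcomp d (repr a)).

Lemma Apr_eq p q : (Apr p == Apr q) = (p - q \in relI).
Proof. by rewrite /Apr Quotient.idealrBE. Qed.

Lemma Apr_repr (a : Aalg) : Apr (repr a) = a.
Proof. exact: reprK. Qed.

Lemma AprD p q : Apr (p + q) = Apr p + Apr q.
Proof. exact: raddfD. Qed.

Lemma AprM p q : Apr (p * q) = Apr p * Apr q.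
Proof. exact: rmorphM. Qed.

Lemma Apr_sum (I : Type) (r : seq I) (Q : pred I) (F : I -> P) :
  Apr (\sum_(i <- r | Q i) F i) = \sum_(i <- r | Q i) Apr (F i).
Proof. exact: raddf_sum. Qed.

Lemma wdegD m1 m2 : wdeg (m1 + m2)%MM = wdeg m1 + wdeg m2.
Proof.
rewrite /wdeg -big_split /=; apply: eq_bigr => i _.
by rewrite mnmDE mulrnDr.
Qed.

Lemma wdegU i : wdeg U_(i)%MM = xvec i.
Proof.
rewrite /wdeg (bigD1 i) //= mnm1E eqxx mulr1n big1 ?addr0 // => j ne_ji.
by rewrite mnm1E eq_sym (negbTE ne_ji).
Qed.

Lemma phomogX m : phomog (wdeg m) 'X_[m].
Proof. by move=> m'; rewrite msuppX inE => /eqP->. Qed.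

Lemma phomog0 d : phomog d 0.
Proof. by move=> m; rewrite mcoeff_msupp mcoeff0 eqxx. Qed.

Lemma phomog1 : phomog 0 1.
Proof.
move=> m; rewrite mcoeff_msupp mcoeff1; case: (m =P 0%MM) => [->|_]; last by rewrite eqxx.
by rewrite /wdeg big1 // => i _; rewrite mnm0E.
Qed.

Lemma phomogD d p q : phomog d p -> phomog d q -> phomog d (p + q).
Proof.
by move=> hp hq m /msuppD_le; rewrite mem_cat => /orP[/hp|/hq].
Qed.

Lemma phomogZ d c p : phomog d p -> phomog d (c *: p).
Proof. by move=> hp m /msuppZ_le/hp. Qed.

Lemma phomogM d e p q : phomog d p -> phomog e q -> phomog (d + e) (p * q).
Proof.
move=> hp hq m /msuppM_le/allpairsP[[m1 m2] /= [/hp e1 /hq e2 ->]].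
by rewrite wdegD e1 e2.
Qed.

Lemma phomog_exp d p n : phomog d p -> phomog (d *+ n) (p ^+ n).
Proof.
move=> hp; elim: n => [|n IHn]; first by rewrite expr0 mulr0n; apply: phomog1.
by rewrite exprS mulrS; apply: phomogM.
Qed.

Lemma phomog_sum (I : Type) (r : seq I) (Q : pred I) (F : I -> P) d :
  (forall i, Q i -> phomog d (F i)) -> phomog d (\sum_(i <- r | Q i) F i).
Proof.
by move=> hF; elim/big_rec: _ => [|i p Qi]; [apply: phomog0 | apply/phomogD/hF].
Qed.

Lemma phomogXU i : phomog (cvec X) ('X_i ^+ weight i).
Proof. by rewrite -(xvec_weight i) -wdegU; apply/phomog_exp/phomogX. Qed.

Lemma phomog_frel i : phomog (cvec X) (frel i).
Proof.
apply: phomogD; last by apply/phomogZ/phomogXU.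
by apply: phomogD; [|rewrite -scaleN1r; apply: phomogZ]; apply: phomogXU.
Qed.

Lemma mcoeff_pcomp d p m : (pcomp d p)@_m = if wdeg m == d then p@_m else 0.
Proof.
rewrite /pcomp raddf_sum /=; case: (boolP (m \in msupp p)) => [mp|mNp].
  rewrite big_mkcond (bigD1_seq m) ?msupp_uniq //= big1 ?addr0 => [|m' ne].
    by case: ifP => // _; rewrite mcoeffZ mcoeffX eqxx mulr1.
  by case: ifP => // _; rewrite mcoeffZ mcoeffX (negbTE ne) mulr0.
rewrite memN_msupp_eq0 // if_same big_seq_cond big1 // => m' /andP[m'p _].
rewrite mcoeffZ mcoeffX; case: eqP => [e|_]; last by rewrite mulr0.
by rewrite -e m'p in mNp.
Qed.

Lemma pcompD d p q : pcomp d (p + q) = pcomp d p + pcomp d q.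
Proof.
apply/mpolyP => m; rewrite mcoeffD !mcoeff_pcomp mcoeffD.
by case: ifP => // _; rewrite addr0.
Qed.

Lemma pcompZ d c p : pcomp d (c *: p) = c *: pcomp d p.
Proof.
apply/mpolyP => m; rewrite mcoeffZ !mcoeff_pcomp mcoeffZ.
by case: ifP => // _; rewrite mulr0.
Qed.

Lemma pcomp0 d : pcomp d 0 = 0.
Proof. by apply/mpolyP => m; rewrite mcoeff_pcomp mcoeff0 if_same. Qed.

Lemma pcomp_sum (I : Type) (r : seq I) (Q : pred I) (F : I -> P) d :
  pcomp d (\sum_(i <- r | Q i) F i) = \sum_(i <- r | Q i) pcomp d (F i).
Proof. exact: (big_morph (pcomp d) (pcompD d) (pcomp0 d)). Qed.

Lemma pcomp_homog d e p : phomog d p -> pcomp e p = if e == d then p else 0.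
Proof.
move=> hp; apply/mpolyP => m; rewrite mcoeff_pcomp.
case: (boolP (m \in msupp p)) => [/[dup] mp /hp ->|mNp].
  by rewrite eq_sym; case: ifP => // _; rewrite mcoeff0.
by rewrite (memN_msupp_eq0 mNp) if_same; case: ifP; rewrite ?mcoeff0 ?memN_msupp_eq0.
Qed.

Lemma phomog_pcomp d p : phomog d (pcomp d p).
Proof.
by move=> m; rewrite mcoeff_msupp mcoeff_pcomp; case: ifP => [/eqP //|]; rewrite eqxx.
Qed.

Lemma pcompM d e f g : phomog d f -> pcomp (d + e) (f * g) = f * pcomp e g.
Proof.
move=> hf; rewrite {1}[g]mpolyE /pcomp mulr_sumr -/(pcomp _ _) pcomp_sum.
rewrite mulr_sumr [RHS]big_mkcond /=; apply: eq_bigr => m _.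
rewrite -scalerAr pcompZ (pcomp_homog _ (phomogM hf (phomogX (m := m)))).
rewrite (inj_eq (addrI d)) eq_sym; by case: ifP => _; rewrite ?scaler0 ?scalerAr.
Qed.

Lemma pcompI d p : p \in relI -> pcomp d p \in relI.
Proof.
move=> /asboolP[g ->]; apply/asboolP; exists (fun i => pcomp (d - cvec X) (g i)).
rewrite pcomp_sum; apply: eq_bigr => i _.
by rewrite mulrC -{1}[d](subrKC (cvec X)) pcompM 1?mulrC //; apply: phomog_frel.
Qed.

Lemma AcompE d p : Acomp d (Apr p) = Apr (pcomp d p).
Proof.
apply/eqP; rewrite /Acomp Apr_eq.
have -> : pcomp d (repr (Apr p)) - pcomp d p = pcomp d (repr (Apr p) - p).
  by rewrite -scaleN1r -pcompZ -pcompD scaleN1r.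
by apply: pcompI; rewrite -Apr_eq Apr_repr.
Qed.

Lemma AcompD d a b : Acomp d (a + b) = Acomp d a + Acomp d b.
Proof.
by rewrite -(Apr_repr a) -(Apr_repr b) -AprD !AcompE pcompD AprD.
Qed.

Lemma Acomp_orth d e a : Acomp d (Acomp e a) = if d == e then Acomp e a else 0.
Proof.
rewrite [Acomp e a]/Acomp AcompE (pcomp_homog _ (@phomog_pcomp e _)).
by case: ifP => // _; apply: raddf0.
Qed.

Lemma Acomp_sum a : exists2 s, uniq s & a = \sum_(d <- s) Acomp d a.
Proof.
set p := repr a; exists (undup [seq wdeg m | m <- msupp p]).
  exact: undup_uniq.
rewrite -{1}(Apr_repr a) -/p; under eq_bigr do rewrite /Acomp -/p.
rewrite -Apr_sum; congr Apr; apply/mpolyP => m; rewrite raddf_sum /=.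
under eq_bigr do rewrite mcoeff_pcomp.
case: (boolP (m \in msupp p)) => [mp|mNp]; last first.
  by rewrite (memN_msupp_eq0 mNp) big1 // => d _; rewrite if_same.
have dm : wdeg m \in undup [seq wdeg m | m <- msupp p].
  by rewrite mem_undup; apply: map_f.
rewrite (bigD1_seq (wdeg m)) ?undup_uniq //= eqxx big1 ?addr0 // => d.
by rewrite eq_sym => /negbTE->.
Qed.

Lemma AcompM d e a b : Ahomog d a -> Acomp (d + e) (a * b) = a * Acomp e b.
Proof.
move=> [p hp ->]; rewrite -(Apr_repr b) -AprM !AcompE pcompM //.
exact: AprM.
Qed.

End CoordinateAlgebra.

Section GradedModules.
Variables (k : fieldType) (X : wpl k).
Local Notation A := (Aalg X).
Local Notation L := (Lgrp X).

(* The decomposition of M as the direct sum of its M_d is given by the         *)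
(* projections gcomp d onto the M_d, so that M_d = {v | gcomp d v = v}.        *)
Record grmod := GrMod {
  gcar :> lmodType A;
  gcomp : L -> gcar -> gcar;
  gcompD : forall d u v, gcomp d (u + v) = gcomp d u + gcomp d v;
  gcomp_orth : forall d e v,
    gcomp d (gcomp e v) = if d == e then gcomp e v else 0;
  gcomp_sum : forall v, exists2 s, uniq s & v = \sum_(d <- s) gcomp d v;
  gcompZ : forall d e a v, Ahomog d a -> gcomp (d + e) (a *: v) = a *: gcomp e v;
  gfingen : exists n (e : 'I_n -> gcar),
    forall v, exists a : 'I_n -> A, v = \sum_i a i *: e i
}.

Lemma gcomp0 (M : grmod) d : gcomp d (0 : M) = 0.
Proof. by apply: (addrI (gcomp d 0)); rewrite -gcompD !addr0. Qed.

(* M(x)_d = M_(d + x) *)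
Definition shift (M : grmod) (x : L) : grmod.
Proof.
refine (@GrMod M (fun d => @gcomp M (d + x)) _ _ _ _ (gfingen M)).
- by move=> d u v; apply: gcompD.
- by move=> d e v; rewrite gcomp_orth (inj_eq (addIr x)).
- move=> v; have [s us ev] := gcomp_sum v; exists [seq d - x | d <- s].
    by rewrite map_inj_uniq //; apply: addIr.
  by rewrite big_map {1}ev; apply: eq_bigr => d _; rewrite subrK.
- by move=> d e a v ha; rewrite -addrA gcompZ.
Defined.

Definition Osheaf : grmod.
Proof.
refine (@GrMod (Aalg X)^o (@Acomp k X) _ _ _ _ _).
- exact: AcompD.
- exact: Acomp_orth.
- exact: Acomp_sum.
- by move=> d e a v ha; apply: AcompM.
- exists 1%N, (fun=> 1) => v; exists (fun=> v).
  by rewrite big_ord1 /GRing.scale /= mulr1.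
Defined.

Record gsub (M : grmod) := GSub {
  gmem :> M -> Prop;
  gmem0 : gmem 0;
  gmemD : forall u v, gmem u -> gmem v -> gmem (u + v);
  gmemZ : forall a v, gmem v -> gmem (a *: v);
  gmem_comp : forall d v, gmem v -> gmem (gcomp d v)
}.

Definition gsub_le (M : grmod) (P Q : gsub M) := forall v, P v -> Q v.

Definition gsub_zero (M : grmod) : gsub M.
Proof.
refine (@GSub M (fun v => v = 0) _ _ _ _) => //.
- by move=> u v -> ->; rewrite addr0.
- by move=> a v ->; rewrite scaler0.
- by move=> d v ->; rewrite gcomp0.
Defined.

Definition gsub_full (M : grmod) : gsub M :=
  @GSub M (fun=> True) I (fun _ _ _ _ => I) (fun _ _ _ => I) (fun _ _ _ => I).

Definition gsub_max (M : grmod) (P Q : gsub M) :=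
  [/\ gsub_le P Q, ~ gsub_le Q P &
      forall T : gsub M, gsub_le P T -> gsub_le T Q -> gsub_le T P \/ gsub_le Q T].

(* flen P Q: P is contained in Q and Q/P has finite length, i.e. there is a     *)
(* chain P = P_0 < ... < P_n = Q with simple quotients.                         *)
Inductive flen (M : grmod) : gsub M -> gsub M -> Prop :=
| flen0 P Q : gsub_le P Q -> gsub_le Q P -> flen P Q
| flenS P R Q : flen P R -> gsub_max R Q -> flen P Q.

(* The morphisms M -> N of the Serre quotient mod(A)/mod_0(A) are represented   *)
(* by graded A-linear maps f : M' -> N/N' with M/M' and N' of finite length,    *)
(* modulo agreement of f1, f2 as maps M'' -> N/N'' for some M'' contained in    *)
(* both M' and some N'' containing both N'. The map f is encoded by the graded  *)
(* submodule {(u, v) | u in M', v in f u} of the sum of M and N; it determines  *)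
(* M' as its projection to M (cdom) and N' as its intersection with N (cker).   *)
Record corr (M N : grmod) := Corr {
  crel :> M -> N -> Prop;
  crel0 : crel 0 0;
  crelD : forall u u' v v', crel u v -> crel u' v' -> crel (u + u') (v + v');
  crelZ : forall a u v, crel u v -> crel (a *: u) (a *: v);
  crel_comp : forall d u v, crel u v -> crel (gcomp d u) (gcomp d v)
}.

Definition cimg (M N : grmod) (f : corr M N) (P : gsub M) : gsub N.
Proof.
refine (@GSub N (fun v => exists2 u, P u & f u v) _ _ _ _).
- by exists 0; [apply: gmem0 | apply: crel0].
- move=> v v' [u Pu fuv] [u' Pu' fuv']; exists (u + u'); first exact: gmemD.
  exact: crelD.
- by move=> a v [u Pu fuv]; exists (a *: u); [apply: gmemZ | apply: crelZ].
- move=> d v [u Pu fuv]; exists (gcomp d u); first exact: gmem_comp.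
  exact: crel_comp.
Defined.

Definition cinv (M N : grmod) (f : corr M N) : corr N M.
Proof.
by refine (@Corr N M (fun v u => f u v) _ _ _ _);
  [apply: crel0 | move=> *; apply: crelD | move=> *; apply: crelZ
  | move=> *; apply: crel_comp].
Defined.

Definition cdom (M N : grmod) (f : corr M N) : gsub M :=
  cimg (cinv f) (gsub_full N).

Definition cker (M N : grmod) (f : corr M N) : gsub N :=
  cimg f (gsub_zero M).

Record qhom (M N : grmod) := QHom {
  qcorr :> corr M N;
  qdom : flen (cdom qcorr) (gsub_full M);
  qker : flen (gsub_zero N) (cker qcorr)
}.

Definition qeq (M N : grmod) (f g : qhom M N) :=
  exists (P : gsub M) (Q : gsub N),
    [/\ flen P (gsub_full M) /\ flen (gsub_zero N) Q,
        gsub_le P (cdom f) /\ gsub_le P (cdom g) &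
        forall u v w, P u -> f u v -> g u w -> Q (v - w)].

Definition ccomp (M N K : grmod) (g : corr N K) (f : corr M N) : corr M K.
Proof.
refine (@Corr M K (fun u w => exists2 v, f u v & g v w) _ _ _ _).
- by exists 0; apply: crel0.
- move=> u u' w w' [v fv gv] [v' fv' gv']; exists (v + v'); exact: crelD.
- by move=> a u w [v fv gv]; exists (a *: v); apply: crelZ.
- by move=> d u w [v fv gv]; exists (gcomp d v); apply: crel_comp.
Defined.

Definition cid (M : grmod) : corr M M.
Proof.
by refine (@Corr M M (fun u v => u = v) _ _ _ _) => //;
  [move=> u u' v v' -> -> | move=> a u v -> | move=> d u v ->].
Defined.

Definition cgraph (M N : grmod) (f : {linear M -> N})
  (fc : forall d u, f (gcomp d u) = gcomp d (f u)) : corr M N.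
Proof.
refine (@Corr M N (fun u v => v = f u) _ _ _ _).
- by rewrite linear0.
- by move=> u u' v v' -> ->; rewrite linearD.
- by move=> a u v ->; rewrite linearZ.
- by move=> d u v ->; rewrite fc.
Defined.

Lemma gmemN (M : grmod) (P : gsub M) v : P v -> P (- v).
Proof. by rewrite -scaleN1r; apply: gmemZ. Qed.

Lemma gmemB (M : grmod) (P : gsub M) u v : P u -> P v -> P (u - v).
Proof. by move=> Pu Pv; apply: gmemD Pu _; apply: gmemN. Qed.

Lemma crelB (M N : grmod) (f : corr M N) u u' v v' :
  f u v -> f u' v' -> f (u - u') (v - v').
Proof.
by move=> h h'; apply: crelD h _; rewrite -!scaleN1r; apply: crelZ.
Qed.

Lemma flen_le (M : grmod) (P Q : gsub M) : flen P Q -> gsub_le P Q.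
Proof.
by elim=> // {}P R {}Q _ PR [RQ _ _] v /PR /RQ.
Qed.

Lemma flen_eqr (M : grmod) (P Q Q' : gsub M) :
  flen P Q -> gsub_le Q Q' -> gsub_le Q' Q -> flen P Q'.
Proof.
move=> h; elim: h Q' => [{}P {}Q PQ QP|{}P R {}Q PR _ [RQ QR mx]] Q' QQ' Q'Q.
  by apply: flen0 => v; [move/PQ/QQ' | move/Q'Q/QP].
apply: flenS PR _; split=> [v /RQ/QQ'//|h|T RT TQ'].
  by apply: QR => v /QQ'/h.
case: (mx T RT); first by move=> v /TQ'/Q'Q.
  by left.
by move=> QT; right=> v /Q'Q/QT.
Qed.

Lemma flen_eql (M : grmod) (P P' Q : gsub M) :
  flen P Q -> gsub_le P P' -> gsub_le P' P -> flen P' Q.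
Proof.
elim=> [{}P {}Q PQ QP|{}P R {}Q _ IH mx] PP' P'P.
  by apply: flen0 => v; [move/P'P/PQ | move/QP/PP'].
by apply: flenS mx; apply: IH.
Qed.

Lemma flen_trans (M : grmod) (P Q R : gsub M) :
  flen P Q -> flen Q R -> flen P R.
Proof.
move=> h h'; elim: h' h => [{}Q {}R QR RQ|{}Q T {}R _ IH mx] PQ.
  exact: flen_eqr PQ QR RQ.
by apply: flenS mx; apply: IH.
Qed.

Lemma flen_img (M N : grmod) (f : corr M N) (P Q : gsub M) :
  flen P Q -> flen (cimg f P) (cimg f Q).
Proof.
have mono (R T : gsub M) : gsub_le R T -> gsub_le (cimg f R) (cimg f T).
  by move=> RT v [u /RT Tu fuv]; exists u.
elim=> [{}P {}Q PQ QP|{}P R {}Q _ IH [RQ _ mx]].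
  by apply: flen0; apply: mono.
case: (EM (gsub_le (cimg f Q) (cimg f R))) => [QR|nQR].
  by apply: flen_eqr IH _ QR; apply: mono.
apply: flenS IH _; split=> // [|T RT TQ]; first exact: mono.
pose T'm (u : M) := exists r s, [/\ R r, Q s, exists2 v, f s v & T v & u = r + s].
have T'0 : T'm 0.
  exists 0, 0; split; rewrite ?addr0 //; try exact: gmem0.
  by exists 0; [apply: crel0 | apply: gmem0].
have T'D u v : T'm u -> T'm v -> T'm (u + v).
  move=> [r [s [Rr Qs [w fsw Tw] ->]]] [r' [s' [Rr' Qs' [w' fsw' Tw'] ->]]].
  exists (r + r'), (s + s'); split; rewrite 1?addrACA //; try exact: gmemD.
  by exists (w + w'); [apply: crelD | apply: gmemD].
have T'Z a v : T'm v -> T'm (a *: v).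
  move=> [r [s [Rr Qs [w fsw Tw] ->]]].
  exists (a *: r), (a *: s); split; rewrite ?scalerDr //; try exact: gmemZ.
  by exists (a *: w); [apply: crelZ | apply: gmemZ].
have T'c d v : T'm v -> T'm (gcomp d v).
  move=> [r [s [Rr Qs [w fsw Tw] ->]]].
  exists (gcomp d r), (gcomp d s); split; rewrite ?gcompD //; try exact: gmem_comp.
  by exists (gcomp d w); [apply: crel_comp | apply: gmem_comp].
have RT' : gsub_le R (GSub T'0 T'D T'Z T'c).
  move=> u Ru; exists u, 0; split; rewrite ?addr0 //; first exact: gmem0.
  by exists 0; [apply: crel0 | apply: gmem0].
have T'Q : gsub_le (GSub T'0 T'D T'Z T'c) Q.
  by move=> _ [r [s [/RQ Qr Qs _ ->]]]; apply: gmemD.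
case: (mx _ RT' T'Q) => [T'R|QT'].
  left=> v Tv; have [u Qu fuv] := TQ v Tv; exists u => //; apply: T'R.
  by exists 0, u; split; rewrite ?add0r //; [apply: gmem0 | exists v].
right=> v [u Qu fuv]; have [r [s [Rr Qs [w fsw Tw] eu]]] := QT' u Qu.
rewrite -[v](subrK w); apply: gmemD Tw; apply: RT; exists r => //.
by have := crelB fuv fsw; rewrite eu addrK.
Qed.

Definition gsub_cap (M : grmod) (P Q : gsub M) : gsub M.
Proof.
refine (@GSub M (fun v => P v /\ Q v) _ _ _ _).
- by split; apply: gmem0.
- by move=> u v [Pu Qu] [Pv Qv]; split; apply: gmemD.
- by move=> a v [Pv Qv]; split; apply: gmemZ.
- by move=> d v [Pv Qv]; split; apply: gmem_comp.
Defined.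

Definition gsub_add (M : grmod) (P Q : gsub M) : gsub M.
Proof.
refine (@GSub M (fun v => exists u w, [/\ P u, Q w & v = u + w]) _ _ _ _).
- by exists 0, 0; split; rewrite ?addr0 //; apply: gmem0.
- move=> _ _ [u [w [Pu Qw ->]]] [u' [w' [Pu' Qw' ->]]].
  by exists (u + u'), (w + w'); split; rewrite 1?addrACA //; apply: gmemD.
- move=> a _ [u [w [Pu Qw ->]]].
  by exists (a *: u), (a *: w); split; rewrite ?scalerDr //; apply: gmemZ.
- move=> d _ [u [w [Pu Qw ->]]].
  by exists (gcomp d u), (gcomp d w); split; rewrite ?gcompD //; apply: gmem_comp.
Defined.

Definition cres (M : grmod) (P : gsub M) : corr M M.
Proof.
refine (@Corr M M (fun u v => u = v /\ P u) _ _ _ _).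
- by split=> //; apply: gmem0.
- by move=> u u' v v' [-> Pv] [-> Pv']; split=> //; apply: gmemD.
- by move=> a u v [-> Pv]; split=> //; apply: gmemZ.
- by move=> d u v [-> Pv]; split=> //; apply: gmem_comp.
Defined.

Definition cmod (M : grmod) (P : gsub M) : corr M M.
Proof.
refine (@Corr M M (fun u v => P (v - u)) _ _ _ _).
- by rewrite subr0; apply: gmem0.
- by move=> u u' v v' h h'; rewrite opprD addrACA; apply: gmemD.
- by move=> a u v h; rewrite -scalerBr; apply: gmemZ.
- move=> d u v h; rewrite -[- _]scaleN1r.
  have -> : -1 *: gcomp d u = gcomp d (- u).
    apply: (addrI (gcomp d u)); rewrite -gcompD subrr gcomp0.
    by rewrite scaleN1r subrr.
  by rewrite -gcompD; apply: gmem_comp.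
Defined.

Lemma flen_refl (M : grmod) (P : gsub M) : flen P P.
Proof. by apply: flen0. Qed.

Lemma flen_cap (M : grmod) (P Q : gsub M) :
  flen P (gsub_full M) -> flen Q (gsub_full M) -> flen (gsub_cap P Q) (gsub_full M).
Proof.
move=> /(flen_img (cres Q)) hP hQ; apply: flen_trans (hQ).
apply: flen_eqr; first apply: (flen_eql hP).
- by move=> v [u Pu [<- Qu]].
- by move=> v [Pv Qv]; exists v.
- by move=> v [u _ [<- Qu]].
- by move=> v Qv; exists v.
Qed.

Lemma flen_add (M : grmod) (P Q : gsub M) :
  flen (gsub_zero M) P -> flen (gsub_zero M) Q -> flen (gsub_zero M) (gsub_add P Q).
Proof.
move=> /(flen_img (cmod Q)) hP hQ; apply: flen_trans (hQ) _.
apply: flen_eqr; first apply: (flen_eql hP).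
- by move=> v [u ->] /=; rewrite subr0.
- by move=> v Qv; exists 0; rewrite //= subr0.
- by move=> v [u Pu Qvu]; exists u, (v - u); split=> //; rewrite addrC subrK.
- by move=> _ [u [w [Pu Qw ->]]]; exists u; rewrite //= addrC addKr.
Qed.

Lemma flen_pre (M N : grmod) (f : corr M N) (P : gsub N) :
  flen (cdom f) (gsub_full M) -> flen P (gsub_full N) ->
  flen (cimg (cinv f) P) (gsub_full M).
Proof. by move=> hf hP; apply: flen_trans hf; apply: flen_img. Qed.

Lemma flen_post (M N : grmod) (f : corr M N) (P : gsub M) :
  flen (gsub_zero N) (cker f) -> flen (gsub_zero M) P ->
  flen (gsub_zero N) (cimg f P).
Proof. by move=> hf hP; apply: flen_trans hf _; apply: flen_img. Qed.

Definition qcomp (M N K : grmod) (g : qhom N K) (f : qhom M N) : qhom M K.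
Proof.
refine (@QHom M K (ccomp g f) _ _).
- apply: flen_eql (flen_pre (qdom f) (qdom g)) _ _.
  + by move=> u [v [w _ gvw] fuv]; exists w => //; exists v.
  + by move=> u [w _ [v fuv gvw]]; exists v => //; exists w.
- apply: flen_eqr (flen_post (qker g) (qker f)) _ _.
  + by move=> w [v [u -> fuv] gvw]; exists 0 => //; exists v.
  + by move=> w [u -> [v fuv gvw]]; exists v => //; exists 0.
Defined.

Definition qgraph (M N : grmod) (f : {linear M -> N})
  (fc : forall d u, f (gcomp d u) = gcomp d (f u)) : qhom M N.
Proof.
refine (@QHom M N (cgraph fc) _ _).
- by apply: flen0 => // u _; exists (f u).
- apply: flen0 => v; first by move=> ->; exists 0; rewrite //= linear0.
  by move=> [u -> ->] /=; rewrite linear0.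
Defined.

Definition qid (M : grmod) : qhom M M.
Proof.
refine (@QHom M M (cid M) _ _).
- by apply: flen0 => // u _; exists u.
- by apply: flen0 => [v ->|v [u -> <-]] //; exists 0.
Defined.

Definition qzero (M N : grmod) : qhom M N.
Proof.
refine (@qgraph M N (\0%R : {linear M -> N}) _).
by move=> d u /=; rewrite gcomp0.
Defined.

Lemma qeq_refl (M N : grmod) (f : qhom M N) : qeq f f.
Proof.
exists (cdom f), (cker f); split; first by split; [apply: qdom | apply: qker].
  by split=> u.
move=> u v w _ fv fw; exists 0 => //.
by have := crelB fv fw; rewrite subrr.
Qed.

Lemma qeq_sym (M N : grmod) (f g : qhom M N) : qeq f g -> qeq g f.
Proof.
move=> [P [Q [h [hf hg] fg]]]; exists P, Q; split=> // u v w Pu gv fw.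
by rewrite -opprB; apply/gmemN/(fg u).
Qed.

Lemma qeq_trans (M N : grmod) (f g h : qhom M N) : qeq f g -> qeq g h -> qeq f h.
Proof.
move=> [P [Q [[hP hQ] [Pf Pg] fg]]] [P' [Q' [[hP' hQ'] [P'g P'h] gh]]].
exists (gsub_cap P P'), (gsub_add Q Q'); split.
- by split; [apply: flen_cap | apply: flen_add].
- by split=> u [Pu P'u]; [apply: Pf | apply: P'h].
- move=> u v w [Pu P'u] fv hw; have [x _ gx] := Pg u Pu.
  exists (v - x), (x - w); split; [exact: fg gx | exact: gh hw |].
  by rewrite addrA subrK.
Qed.

Lemma qcomp_congr (M N K : grmod) (g g' : qhom N K) (f f' : qhom M N) :
  qeq g g' -> qeq f f' -> qeq (qcomp g f) (qcomp g' f').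
Proof.
move=> [P2 [Q2 [[hP2 hQ2] [P2g P2g'] gg']]] [P1 [Q1 [[hP1 hQ1] [P1f P1f'] ff']]].
exists (gsub_cap P1 (gsub_cap (cimg (cinv f) P2) (cimg (cinv f') P2))).
exists (gsub_add (cimg g (cker f)) (gsub_add Q2 (cimg g' Q1))); split.
- split.
    by apply: flen_cap hP1 _; apply: flen_cap; apply: flen_pre => //; apply: qdom.
  by apply: flen_add; [|apply: flen_add hQ2 _]; apply: flen_post => //; apply: qker.
- split=> u [_ [[v P2v fuv] [v' P2v' fuv']]].
    by have [w _ gw] := P2g v P2v; exists w => //; exists v.
  by have [w _ gw] := P2g' v' P2v'; exists w => //; exists v'.
move=> u p p' [P1u [[n P2n fun_] _]] [n1 fun1 gn1p] [n1' fun1' gn1p'].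
have [q _ gnq] := P2g n P2n; have [q' _ gnq'] := P2g' n P2n.
exists (p - q), (q - p'); split; last by rewrite addrA subrK.
  exists (n1 - n); last exact: crelB.
  by exists 0 => //; rewrite -(subrr u); apply: crelB.
exists (q - q'), (q' - p'); split; last by rewrite addrA subrK.
  exact: gg' gnq gnq'.
by exists (n - n1'); [apply: ff' fun_ fun1' | apply: crelB].
Qed.

Lemma qeq_ext (M N : grmod) (f g : qhom M N) : (forall u v, f u v <-> g u v) -> qeq f g.
Proof.
move=> fg; have [P [Q [h [hf hf'] ff]]] := qeq_refl f.
exists P, Q; split=> //; first by split=> // u /hf[v _ /fg gv]; exists v.
by move=> u v w Pu fv /fg; apply: ff.
Qed.

Lemma qcompA (M N K H : grmod) (h : qhom K H) (g : qhom N K) (f : qhom M N) :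
  qeq (qcomp h (qcomp g f)) (qcomp (qcomp h g) f).
Proof.
apply: qeq_ext => u x; split.
- by move=> [w [v fv gw] hx]; exists v => //; exists w.
- by move=> [v fv [w gw hx]]; exists w => //; exists v.
Qed.

Lemma qcomp1l (M N : grmod) (f : qhom M N) : qeq (qcomp (qid N) f) f.
Proof. by apply: qeq_ext => u v; split=> [[w fw <-]|fv] //; exists v. Qed.

Lemma qcomp1r (M N : grmod) (f : qhom M N) : qeq (qcomp f (qid M)) f.
Proof. by apply: qeq_ext => u v; split=> [[w -> fw]|fv] //; exists u. Qed.

Lemma qcomp0l (M N K : grmod) (f : qhom M N) : qeq (qcomp (qzero N K) f) (qzero M K).
Proof.
exists (cdom f), (gsub_zero K); split.
- by split; [apply: qdom | apply: flen_refl].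
- split=> u [v _ fv]; last by exists 0.
  by exists 0 => //; exists v.
- by move=> u v w _ [x _ ->] ->; rewrite /= subrr.
Qed.

Lemma qcomp0r (M N K : grmod) (f : qhom N K) : qeq (qcomp f (qzero M N)) (qzero M K).
Proof.
exists (gsub_full M), (cker f); split.
- by split; [apply: flen_refl | apply: qker].
- split=> u _; last by exists 0.
  by exists 0 => //; exists 0 => //; apply: crel0.
- by move=> u v w _ [x -> fv] -> /=; rewrite subr0; exists 0.
Qed.

End GradedModules.

(* Categories with zero morphisms, whose hom-sets are setoids.                 *)
Record zcat := ZCat {
  obj :> Type;
  mor : obj -> obj -> Type;
  heq : forall X Y, mor X Y -> mor X Y -> Prop;
  idm : forall X, mor X X;
  compose : forall X Y Z, mor Y Z -> mor X Y -> mor X Z;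
  zmor : forall X Y, mor X Y;
  heq_refl : forall X Y (f : mor X Y), heq f f;
  heq_sym : forall X Y (f g : mor X Y), heq f g -> heq g f;
  heq_trans : forall X Y (f g h : mor X Y), heq f g -> heq g h -> heq f h;
  comp_congr : forall X Y Z (g g' : mor Y Z) (f f' : mor X Y),
    heq g g' -> heq f f' -> heq (compose g f) (compose g' f');
  compA : forall X Y Z W (h : mor Z W) (g : mor Y Z) (f : mor X Y),
    heq (compose h (compose g f)) (compose (compose h g) f);
  comp1l : forall X Y (f : mor X Y), heq (compose (idm Y) f) f;
  comp1r : forall X Y (f : mor X Y), heq (compose f (idm X)) f;
  comp0l : forall X Y Z (f : mor X Y), heq (compose (zmor Y Z) f) (zmor X Z);
  comp0r : forall X Y Z (f : mor Y Z), heq (compose f (zmor X Y)) (zmor X Z)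
}.

Declare Scope zcat_scope.
Delimit Scope zcat_scope with zcat.
Notation "f ≈ g" := (heq f g) (at level 70, no associativity) : zcat_scope.
Notation "g ∘ f" := (compose g f) (at level 40, left associativity) : zcat_scope.

Section CategoryNotions.
Local Open Scope zcat_scope.
Variable C : zcat.

Definition is_mono (X Y : C) (i : mor X Y) :=
  forall Z (g h : mor Z X), i ∘ g ≈ i ∘ h -> g ≈ h.

Definition invertible (X Y : C) (f : mor X Y) :=
  exists g : mor Y X, g ∘ f ≈ idm X /\ f ∘ g ≈ idm Y.

Definition isomorphic (X Y : C) := exists f : mor X Y, invertible f.

Definition is_zero (X : C) := idm X ≈ zmor _ _.

Definition is_kernel (X Y Z : C) (i : mor X Y) (g : mor Y Z) :=
  g ∘ i ≈ zmor _ _ /\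
  forall W (h : mor W Y), g ∘ h ≈ zmor _ _ ->
    exists u : mor W X, i ∘ u ≈ h /\ forall u' : mor W X, i ∘ u' ≈ h -> u' ≈ u.

Definition is_cokernel (X Y Z : C) (f : mor X Y) (p : mor Y Z) :=
  p ∘ f ≈ zmor _ _ /\
  forall W (h : mor Y W), h ∘ f ≈ zmor _ _ ->
    exists u : mor Z W, u ∘ p ≈ h /\ forall u' : mor Z W, u' ∘ p ≈ h -> u' ≈ u.

Definition short_exact (X Y Z : C) (f : mor X Y) (g : mor Y Z) :=
  is_kernel f g /\ is_cokernel f g.

Definition is_simple (X : C) :=
  ~ is_zero X /\
  forall Y (i : mor Y X), is_mono i -> is_zero Y \/ invertible i.

Inductive finite_length : C -> Prop :=
| finite_length0 X : is_zero X -> finite_length X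
| finite_lengthS X Y S (i : mor X Y) (p : mor Y S) :
    finite_length X -> short_exact i p -> is_simple S -> finite_length Y.

Definition is_direct_sum (J : Type) (F : J -> C) (S : C)
    (i : forall j, mor (F j) S) :=
  forall W (f : forall j, mor (F j) W),
    exists u : mor S W, (forall j, u ∘ i j ≈ f j) /\
      forall u' : mor S W, (forall j, u' ∘ i j ≈ f j) -> u' ≈ u.

Definition indecomposable (X : C) :=
  ~ is_zero X /\
  forall (F : bool -> C) (i : forall b, mor (F b) X),
    is_direct_sum i -> is_zero (F true) \/ is_zero (F false).

Definition sub_le (X Y Z : C) (i : mor X Z) (j : mor Y Z) :=
  exists u : mor X Y, j ∘ u ≈ i.

Definition maximal_sub (X Z : C) (i : mor X Z) :=
  [/\ is_mono i, ~ invertible i &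
      forall Y (j : mor Y Z), is_mono j -> sub_le i j -> sub_le j i \/ invertible j].

(* the intersection of the maximal subobjects *)
Definition is_radical (R X : C) (r : mor R X) :=
  [/\ is_mono r,
      forall Y (i : mor Y X), maximal_sub i -> sub_le r i &
      forall R' (r' : mor R' X), is_mono r' ->
        (forall Y (i : mor Y X), maximal_sub i -> sub_le r' i) -> sub_le r' r].

Definition is_top (X T : C) :=
  exists R (r : mor R X) (p : mor X T), is_radical r /\ is_cokernel r p.

(* K_0 is presented by the generators K0cls X and the relations of K0eq.        *)
Inductive K0term :=
| K0cls of C
| K0zero
| K0opp of K0term
| K0add of K0term & K0term.

Inductive K0eq : K0term -> K0term -> Prop :=
| K0eq_refl a : K0eq a a
| K0eq_sym a b : K0eq a b -> K0eq b a
| K0eq_trans a b c : K0eq a b -> K0eq b c -> K0eq a c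
| K0eq_opp a b : K0eq a b -> K0eq (K0opp a) (K0opp b)
| K0eq_add a a' b b' : K0eq a a' -> K0eq b b' -> K0eq (K0add a b) (K0add a' b')
| K0eq_addA a b c : K0eq (K0add a (K0add b c)) (K0add (K0add a b) c)
| K0eq_addC a b : K0eq (K0add a b) (K0add b a)
| K0eq_add0 a : K0eq (K0add K0zero a) a
| K0eq_addN a : K0eq (K0add (K0opp a) a) K0zero
| K0eq_exact X Y Z (f : mor X Y) (g : mor Y Z) :
    short_exact f g -> K0eq (K0cls Y) (K0add (K0cls X) (K0cls Z)).

Definition hall_sub (A B M U : C) (i : mor U M) :=
  [/\ is_mono i, isomorphic U B &
      exists Q (p : mor M Q), is_cokernel i p /\ isomorphic Q A].

(* F_{AB}^M = n: the subobjects U of M with U ≅ B and M/U ≅ A, up to equality   *)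
(* of subobjects, are enumerated without repetition by 'I_n.                    *)
Definition hall_number_is (A B M : C) (n : nat) :=
  exists (U : 'I_n -> C) (i : forall a, mor (U a) M),
    [/\ forall a, hall_sub A B (i a),
        forall a b, sub_le (i a) (i b) -> sub_le (i b) (i a) -> a = b &
        forall V (j : mor V M), hall_sub A B j ->
          exists a, sub_le j (i a) /\ sub_le (i a) j].

End CategoryNotions.

Section CoherentSheaves.
Variables (k : fieldType) (X : wpl k).

Definition coh : zcat :=
  @ZCat (grmod X) (@qhom k X) (@qeq k X) (@qid k X) (@qcomp k X) (@qzero k X)
    (@qeq_refl k X) (@qeq_sym k X) (@qeq_trans k X) (@qcomp_congr k X)
    (@qcompA k X) (@qcomp1l k X) (@qcomp1r k X) (@qcomp0l k X) (@qcomp0r k X).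

Definition line_bundle (M : coh) :=
  exists x : Lgrp X, @isomorphic coh M (shift (Osheaf X) x).

Definition torsion (M : coh) := finite_length M.

(* The closed points of P^1 over k: None is infinity, and Some h, with h monic  *)
(* irreducible, is the point of the affine line defined by h.                   *)
Definition closed_point (z : option {poly k}) : Prop :=
  if z is Some h then h \is monic /\ irreducible_poly h else True.

(* The equation of z in the homogeneous coordinates Y1 = X_1^p_1, Y2 = X_2^p_2  *)
(* of P^1. The affine coordinate is Y2 / Y1, so that for i >= 3 the equation    *)
(* Y2 - lambda_i * Y1 of the marked point lambda_i is X_i^p_i in A.             *)
Definition zform (z : option {poly k}) : Aalg X :=
  let Y1 := 'X_ord0 ^+ weight (ord0 : 'I_(npt X).+2) in
  let Y2 := 'X_(ord_snd X) ^+ weight (ord_snd X) in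
  Apr (if z is Some h
       then \sum_(j < size h) h`_j *: (Y2 ^+ j * Y1 ^+ ((size h).-1 - j))
       else Y1).

Definition zdeg (z : option {poly k}) : Lgrp X :=
  cvec X *+ (if z is Some h then (size h).-1 else 1).

Lemma Ahomog_zform z n : Ahomog (zdeg z *+ n) (zform z ^+ n).
Proof.
rewrite /zform /Apr -rmorphXn /=; eexists; last by [].
apply: phomog_exp; rewrite /zdeg; case: z => [h|]; last exact: phomogXU.
apply: phomog_sum => j _; apply: phomogZ.
have le_j : (j <= (size h).-1)%N by rewrite -ltnS (ltn_predK (ltn_ord j)).
rewrite -{1}(subnKC le_j) mulrnDr.
by apply: phomogM; apply/phomog_exp/phomogXU.
Qed.

Definition mul_by (M : grmod X) d (a : Aalg X) (ha : Ahomog d a) :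
  qhom M (shift M d).
Proof.
refine (@qgraph k X M (shift M d) ( *:%R a : {linear M -> M}) _).
by move=> e u /=; rewrite [e + d]addrC gcompZ.
Defined.

(* The torsion sheaves supported at z, i.e. those on which the equation of z,   *)
(* as a natural map S -> S(zdeg z), is nilpotent.                               *)
Definition tube (z : option {poly k}) (S : coh) :=
  torsion S /\
  exists n, @heq coh _ _ (mul_by S (Ahomog_zform z n)) (zmor _ _).

Definition distinct_tubes (m : nat) (S : 'I_m -> coh) :=
  exists z : 'I_m -> option {poly k},
    injective z /\ forall j, closed_point (z j) /\ tube (z j) (S j).

End CoherentSheaves.

(* Main.v *)
(* Write Y1, Y2 for the homogeneous coordinates X_1^p_1, X_2^p_2 of P^1. Since A
   is noetherian and A/(Y1^n, Y2^n) has finite length, a quotient Q/P of graded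
   modules has finite length iff each of its elements is killed by powers of Y1
   and of Y2; so morphisms, kernels and cokernels of coh X can be handled
   elementwise, up to such elements.

   A nonzero homogeneous element of A is a monomial times a binary form in Y1, Y2.
   Evaluating at points over an algebraic closure of k shows that every closed
   point z has a prime element, whose power is the equation of z, and that this
   prime and a homogeneous element not vanishing at z generate an ideal
   containing powers of Y1 and Y2.

   An indecomposable torsion sheaf is therefore killed by a power of one prime,
   and a cyclic submodule of maximal length splits off, so that it is cyclic.
   Hence it is a quotient of O(y) iff O(y) maps nontrivially to its top, and the
   kernel is then generated by a prime power. By the Chinese remainder theorem
   O(y) maps onto a sum of such sheaves in distinct tubes, with kernel O(y - D),
   where D is the degree of the product of the prime powers; two summands in the
   same tube would contradict Nakayama's lemma. The class of O(x) in K_0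
   determines x, because the number of elements of M_(d + n c), for n large, is
   multiplicative on exact sequences. As A is commutative, the kernel of
   O(y) -> S is the annihilator of S, so it is unique. *)
Require Import Defs.
From HB Require Import structures.
From mathcomp Require Import all_boot all_order all_algebra.
From mathcomp Require Import ring_quotient mpoly boolp closed_field zify ring.

Set Implicit Arguments.
Unset Strict Implicit.
Unset Printing Implicit Defensive.

Import GRing.Theory Num.Theory.
Local Open Scope ring_scope.
Local Open Scope quotient_scope.

(** * Noetherian modules *)

(** In [coh X] a morphism is a graded relation that is total and single-valued only up to finite
    length. Elementwise, [f] has a value at [Y ^+ n *: u] for large [n] rather than at [u], and two
    values differ by an element of [tors]. The proofs absorb the extra powers of Y1 and Y2 by
    showing membership in saturated submodules, where [sat_pow] permits multiplying by such powers
    first.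

    At a closed point [z] the substitute for localization is this: on a sheaf killed by a power of
    the prime at [z], every homogeneous element not vanishing at [z] acts invertibly in [coh X], and
    one of Y1, Y2 is such an element.

    Evaluation controls only homogeneous elements, so elements are first split into graded
    components.

    For K_0, rank and degree would not suffice, since [Lgrp X] may have torsion; counting M_D along
    every coset D + Zc recovers the element of [Lgrp X] itself. Finiteness of [k] makes the counts
    finite. *)

Section Noetherian.

Definition submod (R : nzRingType) (V : lmodType R) (N : V -> Prop) :=
  N 0 /\ forall a u v, N u -> N v -> N (a *: u + v).

Definition fingen (R : nzRingType) (V : lmodType R) (N : V -> Prop) :=
  exists n (e : 'I_n -> V), (forall i, N (e i)) /\
    forall v, N v -> exists a : 'I_n -> R, v = \sum_i a i *: e i.

Definition noetherian (R : nzRingType) (V : lmodType R) :=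
  forall N : V -> Prop, submod N -> fingen N.

Lemma submod_sum (R : nzRingType) (V : lmodType R) (N : V -> Prop) (I : finType)
    (a : I -> R) (e : I -> V) :
  submod N -> (forall i, N (e i)) -> N (\sum_i a i *: e i).
Proof.
by move=> [N0 NZ] Ne; elim/big_ind: _ => // [u v Nu Nv|i _];
  [rewrite -[u]scale1r; apply: NZ | rewrite -[_ *: _]addr0; apply: NZ].
Qed.

Lemma submodB (R : nzRingType) (V : lmodType R) (N : V -> Prop) u v :
  submod N -> N u -> N v -> N (u - v).
Proof. by move=> [_ NZ] Nu Nv; rewrite addrC -scaleN1r; apply: NZ. Qed.

(** Lifts of generators of the image, together with generators of the part of [N] in the kernel,
    generate [N]. *)
Lemma fingen_extension (R : nzRingType) (V W : lmodType R) (f : {linear V -> W})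
    (N : V -> Prop) :
  submod N -> fingen (fun w => exists2 v, N v & w = f v) ->
  fingen (fun v => N v /\ f v = 0) -> fingen N.
Proof.
move=> sN [n [e [Ne eP]]] [m [g [Ng gP]]].
have /choice[h hP] : forall i, exists v, N v /\ e i = f v.
  by move=> i; have [v ? ?] := Ne i; exists v.
exists (n + m)%N, (fun i => match split i with inl i => h i | inr j => g j end).
split=> [i|v Nv].
  by case: (split i) => j; [case: (hP j) | case: (Ng j)].
have [a fv] : exists a : 'I_n -> R, f v = \sum_i a i *: e i.
  by apply: eP; exists v.
have [|b bP] := gP (v - \sum_i a i *: h i).
  split; first by apply: submodB => //; apply: submod_sum => // i; case: (hP i).
  rewrite linearB /= linear_sum fv; apply/eqP; rewrite subr_eq0; apply/eqP/eq_bigr => i _.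
  by rewrite linearZ /=; case: (hP i) => _ <-.
exists (fun i => match split i with inl i => a i | inr j => b j end).
rewrite big_split_ord /=.
under eq_bigr => i _ do rewrite (unsplitK (inl i)).
under [X in _ + X]eq_bigr => i _ do rewrite (unsplitK (inr i)).
by rewrite -bP addrC subrK.
Qed.

(** Induction on the number [j] of leading coordinates allowed to be nonzero; reading off the last
    of them reduces to [R] and to fewer coordinates. *)
Lemma noetherian_rV (R : nzRingType) n :
  @noetherian R R^o -> @noetherian R 'rV[R]_n.
Proof.
move=> nR; have step j : (j <= n)%N -> forall N : 'rV[R]_n -> Prop, submod N ->
    (forall v, N v -> forall i : 'I_n, (j <= i)%N -> v 0 i = 0) -> fingen N.
  elim: j => [|j IH] ltj N sN N0.
    exists 0%N, (fun=> 0); split=> [[]//|v Nv]; exists (fun=> 0).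
    by rewrite big_ord0; apply/rowP => i; rewrite mxE N0.
  pose jo := Ordinal ltj.
  pose f (v : 'rV[R]_n) : R^o := v 0 jo.
  have fL : linear f by move=> a u v; rewrite /f !mxE.
  pose fl : {linear 'rV[R]_n -> R^o} := HB.pack f (GRing.isLinear.Build _ _ _ _ f fL).
  apply: (@fingen_extension _ _ _ fl) => //.
    apply: nR; split; first by exists 0; [case: sN | rewrite linear0].
    move=> a _ _ [u Nu ->] [v Nv ->]; exists (a *: u + v); first by case: sN => _; apply.
    by rewrite linearP.
  apply: IH; first exact: ltnW.
    split; first by split; [case: sN | rewrite linear0].
    move=> a u v [Nu fu] [Nv fv]; split; first by case: sN => _; apply.
    by rewrite linearP fu fv scaler0 addr0.
  move=> v [Nv fv] i; rewrite leq_eqVlt => /orP[/eqP ei|]; last exact: N0.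
  by rewrite -[RHS]fv /fl /= /f; congr (v 0 _); apply: val_inj.
by move=> N sN; apply: (step n) => // v _ i; rewrite leqNgt ltn_ord.
Qed.

(** Stated for a map semilinear over [phi], so that it serves both a quotient ring ([f] is [phi])
    and an image of a free module ([phi] is the identity). *)
Lemma fingen_image (R S : nzRingType) (phi : {rmorphism R -> S}) (V : lmodType R)
    (W : lmodType S) (f : V -> W) (N : W -> Prop) :
  noetherian V -> (forall u v, f (u + v) = f u + f v) ->
  (forall a u, f (a *: u) = phi a *: f u) ->
  submod N -> (forall w, N w -> exists v, w = f v) -> fingen N.
Proof.
move=> nV fD fZ [N0 NZ] surj.
have f0 : f 0 = 0 by have /eqP := fD 0 0; rewrite addr0 eq_sym addrC -subr_eq0 addrK => /eqP.
have [|n [e [Ne eP]]] := nV (fun v => N (f v)).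
  split; first by rewrite f0.
  by move=> a u v Nu Nv; rewrite fD fZ; apply: NZ.
exists n, (f \o e); split=> // w Nw; have [v ev] := surj w Nw.
have [|a ea] := eP v; first by rewrite -ev.
exists (phi \o a); rewrite ev ea (big_morph f fD f0).
by apply: eq_bigr => i _; rewrite fZ.
Qed.

Lemma noetherian_quotient (R S : nzRingType) (phi : {rmorphism R -> S}) :
  (forall s, exists r, s = phi r) -> @noetherian R R^o -> @noetherian S S^o.
Proof.
move=> surj nR N sN; apply: (@fingen_image R S phi R^o S^o phi) => //.
- exact: rmorphD.
- by move=> a u; rewrite /GRing.scale /= rmorphM.
Qed.

Lemma noetherian_field (F : fieldType) : @noetherian F F^o.
Proof.
move=> N [N0 NZ]; case: (EM (exists2 a, N a & a != 0)) => [[a Na a0]|H].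
  exists 1%N, (fun=> a); split=> // v Nv; exists (fun=> v / a).
  by rewrite big_ord1 /GRing.scale /= divfK.
exists 0%N, (fun=> 0); split=> // v Nv; exists (fun=> 0); rewrite big_ord0.
by apply/eqP; apply: contra_notT H => v0; exists v.
Qed.

Lemma hilbert_basis (R : comNzRingType) :
  @noetherian R R^o -> @noetherian {poly R} {poly R}^o.
Proof.
move=> nR I [I0 IZ].
have IM (a p : {poly R}) : I p -> I (a * p).
  by move=> Ip; rewrite -[_ * _]addr0; apply: IZ.
have ID (p q : {poly R}) : I p -> I q -> I (p + q).
  by move=> Ip Iq; rewrite -[p]mul1r; apply: IZ.
have Isum n (c e : 'I_n -> {poly R}) : (forall i, I (e i)) -> I (\sum_i c i * e i).
  by move=> Ie; apply: (big_ind I) => // i _; apply: IM.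
(* The ideal of leading coefficients. Since [d] may exceed the degree of [p], cancellation of
   leading terms in a sum does no harm. *)
pose J (a : R^o) := exists p d, [/\ I p, (size p <= d.+1)%N & p`_d = a].
have sJ : submod J.
  split; first by exists 0, 0%N; rewrite size_poly0 coef0.
  move=> a u v [p [d [Ip sp <-]]] [q [d' [Iq sq <-]]].
  exists (a%:P * ('X^d' * p) + 'X^d * q), (d + d')%N; split.
  - by apply: ID; do ?apply: (IM).
  - apply: leq_trans (size_polyD _ _) _; rewrite geq_max; apply/andP; split.
      rewrite mul_polyC; apply: leq_trans (size_scale_leq _ _) _.
      apply: leq_trans (size_polyMleq _ _) _; rewrite size_polyXn /=.
      by rewrite addnC -addSn leq_add2r.
    apply: leq_trans (size_polyMleq _ _) _; rewrite size_polyXn /=.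
    by rewrite -addnS leq_add2l.
  - by rewrite coefD coefCM !coefXnM !ltnNge leq_addr leq_addl /= addnK addKn.
have [n [a [Ja aP]]] := nR J sJ.
have /choice[p pP] : forall i, exists p, exists d, [/\ I p, (size p <= d.+1)%N & p`_d = a i] by exact: Ja.
have /choice[d dP] : forall i, exists d, [/\ I (p i), (size (p i) <= d.+1)%N & (p i)`_d = a i] by exact: pP.
pose D := \max_i d i.
(* The [p i] reduce degrees above [D]; the elements of [I] of degree at most [D] form a submodule of
   a free module of rank [D.+1]. *)
have [|m [g [gI gP]]] := (@noetherian_rV R D.+1 nR) (fun v => I (rVpoly v)).
  split; first by rewrite linear0.
  by move=> c u v Iu Iv; rewrite linearP /= -mul_polyC; apply: ID => //; apply: IM.
pose e (i : 'I_(n + m)) : {poly R}^o :=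
  match split i with inl i => p i | inr j => rVpoly (g j) end.
exists (n + m)%N, e; split=> [i|].
  by rewrite /e; case: (split i) => j; [case: (dP j) | apply: gI].
have split_sum (c : 'I_n -> {poly R}) (b : 'I_m -> {poly R}) :
    exists c' : 'I_(n + m) -> {poly R},
      \sum_i c i * p i + \sum_j b j * rVpoly (g j) = \sum_i c' i * e i.
  exists (fun i => match split i with inl i => c i | inr j => b j end).
  rewrite big_split_ord /e /=.
  under [X in _ = X + _]eq_bigr => i _ do rewrite (unsplitK (inl i)).
  by under [X in _ = _ + X]eq_bigr => i _ do rewrite (unsplitK (inr i)).
suff H s : forall v : {poly R}, (size v <= s)%N -> I v ->
    exists (c : 'I_n -> {poly R}) (b : 'I_m -> {poly R}),
      v = \sum_i c i * p i + \sum_j b j * rVpoly (g j).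
  move=> v Iv; have [c [b ->]] := H _ v (leqnn _) Iv.
  by have [c' ->] := split_sum c b; exists c'.
elim: s => [|s IH] v sv Iv.
  exists (fun=> 0), (fun=> 0).
  rewrite big1 => [|i _]; rewrite ?mul0r // big1 => [|i _]; rewrite ?mul0r // addr0.
  by apply/eqP; rewrite -size_poly_leq0.
case: (leqP s.+1 D.+1) => [sD|Ds].
  have [|b vb] := gP (poly_rV v).
    by rewrite poly_rV_K // (leq_trans sv).
  exists (fun=> 0), (fun j => (b j)%:P); rewrite big1 ?add0r => [|i _]; last by rewrite mul0r.
  rewrite -[LHS](@poly_rV_K _ D.+1) ?(leq_trans sv) // vb linear_sum.
  by apply: eq_bigr => j _; rewrite linearZ mul_polyC.
have [|c vc] := aP v`_s; first by exists v, s.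
(* This removes the coefficient of [v] in degree [s], which [c] expresses through the leading
   coefficients of the [p i]. *)
pose w := v - \sum_i ((c i)%:P * 'X^(s - d i)) * p i.
have ds i : (d i <= s)%N by apply: leq_trans (leq_bigmax i) _; rewrite -ltnS ltnW.
have szi i : (size ((c i)%:P * 'X^(s - d i) * p i)%R <= s.+1)%N.
  have [_ sp _] := dP i; rewrite -mulrA mul_polyC.
  apply: leq_trans (size_scale_leq _ _) _; apply: leq_trans (size_polyMleq _ _) _.
  by rewrite size_polyXn /= -(subnK (ds i)) addnK -addnS leq_add2l.
have sw : (size w <= s)%N.
  apply/leq_sizeP => j; rewrite leq_eqVlt => /orP[/eqP <-|lt].
    rewrite coefB coef_sum vc; apply/eqP; rewrite subr_eq0; apply/eqP/eq_bigr => i _.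
    rewrite -mulrA coefCM coefXnM ltnNge leq_subr /= subKn //.
    by case: (dP i) => _ _ ->.
  apply/(leq_sizeP _ _ _ j lt); apply: leq_trans (size_polyD _ _) _; rewrite size_polyN.
  rewrite geq_max sv /=; apply: leq_trans (size_sum _ _ _) _.
  by apply/bigmax_leqP => i _; apply: szi.
have [|c' [b wb]] := IH w sw.
  rewrite /w -mulN1r; apply: ID => //; apply: IM; apply: Isum => i.
  by case: (dP i).
exists (fun i => (c i)%:P * 'X^(s - d i) + c' i), b.
under eq_bigr do rewrite mulrDl.
by rewrite big_split /= -addrA -wb /w addrC subrK.
Qed.

(** A surjection from [{poly {mpoly F[n]}}], sending ['X] to the last variable, is enough to carry
    noetherianity over. *)
Lemma noetherian_mpoly (F : fieldType) n :
  @noetherian {mpoly F[n]} {mpoly F[n]}^o.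
Proof.
elim: n => [|n IH].
  apply: (@noetherian_quotient F {mpoly F[0]} (@mpolyC 0 F)); last exact: noetherian_field.
  move=> p; exists p@_0; apply/mpolyP => m; rewrite mcoeffC.
  have -> : m = 0%MM by apply/mnmP => - [].
  by rewrite eqxx mulr1.
have cm : commr_rmorph (@mwiden n F) ('X_ord_max) by move=> a; apply: mulrC.
apply: (@noetherian_quotient {poly {mpoly F[n]}} {mpoly F[n.+1]} (horner_morph cm));
  last exact: hilbert_basis.
move=> p; elim/mpolyind: p => [|c m p _ _ [r ->]]; first by exists 0; rewrite rmorph0.
suff [s es] : exists s, 'X_[m] = horner_morph cm s.
  by exists ((c%:MP)%:P * s + r); rewrite rmorphD rmorphM /= -es horner_morphC /= mwidenC mul_mpolyC.
rewrite mpolyXE_id; apply: (big_ind (fun q => exists s, q = horner_morph cm s)).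
- by exists 1; rewrite rmorph1.
- by move=> _ _ [s ->] [s' ->]; exists (s * s'); rewrite rmorphM.
move=> i _; suff [s es] : exists s, 'X_i = horner_morph cm s.
  by exists (s ^+ m i); rewrite rmorphXn /= es.
case: (unliftP ord_max i) => [j|] ->; last by exists 'X; rewrite horner_morphX.
exists ('X_j)%:P; rewrite horner_morphC /= mwidenX mnmwiden1; congr 'X_[U_(_)].
by apply: val_inj; rewrite /= /bump leqNgt ltn_ord.
Qed.

Lemma noetherian_fingen (R : comNzRingType) (V : lmodType R) :
  @noetherian R R^o -> fingen (fun _ : V => True) -> noetherian V.
Proof.
move=> nR [n [e [_ eP]]] N sN.
apply: (@fingen_image R R idfun 'rV[R]_n V (fun v => \sum_i v 0 i *: e i)) => //.
- exact: noetherian_rV.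
- by move=> u v; rewrite -big_split /=; apply: eq_bigr => i _; rewrite mxE scalerDl.
- by move=> a u; rewrite scaler_sumr; apply: eq_bigr => i _; rewrite mxE scalerA.
move=> w _; have [//|a ->] := eP w; exists (\row_i a i).
by apply: eq_bigr => i _; rewrite mxE.
Qed.

End Noetherian.

(** * The grading group *)

Section Degree.
Variables (k : finFieldType) (X : wpl k).
Local Notation t := (npt X).+2.
Local Notation L := (Lgrp X).

Definition cofactor_weight (i : 'I_t) : nat := \prod_(j < t | j != i) weight j.

Definition total_weight : nat := \prod_(j < t) weight j.

Lemma cofactor_weightE i : (weight i * cofactor_weight i)%N = total_weight.
Proof. by rewrite /total_weight (bigD1 i). Qed.

Lemma total_weight_gt0 : (0 < total_weight)%N.
Proof. by rewrite prodn_gt0 // => i; apply: weight_gt0. Qed.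

Lemma cofactor_weight_gt0 i : (0 < cofactor_weight i)%N.
Proof. by rewrite prodn_gt0 // => j; apply: weight_gt0. Qed.

(** The degree map of [Lgrp X], scaled by the product of all weights so that the degree 1 /
    [weight i] of [xvec i] becomes an integer. *)
Definition vdeg (v : 'rV[int]_t) : int := \sum_i v 0 i *+ cofactor_weight i.

Lemma vdegD u v : vdeg (u + v) = vdeg u + vdeg v.
Proof.
by rewrite /vdeg -big_split; apply: eq_bigr => i _; rewrite mxE mulrnDl.
Qed.

Lemma vdeg_delta i : vdeg (delta_mx 0 i) = cofactor_weight i.
Proof.
rewrite /vdeg (bigD1 i) //= mxE !eqxx big1 ?addr0 => [|j /negbTE nj].
  exact: natz.
by rewrite mxE eqxx nj mul0rn.
Qed.

Lemma vdeg0 : vdeg 0 = 0.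
Proof. by rewrite /vdeg big1 // => i _; rewrite mxE mul0rn. Qed.

Lemma vdegN u : vdeg (- u) = - vdeg u.
Proof. by apply/eqP; rewrite -addr_eq0 -vdegD addNr vdeg0. Qed.

Lemma vdegMn u n : vdeg (u *+ n) = vdeg u *+ n.
Proof. by elim: n => [|n IH]; rewrite ?mulr0n ?vdeg0 // !mulrS vdegD IH. Qed.

Lemma vdegMz u n : vdeg (u *~ n) = vdeg u *~ n.
Proof. by case: n => n; rewrite -?pmulrn ?NegzE ?mulrNz -?pmulrn ?vdegN vdegMn. Qed.

Lemma vdeg_sum (I : Type) (r : seq I) (F : I -> 'rV[int]_t) :
  vdeg (\sum_(i <- r) F i) = \sum_(i <- r) vdeg (F i).
Proof. exact: (big_morph vdeg vdegD vdeg0). Qed.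

Lemma Lrel_vdeg v : v \in @Lrel k X -> vdeg v = 0.
Proof.
move=> /asboolP[a ->]; rewrite vdeg_sum big1 // => i _; rewrite vdeg_sum big1 // => j _.
have e l : (cofactor_weight l : int) *+ weight l = total_weight.
  by rewrite -mulr_natr natz -PoszM mulnC cofactor_weightE.
by rewrite vdegMz vdegD vdegN !vdegMn !vdeg_delta !e subrr mul0rz.
Qed.

(** Makes each coordinate modulo its weight well defined on [Lgrp X]; together with the degree these
    residues separate its elements. *)
Lemma Lrel_dvd v i : v \in @Lrel k X -> (weight i %| (v 0%R i))%Z.
Proof.
move=> /asboolP[a ->]; rewrite summxE; apply: rpred_sum => j _.
rewrite summxE; apply: rpred_sum => l _; rewrite -scaler_int mxE; apply: dvdz_mull.
rewrite mxE [X in (_ + X)%R]mxE; apply: rpredB.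
  rewrite mulmxnE mxE eqxx /=; case: eqP => [<-|_]; last by rewrite mul0rn rpred0.
  by rewrite -[_ *+ _]mulr_natr mul1r natz dvdzz.
rewrite mulmxnE mxE eqxx /=; case: eqP => [<-|_]; last by rewrite mul0rn rpred0.
by rewrite -[_ *+ _]mulr_natr mul1r natz dvdzz.
Qed.

Definition ldeg (x : L) : int := vdeg (repr x).

Lemma ldeg_pi v : ldeg (\pi_(Quotient.quot (@Lrel k X)) v) = vdeg v.
Proof.
apply/eqP; rewrite -subr_eq0 -vdegN -vdegD; apply/eqP/Lrel_vdeg.
by rewrite Quotient.idealrBE reprK.
Qed.

Lemma ldegD x y : ldeg (x + y) = ldeg x + ldeg y.
Proof. by rewrite -[x]reprK -[y]reprK -raddfD /= !ldeg_pi vdegD. Qed.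

Lemma ldeg0 : ldeg 0 = 0.
Proof. by apply: (addrI (ldeg 0)); rewrite -ldegD !addr0. Qed.

Lemma ldegN x : ldeg (- x) = - ldeg x.
Proof. by apply/eqP; rewrite -addr_eq0 -ldegD addNr ldeg0. Qed.

Lemma ldegMn x n : ldeg (x *+ n) = ldeg x *+ n.
Proof. by elim: n => [|n IH]; rewrite ?mulr0n ?ldeg0 // !mulrS ldegD IH. Qed.

Lemma ldeg_xvec (i : 'I_t) : ldeg (xvec i) = cofactor_weight i.
Proof. by rewrite /xvec ldeg_pi vdeg_delta. Qed.

Lemma ldeg_cvec : ldeg (cvec X) = total_weight.
Proof.
rewrite /cvec ldegMn ldeg_xvec -(cofactor_weightE (ord0 : 'I_t)) mulnC.
by rewrite -mulr_natr natz.
Qed.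

Lemma ldeg_cvecMn n : ldeg (cvec X *+ n) = (total_weight * n)%N.
Proof. by rewrite (ldegMn (cvec X)) ldeg_cvec -mulr_natr natz. Qed.

Lemma ldeg_sum_xvec (l : 'I_t -> nat) :
  ldeg (\sum_i xvec i *+ l i) = (\sum_i l i * cofactor_weight i)%N :> int.
Proof.
rewrite (big_morph _ ldegD ldeg0) (big_morph Posz PoszD (erefl _)); apply: eq_bigr => i _.
by rewrite ldegMn ldeg_xvec -mulr_natr natz mulrC PoszM.
Qed.

Lemma wdegE (m : 'X_{1..t}) :
  wdeg m = \pi_(Quotient.quot (@Lrel k X)) (\row_i (m i : int)).
Proof.
rewrite /wdeg [X in \pi X](_ : _ = \sum_i (delta_mx 0 i *+ m i)).
  by rewrite raddf_sum /=; apply: eq_bigr => i _; rewrite raddfMn.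
apply/rowP => i; rewrite !mxE summxE (bigD1 i) //= mulmxnE mxE !eqxx big1 ?addr0.
  exact/esym/natz.
by move=> j nj; rewrite mulmxnE mxE eqxx eq_sym (negbTE nj) mul0rn.
Qed.

Lemma sum_xvecE (l : 'I_t -> nat) : \sum_i xvec i *+ l i = wdeg [multinom l i | i < t].
Proof. by apply: eq_bigr => i _; rewrite mnmE. Qed.

Lemma wdeg_mod (m m' : 'X_{1..t}) i : wdeg m = wdeg m' -> (m i = m' i %[mod weight i])%N.
Proof.
move=> e; have : (\row_i (m i : int)) - (\row_i (m' i : int)) \in @Lrel k X.
  by rewrite Quotient.idealrBE -!wdegE e.
move/Lrel_dvd => /(_ i); rewrite !mxE -eqz_mod_dvd => /eqP.
by rewrite !modz_nat => -[].
Qed.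

Lemma wdeg_divsum (m : 'X_{1..t}) :
  wdeg m = \sum_i xvec i *+ (m i %% weight i)%N + cvec X *+ (\sum_i m i %/ weight i)%N.
Proof.
rewrite /wdeg -sumrMnr -big_split /=; apply: eq_bigr => i _.
by rewrite {1}(divn_eq (m i) (weight i)) mulrnDr addrC mulnC mulrnA xvec_weight.
Qed.

Lemma cvecMn_inj n n' : cvec X *+ n = cvec X *+ n' -> n = n'.
Proof.
move=> /(congr1 ldeg); rewrite !ldeg_cvecMn => -[] /eqP.
by rewrite eqn_pmul2l ?total_weight_gt0 // => /eqP.
Qed.

(** The remainders agree by [wdeg_mod], and what is left is a multiple of [c], which has infinite
    order. Thus all monomials of a homogeneous polynomial give binary forms of one degree. *)
Lemma wdeg_div (m m' : 'X_{1..t}) : wdeg m = wdeg m' ->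
  (\sum_i m i %/ weight i = \sum_i m' i %/ weight i)%N.
Proof.
move=> e; have := e; rewrite !wdeg_divsum.
have -> : \sum_i xvec i *+ (m i %% weight i)%N = \sum_i xvec i *+ (m' i %% weight i)%N.
  by apply: eq_bigr => i _; rewrite (wdeg_mod i e).
by move/addrI/cvecMn_inj.
Qed.
End Degree.

(** * Homogeneous elements of the coordinate algebra *)

Section Homogeneous.
Variables (k : finFieldType) (X : wpl k).
Local Notation t := (npt X).+2.
Local Notation P := {mpoly k[t]}.
Local Notation A := (Aalg X).
Local Notation L := (Lgrp X).
Local Notation c := (cvec X).

HB.instance Definition _ := GRing.RMorphism.copy (@Apr k X)
  (\pi_({ideal_quot (@relI k X)}) : {rmorphism P -> A}).

Definition xgen (i : 'I_t) : A := Apr 'X_i.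
Definition Y1 : A := xgen ord0 ^+ weight (ord0 : 'I_t).
Definition Y2 : A := xgen (ord_snd X) ^+ weight (ord_snd X).
Definition kA (a : k) : A := Apr (a%:MP).

HB.instance Definition _ := GRing.RMorphism.copy kA
  (@Apr k X \o @mpolyC t k : {rmorphism k -> A}).

(* The binary form Y1^n b(Y2/Y1); meaningful only if size b <= n.+1. *)
Definition bform n (b : {poly k}) : A :=
  \sum_(j < n.+1) kA b`_j * (Y2 ^+ j * Y1 ^+ (n - j)).

(** [xgen i ^+ weight i] as a linear form in Y1, Y2, dehomogenized by Y1 = 1. At infinity the form
    is Y1 itself, hence the constant 1. *)
Definition lin (i : 'I_t) : {poly k} :=
  if i == ord0 then 1 else 'X - (odflt 0 (point i))%:P.

Lemma size_lin i : (size (lin i) <= 2)%N.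
Proof. by rewrite /lin; case: ifP => _; rewrite ?size_poly1 ?size_XsubC. Qed.

Lemma lin_neq0 i : lin i != 0.
Proof. by rewrite /lin; case: ifP => _; rewrite ?oner_eq0 ?polyXsubC_eq0. Qed.

Lemma bform1E b : bform 1 b = kA b`_0 * Y1 + kA b`_1 * Y2.
Proof. by rewrite /bform !big_ord_recl big_ord0 /= !expr0 !expr1 mul1r mulr1 addr0. Qed.

Lemma xgen_weight i : xgen i ^+ weight i = bform 1 (lin i).
Proof.
rewrite bform1E /lin; case: eqP => [->|/eqP ni].
  by rewrite !coef1 /= rmorph1 rmorph0 mul1r mul0r addr0.
rewrite !coefB !coefX !coefC /= sub0r subr0 rmorph1 mul1r rmorphN mulNr.
case: (eqVneq i (ord_snd X)) => [->|ns].
  by rewrite (@point_snd _ X) // rmorph0 mul0r oppr0 add0r.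
have ge2 : (2 <= i)%N.
  by case: i ni ns => [[|[|i]] hi] //; rewrite -val_eqE.
have : Defs.frel i \in @relI k X.
  apply/asboolP; exists (fun j => (j == i)%:R); rewrite (bigD1 i) //= eqxx mul1r.
  by rewrite big1 ?addr0 // => j /andP[_ /negbTE ->]; rewrite mul0r.
rewrite -[Defs.frel i]subr0 -Apr_eq rmorph0 /Defs.frel => /eqP.
rewrite rmorphD rmorphB -mul_mpolyC rmorphM !rmorphXn /= -/(kA _) -/(xgen _) -/(xgen _) -/(xgen _).
rewrite -/Y1 -/Y2 => /eqP; rewrite addrAC subr_eq0 => /eqP <-.
by rewrite [RHS]addrC addrK.
Qed.

Lemma bformD n b b' : bform n (b + b') = bform n b + bform n b'.
Proof.
rewrite /bform -big_split /=; apply: eq_bigr => j _.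
by rewrite coefD rmorphD mulrDl.
Qed.

Lemma bform0 n : bform n 0 = 0.
Proof. by rewrite /bform big1 // => j _; rewrite coef0 rmorph0 mul0r. Qed.

Lemma bformZ n a (b : {poly k}) : bform n (a *: b) = kA a * bform n b.
Proof.
by rewrite /bform mulr_sumr; apply: eq_bigr => j _; rewrite coefZ rmorphM -mulrA.
Qed.

Lemma bform_sum n (I : Type) (r : seq I) (F : I -> {poly k}) :
  bform n (\sum_(i <- r) F i) = \sum_(i <- r) bform n (F i).
Proof. exact: (big_morph (bform n) (bformD n) (bform0 n)). Qed.

Lemma bformXn n j : (j <= n)%N -> bform n 'X^j = Y2 ^+ j * Y1 ^+ (n - j).
Proof.
move=> lejn; rewrite /bform (bigD1 (Ordinal (lejn : j < n.+1)%N)) //= coefXn eqxx rmorph1 mul1r.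
rewrite big1 ?addr0 // => i; rewrite -val_eqE /= coefXn => /negbTE ->.
by rewrite rmorph0 mul0r.
Qed.

Lemma bform01 : bform 0 1 = 1.
Proof. by have := @bformXn 0 0 isT; rewrite !expr0 mulr1. Qed.

Lemma bformM n m (b b' : {poly k}) : (size b <= n.+1)%N -> (size b' <= m.+1)%N ->
  bform n b * bform m b' = bform (n + m) (b * b').
Proof.
move=> sb sb'.
have exp (d : {poly k}) l : (size d <= l.+1)%N -> d = \sum_(i < l.+1) d`_i *: 'X^i.
  move=> sd; rewrite -poly_def; apply/polyP => i; rewrite coef_poly.
  by case: ltnP => // li; rewrite nth_default // (leq_trans sd).
rewrite (exp _ _ sb) (exp _ _ sb') [X in bform (n + m) X]mulr_suml !bform_sum mulr_suml.
apply: eq_bigr => i _; rewrite [X in bform (n + m) X]mulr_sumr bform_sum mulr_sumr.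
apply: eq_bigr => j _.
have li : (i <= n)%N by rewrite -ltnS.
have lj : (j <= m)%N by rewrite -ltnS.
rewrite -scalerAl -scalerAr !bformZ -exprD !bformXn ?leq_add //.
rewrite mulrACA -!mulrA; congr (_ * (_ * _)).
have -> : (n + m - (i + j) = n - i + (m - j))%N by lia.
by rewrite !exprD -!mulrA; congr (_ * _); rewrite mulrCA.
Qed.

Lemma size_exp_leS (b : {poly k}) n q : (size b <= n.+1)%N -> (size (b ^+ q) <= (n * q).+1)%N.
Proof.
move=> sb; apply: leq_trans (size_poly_exp_leq _ _) _.
rewrite ltnS leq_mul2r; apply/orP; right; lia.
Qed.

Lemma size_mul_leS (b b' : {poly k}) n m : (size b <= n.+1)%N -> (size b' <= m.+1)%N ->
  (size (b * b')%R <= (n + m).+1)%N.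
Proof. by move=> sb sb'; apply: leq_trans (size_polyMleq _ _) _; lia. Qed.

Lemma bform_exp n (b : {poly k}) q : (size b <= n.+1)%N -> bform n b ^+ q = bform (n * q) (b ^+ q).
Proof.
move=> sb; elim: q => [|q IH].
  by rewrite !expr0 muln0 bform01.
by rewrite exprS IH bformM ?size_exp_leS // mulnS exprS.
Qed.

Lemma bform_prod (I : Type) (r : seq I) (n : I -> nat) (b : I -> {poly k}) :
  (forall i, size (b i) <= (n i).+1)%N ->
  (size (\prod_(i <- r) b i)%R <= (\sum_(i <- r) n i).+1)%N /\
  \prod_(i <- r) bform (n i) (b i) = bform (\sum_(i <- r) n i) (\prod_(i <- r) b i).
Proof.
move=> sb; elim: r => [|i r [IH1 IH2]].
  by rewrite !big_nil size_poly1 bform01.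
by rewrite !big_cons IH2 bformM // size_mul_leS.
Qed.

Definition xmon (l : 'I_t -> nat) : A := \prod_i xgen i ^+ l i.

Lemma AprX m : Apr 'X_[m] = xmon m.
Proof. by rewrite mpolyXE_id rmorph_prod; apply: eq_bigr => i _; rewrite rmorphXn. Qed.

Definition linprod (q : 'I_t -> nat) : {poly k} := \prod_i lin i ^+ q i.

Lemma size_linprod q : (size (linprod q) <= (\sum_i q i).+1)%N.
Proof.
have [|//] := @bform_prod _ (index_enum 'I_t) q (fun i => lin i ^+ q i).
by move=> i; rewrite -{2}[q i]mul1n; apply: size_exp_leS; apply: size_lin.
Qed.

Lemma xmon_weight q : xmon (fun i => weight i * q i)%N = bform (\sum_i q i) (linprod q).
Proof.
have [|_ <-] := @bform_prod _ (index_enum 'I_t) q (fun i => lin i ^+ q i).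
  by move=> i; rewrite -{2}[q i]mul1n; apply: size_exp_leS; apply: size_lin.
apply: eq_bigr => i _; rewrite exprM xgen_weight bform_exp ?size_lin //.
by rewrite mul1n.
Qed.

Lemma xmonD l l' : xmon (fun i => l i + l' i)%N = xmon l * xmon l'.
Proof. by rewrite -big_split; apply: eq_bigr => i _; rewrite exprD. Qed.

Lemma eq_xmon l l' : l =1 l' -> xmon l = xmon l'.
Proof. by move=> e; apply: eq_bigr => i _; rewrite e. Qed.

(** Each exponent is divided by its weight. The remainders and the total of the quotients depend
    only on the degree, so one monomial [xmon l] factors out, and the powers of [xgen i ^+ weight i]
    left over are products of linear forms. *)
Lemma phomog_normal_form d (p : P) : phomog d p -> p = 0 \/
  exists l n (b : {poly k}), [/\ forall i, (l i < weight i)%N, (size b <= n.+1)%N,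
    Apr p = xmon l * bform n b & d = \sum_i xvec i *+ l i + c *+ n].
Proof.
case e0 : (msupp p) => [|m0 s] hp.
  by left; apply/eqP; rewrite -msupp_eq0 e0.
right; pose n := (\sum_i m0 i %/ weight i)%N.
pose l i := (m0 i %% weight i)%N; have m0p : m0 \in msupp p by rewrite e0 mem_head.
exists l, n, (\sum_(m <- msupp p) p@_m *: linprod (fun i => m i %/ weight i)%N).
have md m : m \in msupp p -> wdeg m = wdeg m0 by move=> /hp->; rewrite hp.
split=> [i||| ].
- by rewrite ltn_mod weight_gt0.
- apply: leq_trans (size_sum _ _ _) _; apply/bigmax_leqP_seq => m mp _.
  apply: leq_trans (size_scale_leq _ _) _.
  by rewrite /n -(wdeg_div (md m mp)) size_linprod.
- rewrite bform_sum mulr_sumr {1}[p]mpolyE rmorph_sum; apply: eq_big_seq => m mp.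
  rewrite -mul_mpolyC rmorphM /= -/(kA _) AprX bformZ mulrCA; congr (_ * _).
  rewrite /n -(wdeg_div (md m mp)) -xmon_weight -xmonD; apply: eq_xmon => i.
  by rewrite /l -(wdeg_mod i (md m mp)) addnC mulnC -divn_eq.
- by rewrite -(hp _ m0p) wdeg_divsum.
Qed.

Lemma normal_form d (a : A) : Ahomog d a -> a != 0 ->
  exists l n (b : {poly k}), [/\ forall i, (l i < weight i)%N, (size b <= n.+1)%N,
    a = xmon l * bform n b & d = \sum_i xvec i *+ l i + c *+ n].
Proof.
move=> [p hp ->] np0; have [p0|//] := phomog_normal_form hp.
by rewrite p0 rmorph0 eqxx in np0.
Qed.

Lemma Ahomog0 d : Ahomog d (0 : A).
Proof. by exists 0; [apply: phomog0 | rewrite rmorph0]. Qed.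

Lemma Ahomog1 : Ahomog 0 (1 : A).
Proof. by exists 1; [apply: phomog1 | rewrite rmorph1]. Qed.

Lemma AhomogD d (a b : A) : Ahomog d a -> Ahomog d b -> Ahomog d (a + b).
Proof. by move=> [p hp ->] [q hq ->]; exists (p + q); [apply: phomogD | rewrite rmorphD]. Qed.

Lemma AhomogM d e (a b : A) : Ahomog d a -> Ahomog e b -> Ahomog (d + e) (a * b).
Proof. by move=> [p hp ->] [q hq ->]; exists (p * q); [apply: phomogM | rewrite rmorphM]. Qed.

Lemma AhomogX d (a : A) n : Ahomog d a -> Ahomog (d *+ n) (a ^+ n).
Proof. by move=> [p hp ->]; exists (p ^+ n); [apply: phomog_exp | rewrite rmorphXn]. Qed.

Lemma Ahomog_comp d (a : A) : Ahomog d (Acomp d a).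
Proof. by exists (Defs.pcomp d (repr a)); first exact: phomog_pcomp. Qed.

Lemma Acomp_id d (a : A) : Ahomog d a -> Acomp d a = a.
Proof. by move=> [p hp ->]; rewrite AcompE (pcomp_homog _ hp) eqxx. Qed.

Lemma Acomp0 d : Acomp d (0 : A) = 0.
Proof. exact/Acomp_id/Ahomog0. Qed.

Lemma Ahomog_kA a : Ahomog 0 (kA a).
Proof.
exists a%:MP => //; rewrite -[a%:MP]mulr1 mul_mpolyC.
by apply: phomogZ; apply: phomog1.
Qed.

Lemma Ahomog_xgen i : Ahomog (xvec i) (xgen i).
Proof. by exists 'X_i => //; rewrite -wdegU; apply: phomogX. Qed.

Lemma Ahomog_xmon l : Ahomog (\sum_i xvec i *+ l i) (xmon l).
Proof.
rewrite sum_xvecE; exists 'X_[[multinom l i | i < t]]; first exact: phomogX.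
by rewrite AprX; apply: eq_xmon => i; rewrite mnmE.
Qed.

Lemma Ahomog_Y1 : Ahomog c Y1.
Proof. by rewrite -(xvec_weight (ord0 : 'I_t)); apply/AhomogX/Ahomog_xgen. Qed.

Lemma Ahomog_Y2 : Ahomog c Y2.
Proof. by rewrite -(xvec_weight (ord_snd X)); apply/AhomogX/Ahomog_xgen. Qed.

Lemma Ahomog_bform n b : Ahomog (c *+ n) (bform n b).
Proof.
rewrite /bform; elim/big_ind: _ => [||j _]; [exact: Ahomog0 | exact: AhomogD |].
have lj : (j <= n)%N by rewrite -ltnS.
rewrite -[c *+ n]add0r -{1}(subnKC lj) mulrnDr; apply: AhomogM; first exact: Ahomog_kA.
by apply: AhomogM; apply: AhomogX; [apply: Ahomog_Y2 | apply: Ahomog_Y1].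
Qed.

Lemma Ahomog_ldeg_ge0 d (a : A) : Ahomog d a -> a != 0 -> 0 <= ldeg d.
Proof.
move=> ha a0; have [l [n [b [_ _ _ ->]]]] := normal_form ha a0.
by rewrite ldegD ldeg_sum_xvec ldeg_cvecMn.
Qed.

(** In [Y2 ^+ j * Y1 ^+ (n - j)] one of the exponents is at least [N] as soon as [n] is at least
    [N + N]. *)
Lemma bform_Ypow N n (b : {poly k}) : (N + N <= n)%N ->
  exists r s, bform n b = r * Y1 ^+ N + s * Y2 ^+ N.
Proof.
move=> leN; rewrite /bform; elim/big_ind: _ => [||j _].
- by exists 0, 0; rewrite !mul0r addr0.
- by move=> _ _ [r [s ->]] [r' [s' ->]]; exists (r + r'), (s + s'); rewrite (mulrDl r r' (Y1 ^+ N)) (mulrDl s s' (Y2 ^+ N)) addrACA.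
case: (leqP N j) => lj.
  exists 0, (kA b`_j * (Y2 ^+ (j - N) * Y1 ^+ (n - j))).
  have -> : Y2 ^+ j = Y2 ^+ (j - N) * Y2 ^+ N by rewrite -exprD subnK.
  by rewrite mul0r add0r -!mulrA; do 2 congr (_ * _); rewrite mulrC.
exists (kA b`_j * (Y2 ^+ j * Y1 ^+ (n - j - N))), 0.
have -> : Y1 ^+ (n - j) = Y1 ^+ (n - j - N) * Y1 ^+ N by rewrite -exprD subnK //; lia.
by rewrite mul0r addr0 -!mulrA.
Qed.

Lemma xgen_Ypow N i : exists r s,
  xgen i ^+ (weight i * (N + N)) = r * Y1 ^+ N + s * Y2 ^+ N.
Proof.
rewrite exprM xgen_weight bform_exp ?size_lin // mul1n.
exact: bform_Ypow.
Qed.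

Lemma Ahomog_Ypow x N : exists n0, forall n (a : A), (n0 <= n)%N ->
  Ahomog (x + c *+ n) a -> exists r s, a = r * Y1 ^+ N + s * Y2 ^+ N.
Proof.
(* Since [l i < weight i], the monomial part has degree at most [t] times that of [c], and the last
   summand outweighs the degree of [x]. What remains forces a form of degree at least [N + N]. *)
exists (N + N + t + `|ldeg x|)%N => n a len ha.
have [->|a0] := eqVneq a 0; first by exists 0, 0; rewrite !mul0r addr0.
have [l [m [b [lw sb -> e]]]] := normal_form ha a0.
have [|r [s ->]] := @bform_Ypow N m b; last first.
  by exists (xmon l * r), (xmon l * s); rewrite mulrDr -mulrA -mulrA.
have := congr1 (@ldeg k X) e; rewrite !ldegD ldeg_sum_xvec !ldeg_cvecMn.
have : (\sum_i l i * cofactor_weight i <= t * total_weight X)%N.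
  rewrite -[t in (_ <= t * _)%N]card_ord -sum_nat_const; apply: leq_sum => i _.
  by rewrite -(cofactor_weightE i) leq_mul2r ltnW ?lw ?orbT.
have := total_weight_gt0 X; nia.
Qed.
End Homogeneous.

(** * Geometric points and prime elements *)

Section ClosedPoints.
Variables (k : finFieldType) (X : wpl k).
Local Notation t := (npt X).+2.
Local Notation A := (Aalg X).
Local Notation L := (Lgrp X).
Local Notation c := (cvec X).

Definition mark (i : 'I_t) : option {poly k} :=
  if i == ord0 then None else Some ('X - (odflt 0 (point i))%:P).

Definition zlin (z : option {poly k}) : {poly k} := odflt 1 z.
Definition znum (z : option {poly k}) : nat := if z is Some h then (size h).-1 else 1.

Lemma size_zlin z : (size (zlin z) <= (znum z).+1)%N.
Proof. by case: z => [h|] /=; rewrite ?size_poly1 // leqSpred. Qed.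

Lemma zlin_mark i : zlin (mark i) = lin i.
Proof. by rewrite /mark /lin; case: ifP. Qed.

Lemma znum_mark i : znum (mark i) = 1%N.
Proof. by rewrite /mark /znum; case: ifP; rewrite ?size_XsubC. Qed.

Lemma mark_inj : injective mark.
Proof.
move=> i j; rewrite /mark.
case: (eqVneq i ord0) => [->|ni]; case: (eqVneq j ord0) => [->|nj] //.
move=> [] /(congr1 (fun p : {poly k} => p`_0)); rewrite !coefB !coefX !coefC !sub0r /=.
have pS (l : 'I_t) : l != ord0 -> point l = Some (odflt 0 (point l)).
  case e : (point l) => // l0; case/eqP: l0; apply: (@point_inj _ X).
  by rewrite e (@point_fst _ X).
by move=> /oppr_inj e; apply: (@point_inj _ X); rewrite (pS _ ni) (pS _ nj) e.
Qed.

Lemma closed_point_size h : closed_point (Some h : option {poly k}) -> (1 < size h)%N.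
Proof. by move=> [_ []]. Qed.

Lemma znum_gt0 z : closed_point z -> (0 < znum z)%N.
Proof. by case: z => [h /closed_point_size|] //=; case: (size h) => [|[]]. Qed.

Lemma zform_form z : closed_point z -> zform X z = bform X (znum z) (zlin z).
Proof.
case: z => [h /closed_point_size sh|_]; rewrite /zform.
  rewrite rmorph_sum /bform /= (ltn_predK sh); apply: eq_bigr => j _.
  by rewrite -mul_mpolyC rmorphM rmorphM !rmorphXn.
by rewrite bform1E !coef1 /= rmorph1 rmorph0 mul1r mul0r addr0 rmorphXn.
Qed.

Lemma zform_mark i : zform X (mark i) = xgen i ^+ weight i.
Proof.
rewrite zform_form; first by rewrite znum_mark zlin_mark xgen_weight.
rewrite /mark; case: ifP => //= _; rewrite monicXsubC; split=> //.
exact: irredp_XsubC.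
Qed.

Definition pindex (z : option {poly k}) : option 'I_t := [pick i | mark i == z].

(* The prime element at z: the equation of z is its pexp-th power. *)
Definition pelt z : A := if pindex z is Some i then xgen i else zform X z.
Definition pexp z : nat := if pindex z is Some i then weight i else 1.
Definition pdeg z : L := if pindex z is Some i then xvec i else zdeg X z.

Lemma pexp_gt0 z : (0 < pexp z)%N.
Proof. by rewrite /pexp; case: pindex => // i; apply: weight_gt0. Qed.

Lemma zform_pelt z : zform X z = pelt z ^+ pexp z.
Proof.
rewrite /pelt /pexp /pindex; case: pickP => // i /eqP <-.
by rewrite zform_mark.
Qed.

Lemma pelt_mark i : pelt (mark i) = xgen i.
Proof.
rewrite /pelt /pindex; case: pickP => [j /eqP/mark_inj -> //|/(_ i)].
by rewrite eqxx.
Qed.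

Lemma Ahomog_pelt z : Ahomog (pdeg z) (pelt z).
Proof.
rewrite /pelt /pdeg; case: pindex => [i|]; first exact: Ahomog_xgen.
by have := Ahomog_zform X z 1; rewrite mulr1n expr1.
Qed.

(** * Evaluation at geometric points *)

Section Evaluation.
Variables (K : closedFieldType) (iota : {rmorphism k -> K}).

(** The value that X_i^p_i must take at a point with homogeneous coordinates Y1 = [y.1], Y2 =
    [y.2]. *)
Definition ell (y : K * K) (i : 'I_t) : K :=
  if i == ord0 then y.1 else y.2 - iota (odflt 0 (point i)) * y.1.

Lemma root_exists (a : K) n : (0 < n)%N -> exists x, x ^+ n = a.
Proof.
case: n => // n _.
have [x ex] := @solve_monicpoly K n.+1 (fun i => if i == 0%N then a else 0) isT.
exists x; rewrite ex big_ord_recl /= expr0 mulr1 big1 ?addr0 // => i _.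
by rewrite mul0r.
Qed.

Lemma coord_exists y : exists r : 'I_t -> K, forall i, r i ^+ weight i = ell y i.
Proof.
have /choice[r rP] : forall i, exists x, x ^+ weight i = ell y i.
  by move=> i; apply: root_exists; apply: weight_gt0.
by exists r.
Qed.

Definition coord y : 'I_t -> K := sval (cid (coord_exists y)).

Lemma coordE y i : coord y i ^+ weight i = ell y i.
Proof. by rewrite /coord; case: cid. Qed.

(** A ring homomorphism from A to [K]: [ev_Apr] shows independence of the representative, because
    the chosen roots [coord y] satisfy every relation f_i. *)
Definition ev y (a : A) : K := mmap iota (coord y) (repr a).

Lemma ev_Apr y p : ev y (Apr p) = mmap iota (coord y) p.
Proof.
apply/eqP; rewrite /ev -subr_eq0 -rmorphB /=; apply/eqP.
have : repr (Apr p) - p \in @relI k X by rewrite -Apr_eq Apr_repr.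
move=> /asboolP[g ->]; rewrite rmorph_sum big1 //= => i ge2.
rewrite rmorphM /= /Defs.frel rmorphD rmorphB /= mmapZ !rmorphXn /= !mmapX !mmap1U !coordE.
rewrite /ell; case: eqP => [e|_]; first by rewrite e in ge2.
have -> : ord_snd X == ord0 = false by [].
have -> : odflt 0 (point (ord_snd X)) = 0 by rewrite (@point_snd _ X).
by rewrite eqxx rmorph0 mul0r subr0 addrAC subrK subrr mulr0.
Qed.

Lemma evD y a b : ev y (a + b) = ev y a + ev y b.
Proof. by rewrite -(Apr_repr a) -(Apr_repr b) -AprD !ev_Apr rmorphD. Qed.

Lemma evM y a b : ev y (a * b) = ev y a * ev y b.
Proof. by rewrite -(Apr_repr a) -(Apr_repr b) -AprM !ev_Apr rmorphM. Qed.

Lemma ev1 y : ev y 1 = 1.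
Proof. by rewrite -[1 : A](rmorph1 (@Apr k X)) ev_Apr rmorph1. Qed.

Lemma ev0 y : ev y 0 = 0.
Proof. by rewrite -[0 : A](rmorph0 (@Apr k X)) ev_Apr rmorph0. Qed.

Lemma evX y a n : ev y (a ^+ n) = ev y a ^+ n.
Proof. by elim: n => [|n IH]; rewrite ?expr0 ?ev1 // !exprS evM IH. Qed.

Lemma ev_kA y a : ev y (kA X a) = iota a.
Proof. by rewrite /kA ev_Apr mmapC. Qed.

Lemma ev_xgen y i : ev y (xgen i) = coord y i.
Proof. by rewrite /xgen ev_Apr mmapX mmap1U. Qed.

Lemma ev_prod y (F : 'I_t -> A) : ev y (\prod_i F i) = \prod_i ev y (F i).
Proof. exact: (big_morph (ev y) (evM y) (ev1 y)). Qed.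

Lemma ev_Y1 y : ev y (Y1 X) = y.1.
Proof. by rewrite /Y1 evX ev_xgen coordE. Qed.

Lemma ev_Y2 y : ev y (Y2 X) = y.2.
Proof.
rewrite /Y2 evX ev_xgen coordE /ell.
have -> : odflt 0 (point (ord_snd X)) = 0 by rewrite (@point_snd _ X).
by rewrite rmorph0 mul0r subr0.
Qed.

Lemma ev_bform y n b :
  ev y (bform X n b) = \sum_(j < n.+1) iota b`_j * (y.2 ^+ j * y.1 ^+ (n - j)).
Proof.
rewrite /bform (big_morph (ev y) (evD y) (ev0 y)); apply: eq_bigr => j _.
by rewrite !evM (evX y (Y1 X)) (evX y (Y2 X)) ev_kA ev_Y1 ev_Y2.
Qed.

Lemma ev_bform_affine x n (b : {poly k}) : (size b <= n.+1)%N ->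
  ev (1, x) (bform X n b) = (map_poly iota b).[x].
Proof.
move=> sb; rewrite ev_bform (@horner_coef_wide _ n.+1) ?size_map_poly //.
by apply: eq_bigr => j _; rewrite /= expr1n mulr1 coef_map.
Qed.

Lemma ev_bform_infty n (b : {poly k}) : ev (0, 1) (bform X n b) = iota b`_n.
Proof.
rewrite ev_bform big_ord_recr /= subnn expr0 expr1n !mulr1 big1 ?add0r // => j _.
by rewrite /= expr0n subn_eq0 leqNgt ltn_ord mulr0 mulr0.
Qed.

Definition zpt_spec (z : option {poly k}) (y : K * K) :=
  if z is Some h then y.1 = 1 /\ root (map_poly iota h) y.2 else y = (0, 1).

Lemma zpt_exists z : closed_point z -> exists y, zpt_spec z y.
Proof.
case: z => [h /closed_point_size sh|_]; last by exists (0, 1).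
have /closed_rootP[x rx] : size (map_poly iota h) != 1%N.
  by rewrite size_map_poly neq_ltn sh orbT.
by exists (1, x).
Qed.

(** Coprime polynomials stay coprime over a field extension, hence share no root there. *)
Lemma dvdp_root h (b : {poly k}) x : irreducible_poly h -> root (map_poly iota h) x ->
  root (map_poly iota b) x -> h %| b.
Proof.
move=> irr rh rb; have [//|ncop] := boolP (h %| b).
have cop : coprimep h b by rewrite (irreducible_poly_coprime b irr).
have : coprimep (map_poly iota h) (map_poly iota b) by rewrite coprimep_map.
by move=> /coprimep_root /(_ rh); rewrite -/(root _ _) rb.
Qed.

(** The second conclusion says that the cofactor is again a form, of degree [n - znum z]; for
    [b = 0] this subtraction may truncate, hence the alternative. At infinity, vanishing means that
    the coefficient of degree [n] is zero. *)
Lemma ev_bform_eq0 z y n (b : {poly k}) : closed_point z -> zpt_spec z y ->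
  (size b <= n.+1)%N -> ev y (bform X n b) = 0 ->
  exists2 b' : {poly k}, b = b' * zlin z &
    b = 0 \/ (znum z <= n)%N /\ (size b' <= (n - znum z).+1)%N.
Proof.
case: z => [h|] clz /=; last first.
  move=> -> sb; rewrite ev_bform_infty => /eqP; rewrite fmorph_eq0 => bn.
  exists b; first by rewrite mulr1.
  have sb' : (size b <= n)%N.
    apply/leq_sizeP => j; rewrite leq_eqVlt => /orP[/eqP <-|]; first exact/eqP.
    exact/leq_sizeP.
  case: n sb' {sb bn} => [|n] sb'; last by right; rewrite subn1.
  by left; apply/eqP; rewrite -size_poly_leq0.
case: y => y1 x [/= -> rx] sb; rewrite ev_bform_affine // => /rootP rb.
have hb : h %| b by apply: dvdp_root rx rb; case: clz.
exists (b %/ h); first by rewrite divpK.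
have [->|b0] := eqVneq b 0; [by left | right].
have sh := closed_point_size clz; have h0 : h != 0 by rewrite -size_poly_gt0 ltnW.
move: (dvdp_leq b0 hb) sb sh; rewrite size_divp //.
by move: (size h) (size b) => u v *; split; lia.
Qed.

Lemma ev_zform z y : closed_point z -> zpt_spec z y -> ev y (zform X z) = 0.
Proof.
move=> clz; rewrite zform_form //; case: z clz => [h|] clz /=.
  case: y => y1 x [/= -> /rootP rx]; rewrite ev_bform_affine //.
  by rewrite (ltn_predK (closed_point_size clz)).
by move=> ->; rewrite ev_bform_infty coef1 rmorph0.
Qed.

Lemma ev_pelt z y : closed_point z -> zpt_spec z y -> ev y (pelt z) = 0.
Proof.
move=> clz yz; have /eqP := ev_zform clz yz; rewrite zform_pelt evX.
by rewrite expf_eq0 pexp_gt0 => /eqP.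
Qed.

(** Monic irreducible polynomials with a common root coincide; Y1 is 1 at the affine points, and the
    form of a monic polynomial is 1 at infinity. *)
Lemma ev_zform_inj z z' y : closed_point z -> closed_point z' -> zpt_spec z y ->
  ev y (zform X z') = 0 -> z' = z.
Proof.
move=> clz clz'; rewrite zform_form //.
case: z z' clz clz' => [h|] [h'|] clz clz' //=.
- case: y => y1 x [/= -> rx]; rewrite ev_bform_affine; last first.
    by rewrite (ltn_predK (closed_point_size clz')).
  move=> /rootP rx'; congr Some; have [[mh ih] [mh' ih']] := (clz, clz').
  apply/eqP; rewrite -eqp_monic //; rewrite eqp_sym; apply: (ih'.2 h).
    by rewrite neq_ltn closed_point_size ?orbT.
  exact: dvdp_root rx rx'.
- case: y => y1 x [/= -> rx]; rewrite ev_bform_affine ?size_poly1 //=.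
  by rewrite rmorph1 hornerC => /eqP; rewrite oner_eq0.
- move=> ->; rewrite ev_bform_infty => /eqP; rewrite fmorph_eq0.
  by have [/monicP /eqP] := clz'; rewrite /lead_coef => /eqP ->; rewrite oner_eq0.
Qed.

Lemma ev_xgen_eq0 z y i : closed_point z -> zpt_spec z y ->
  ev y (xgen i) = 0 -> z = mark i.
Proof.
move=> clz yz e0; apply/esym/(ev_zform_inj clz _ yz); last first.
  by rewrite zform_mark evX e0 expr0n eqn0Ngt weight_gt0.
rewrite /mark; case: ifP => //= _; rewrite monicXsubC; split=> //.
exact: irredp_XsubC.
Qed.

(** In the normal form either some [xgen i] with [l i] positive vanishes, and then [z] is its marked
    point, or the binary form vanishes and is divisible by the equation of [z], a power of
    [pelt z]. *)
Lemma ev_eq0_dvd z y d (a : A) : closed_point z -> zpt_spec z y -> Ahomog d a ->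
  ev y a = 0 -> exists b, a = b * pelt z.
Proof.
move=> clz yz ha; have [->|a0] := eqVneq a 0; first by exists 0; rewrite mul0r.
have [l [n [b [_ sb -> _]]]] := normal_form ha a0.
rewrite evM => /eqP; rewrite mulf_eq0 => /orP[|/eqP e0].
  rewrite ev_prod => /eqP/eqP/prodf_eq0[i _]; rewrite evX expf_eq0 => /andP[li /eqP].
  move=> /(ev_xgen_eq0 clz yz) ->; rewrite pelt_mark.
  exists (xgen i ^+ (l i).-1 * \prod_(j | j != i) xgen j ^+ l j * bform X n b).
  have -> : xmon l = xgen i ^+ (l i).-1 * xgen i * \prod_(j | j != i) xgen j ^+ l j.
    by rewrite -exprSr prednK // /xmon (bigD1 i).
  by rewrite [RHS]mulrAC; congr (_ * _); rewrite mulrAC.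
have [b' eb bb] := ev_bform_eq0 clz yz sb e0.
exists (xmon l * bform X (n - znum z) b' * pelt z ^+ (pexp z).-1).
rewrite -[RHS]mulrA -exprSr prednK ?pexp_gt0 // -zform_pelt zform_form //.
case: bb => [b0|[ln sb']].
  move/eqP: eb; rewrite b0 eq_sym mulf_eq0 => /orP[/eqP ->|].
    by rewrite !bform0 mulr0 mul0r.
  case: (z) clz => [h [mh _]|_] /=; last by rewrite oner_eq0.
  by rewrite (negbTE (monic_neq0 mh)).
by rewrite -mulrA bformM ?size_zlin // subnK // -eb.
Qed.

Lemma zpt_Y z y : zpt_spec z y -> y.1 != 0 \/ y.2 != 0.
Proof.
by case: z => [h [-> _]|->] /=; [left | right]; rewrite oner_eq0.
Qed.

(** [b] collects the affine zeros of the form and of the [lin i]. Over an infinite field two nonzero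
    homogeneous elements then have a common point where neither vanishes, so A is a graded
    domain. *)
Lemma ev_generic d (a : A) : Ahomog d a -> a != 0 ->
  exists2 b : {poly k}, b != 0 &
    forall x, ~~ root (map_poly iota b) x -> ev (1, x) a != 0.
Proof.
move=> ha a0; have [l [n [b [_ sb ea _]]]] := normal_form ha a0.
exists (b * \prod_(i < t) lin i).
  rewrite mulf_neq0 //; last by apply/prodf_neq0 => i _; apply: lin_neq0.
  by apply: contraNneq a0 => b0; rewrite ea b0 bform0 mulr0.
move=> x; rewrite rmorphM rootM negb_or => /andP[nb nl].
rewrite ea evM mulf_neq0 //; last by rewrite ev_bform_affine.
rewrite ev_prod; apply/prodf_neq0 => i _; rewrite evX expf_neq0 //.
apply: contra nl => /eqP e0; rewrite rmorph_prod /root horner_prod.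
apply/eqP; rewrite (bigD1 i) //=.
have := congr1 (fun u => u ^+ weight i) e0; rewrite -evX xgen_weight ev_bform_affine ?size_lin //.
by move=> /= ->; rewrite expr0n eqn0Ngt weight_gt0 mul0r.
Qed.

Lemma Ahomog_mul_neq0_closure d e (a b : A) : Ahomog d a -> Ahomog e b ->
  a != 0 -> b != 0 -> a * b != 0.
Proof.
move=> ha hb a0 b0.
have [p p0 pP] := ev_generic ha a0; have [q q0 qP] := ev_generic hb b0.
have /closed_nonrootP[x] : map_poly iota (p * q) != 0 by rewrite map_poly_eq0 mulf_neq0.
rewrite rmorphM rootM negb_or => /andP[/pP na /qP nb].
apply/negP => /eqP ab; have := mulf_neq0 na nb.
by rewrite -evM ab ev0 eqxx.
Qed.
End Evaluation.

(** Points over the finite field [k] itself would be too few: evaluation needs roots of irreducible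
    polynomials, [weight i]-th roots, and a point outside the zeros of any nonzero polynomial. *)
Definition closure_field : closedFieldType := projT1 (countable_algebraic_closure k).
Definition closure_emb : {rmorphism k -> closure_field} :=
  sval (projT2 (countable_algebraic_closure k)).
Local Notation K := closure_field.
Local Notation iota := closure_emb.

Lemma Ahomog_mul_neq0 d e (a b : A) : Ahomog d a -> Ahomog e b ->
  a != 0 -> b != 0 -> a * b != 0.
Proof. exact: (Ahomog_mul_neq0_closure iota). Qed.

Lemma Ahomog_mulI d (a b b' : A) : Ahomog d a -> a != 0 -> a * b = a * b' -> b = b'.
Proof.
move=> ha a0 /eqP; rewrite -subr_eq0 -mulrBr => /eqP ab; apply/eqP; rewrite -subr_eq0.
have [s _ ->] := Acomp_sum (b - b'); rewrite big1 // => e _; apply/eqP.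
apply: contraTT isT => be0; have := Ahomog_mul_neq0 ha (Ahomog_comp e (b - b')) a0 be0.
by rewrite -(AcompM _ _ ha) ab Acomp0 eqxx.
Qed.

(* Nonvanishing at the closed point z. *)
Definition nvan z (u : A) := forall b, u <> b * pelt z.

Lemma nvan_ev z y u : closed_point z -> zpt_spec iota z y -> ev iota y u != 0 -> nvan z u.
Proof. by move=> clz yz u0 b ub; rewrite ub evM (ev_pelt clz yz) mulr0 eqxx in u0. Qed.

Lemma ev_nvan z y d u : closed_point z -> zpt_spec iota z y -> Ahomog d u ->
  nvan z u -> ev iota y u != 0.
Proof.
move=> clz yz hu nu; apply/eqP => u0.
by have [b ub] := ev_eq0_dvd clz yz hu u0; apply: (nu b).
Qed.

(** Nonvanishing is tested on a single value in [K], where products of nonzero elements are nonzero: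
    [pelt z] is prime with respect to homogeneous elements. *)
Lemma nvanM z d e (a b : A) : closed_point z -> Ahomog d a -> Ahomog e b ->
  nvan z a -> nvan z b -> nvan z (a * b).
Proof.
move=> clz ha hb na nb; have [y yz] := zpt_exists iota clz.
apply: (nvan_ev clz yz); rewrite evM mulf_neq0 //.
  exact: (ev_nvan clz yz ha na).
exact: (ev_nvan clz yz hb nb).
Qed.

Lemma nvan1 z : closed_point z -> nvan z 1.
Proof.
move=> clz; have [y yz] := zpt_exists iota clz.
by apply: (nvan_ev clz yz); rewrite ev1 oner_eq0.
Qed.

Lemma nvanX z d (a : A) n : closed_point z -> Ahomog d a -> nvan z a -> nvan z (a ^+ n).
Proof.
move=> clz ha na; elim: n => [|n IH]; first exact: nvan1.
by rewrite exprS; apply: (nvanM clz ha (AhomogX n ha) na IH).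
Qed.

Lemma nvan_pelt z z' : closed_point z -> closed_point z' -> z' <> z -> nvan z (pelt z').
Proof.
move=> clz clz' ne; have [y yz] := zpt_exists iota clz.
apply: (nvan_ev clz yz); apply/eqP => e0; apply: ne.
apply: (ev_zform_inj clz clz' yz); rewrite zform_pelt evX e0.
by rewrite expr0n eqn0Ngt pexp_gt0.
Qed.

Lemma nvan_Y z : closed_point z -> exists2 Y : A, Y = Y1 X \/ Y = Y2 X & nvan z Y.
Proof.
move=> clz; have [y yz] := zpt_exists iota clz.
case: (zpt_Y yz) => y0; [exists (Y1 X); first by left | exists (Y2 X); first by right].
  by apply: (nvan_ev clz yz); rewrite ev_Y1.
by apply: (nvan_ev clz yz); rewrite ev_Y2.
Qed.

Lemma bform_eq0 n (b : {poly k}) : (size b <= n.+1)%N -> bform X n b = 0 -> b = 0.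
Proof.
move=> sb fb; apply/eqP; apply: contraT => b0.
have /closed_nonrootP[x /rootP] : map_poly iota b != 0 by rewrite map_poly_eq0.
by rewrite -(ev_bform_affine iota x sb) fb ev0.
Qed.

Lemma zlin_neq0 z : closed_point z -> zlin z != 0.
Proof. by case: z => [h [mh _]|_] /=; rewrite ?oner_eq0 ?monic_neq0. Qed.

Lemma pelt_neq0 z : closed_point z -> pelt z != 0.
Proof.
move=> clz; apply: contraNneq (zlin_neq0 clz) => p0.
have := zform_pelt z; rewrite zform_form // p0 expr0n eqn0Ngt pexp_gt0 /=.
by move/(bform_eq0 (size_zlin z)) => ->.
Qed.

(** Reducing the coefficient of [b] modulo [h] bounds its degree; the bound on the other coefficient
    follows by comparing degrees. *)
Lemma bezout_poly n m N (b h tau : {poly k}) : coprimep b h -> (size b <= n.+1)%N ->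
  size h = m.+1 -> (n + m <= N)%N -> (size tau <= N.+1)%N ->
  exists al be : {poly k}, [/\ (size al <= (N - n).+1)%N, (size be <= (N - m).+1)%N &
    tau = al * b + be * h].
Proof.
move=> /Bezout_eq1_coprimepP[[u v] /= uv] sb sh le st.
have h0 : h != 0 by rewrite -size_poly_gt0 sh.
pose al : {poly k} := (tau * u) %% h; have sal : (size al < m.+1)%N by rewrite -sh ltn_modp.
have hd : h %| tau - al * b.
  have -> : tau - al * b = tau * v * h + (tau * u) %/ h * b * h.
    have e : tau * u = (tau * u) %/ h * h + al by rewrite -divp_eq.
    have -> : al = tau * u - (tau * u) %/ h * h by rewrite {1}e addrC addKr.
    by rewrite -{1}[tau]mulr1 -uv; ring.
  by rewrite -mulrDl dvdp_mull.
exists al, ((tau - al * b) %/ h); split; last by rewrite divpK // addrC subrK.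
  by apply: leq_trans (sal : (size al <= m)%N) _; lia.
rewrite size_divp // sh /=.
have : (size (tau - al * b)%R <= N.+1)%N by
  apply: leq_trans (size_polyD _ _) _; rewrite size_polyN geq_max st /=;
  apply: leq_trans (size_polyMleq _ _) _; move: (leq_add (sal : (size al <= m)%N) sb);
  move: (size _ + size _)%N => q; lia.
by move: (size _) => q; lia.
Qed.

(** Coprimality of [b] and [h] sees only the affine points; that one of them has full size says that
    the two forms do not both vanish at infinity. *)
Lemma bezout_bform n m N (b h tau : {poly k}) : coprimep b h -> (size b <= n.+1)%N ->
  (size h <= m.+1)%N -> size b = n.+1 \/ size h = m.+1 ->
  (n + m <= N)%N -> (size tau <= N.+1)%N ->
  exists r s, bform X N tau = r * bform X n b + s * bform X m h.
Proof.
move=> cop sb sh [sb'|sh'] le st; last first.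
  have [al [be [sal sbe ->]]] := bezout_poly cop sb sh' le st.
  exists (bform X (N - n) al), (bform X (N - m) be).
  rewrite !bformM // bformD !subnK //; lia.
rewrite coprimep_sym in cop.
have [|al [be [sal sbe ->]]] := bezout_poly cop sh sb' (_ : m + n <= N)%N st; first lia.
exists (bform X (N - n) be), (bform X (N - m) al).
rewrite !bformM // bformD !subnK 1?addrC //; lia.
Qed.

Lemma nvan_bform z d u : closed_point z -> Ahomog d u -> nvan z u ->
  exists w n (b : {poly k}), [/\ (size b <= n.+1)%N, u * w = bform X n b & nvan z (bform X n b)].
Proof.
move=> clz hu nu; have [y yz] := zpt_exists iota clz.
have eu := ev_nvan clz yz hu nu.
have u0 : u != 0 by apply: contraNneq eu => ->; rewrite ev0.
have [l [n [b [_ sb ue _]]]] := normal_form hu u0.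
(* Multiplying by [w] raises each exponent [l i] to [weight i * l i], so that [u * w] is a form.
   Only those [xgen i] that already divide [u] matter in [w], so [w] does not vanish at [z]
   either. *)
pose w : A := xmon (fun i => (weight i).-1 * l i)%N.
have ew : u * w = bform X (\sum_i l i + n) (linprod l * b).
  rewrite -bformM ?size_linprod // -xmon_weight ue mulrAC -xmonD; congr (_ * _).
  by apply: eq_xmon => i; rewrite -{1}[l i]mul1n -mulnDl add1n prednK ?weight_gt0.
exists w, (\sum_i l i + n)%N, (linprod l * b); split=> //.
  by apply: size_mul_leS => //; apply: size_linprod.
rewrite -ew; apply: (nvan_ev clz yz); rewrite evM mulf_neq0 //.
have := eu; rewrite ue evM mulf_eq0 negb_or => /andP[+ _].
rewrite /w /xmon !ev_prod => /prodf_neq0 nz; apply/prodf_neq0 => i _.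
have := nz i isT; rewrite !evX; case: (posnP (l i)) => [->|li].
  by rewrite muln0 expr0 oner_eq0.
by rewrite expf_eq0 li /= => ni; rewrite expf_neq0.
Qed.

(** Up to finite length, [u] is invertible modulo any power of the prime at [z]: this replaces
    localization at [z]. *)
Lemma bezout_nvan z d u e : closed_point z -> Ahomog d u -> nvan z u ->
  exists N, (exists r s, Y1 X ^+ N = r * u + s * pelt z ^+ e) /\
            (exists r s, Y2 X ^+ N = r * u + s * pelt z ^+ e).
Proof.
move=> clz hu nu; have [w [n [b [sb uw nb]]]] := nvan_bform clz hu nu.
have [y yz] := zpt_exists iota clz.
have eb := ev_nvan clz yz (Ahomog_bform X n b) nb.
have sze := size_exp_leS e (size_zlin z).
(* At an affine point the power of [h] has full size; at infinity [b] has, because its form does not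
   vanish there. *)
have [cop full] : coprimep b (zlin z ^+ e) /\
    (size b = n.+1 \/ size (zlin z ^+ e) = (znum z * e).+1).
  case: z clz yz {nu nb sze} => [h|] clz /=.
    case: y eb => y1 x /= eb [ey rx]; rewrite ey ev_bform_affine // in eb.
    split; last by right; rewrite -size_exp prednK // size_poly_gt0 expf_neq0 ?(zlin_neq0 clz).
    rewrite coprimep_sym; apply: coprimep_expl.
    rewrite (irreducible_poly_coprime b clz.2).
    by apply: contra eb => /dvdpP[q ->]; rewrite rmorphM hornerM (rootP rx) mulr0.
  move=> ey; rewrite ey ev_bform_infty fmorph_eq0 in eb; split.
    by rewrite expr1n coprimep1.
  left; apply/eqP; rewrite eqn_leq sb /=; apply: contraR eb; rewrite -leqNgt => sb'.
  by rewrite nth_default.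
exists (n + znum z * e)%N.
have ez : bform X (znum z * e) (zlin z ^+ e) = pelt z ^+ ((pexp z).-1 * e) * pelt z ^+ e.
  rewrite -exprD -mulSnr prednK ?pexp_gt0 // exprM -zform_pelt zform_form //.
  by rewrite (bform_exp _ _ (size_zlin z)).
have main (tau : {poly k}) : (size tau <= (n + znum z * e).+1)%N -> exists r s,
    bform X (n + znum z * e) tau = r * u + s * pelt z ^+ e.
  move=> st; have [r [s ->]] := bezout_bform cop sb sze full (leqnn _) st.
  exists (r * w), (s * pelt z ^+ ((pexp z).-1 * e)).
  by rewrite -uw ez mulrA mulrAC; congr (_ + _); rewrite mulrA.
split.
  have [|r [s e1]] := main 1; first by rewrite size_poly1.
  by exists r, s; rewrite -e1 -(expr0 'X) bformXn // expr0 mul1r subn0.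
have [|r [s e2]] := main 'X^(n + znum z * e); first by rewrite size_polyXn.
by exists r, s; rewrite -e2 bformXn // subnn expr0 mulr1.
Qed.

Lemma nvanVdvd z (a : A) : nvan z a \/ exists b, a = b * pelt z.
Proof.
case: (EM (exists b, a = b * pelt z)) => [|H]; [by right | left=> b ab].
by apply: H; exists b.
Qed.

Lemma dvd_homog d e (a b p : A) : Ahomog d p -> Ahomog e a -> a = b * p ->
  exists2 b', Ahomog (e - d) b' & a = b' * p.
Proof.
move=> hp ha ab; exists (Acomp (e - d) b); first exact: Ahomog_comp.
by rewrite mulrC -(AcompM _ _ hp) [d + _]addrC subrK mulrC -ab Acomp_id.
Qed.

Lemma ldeg_pdeg_gt0 z : closed_point z -> 0 < ldeg (pdeg z).
Proof.
rewrite /pdeg; case: pindex => [i _|clz].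
  by rewrite ldeg_xvec ltz_nat cofactor_weight_gt0.
have -> : zdeg X z = c *+ znum z by case: (z).
by rewrite ldeg_cvecMn ltz_nat muln_gt0 total_weight_gt0 znum_gt0.
Qed.

(** Division by [pelt z] lowers the degree, which is nonnegative for nonzero homogeneous
    elements. *)
Lemma factor_pelt z d (a : A) : closed_point z -> Ahomog d a -> a != 0 ->
  exists i u e, [/\ Ahomog e u, nvan z u & a = pelt z ^+ i * u].
Proof.
move=> clz; have [n] := ubnP `|ldeg d|%N; elim: n => // n IH in d a *.
rewrite ltnS => ln ha a0; case: (nvanVdvd z a) => [na|[b ab]].
  by exists 0%N, a, d; rewrite expr0 mul1r.
have [b' hb' ab'] := dvd_homog (Ahomog_pelt z) ha ab.
have b0 : b' != 0 by apply: contraNneq a0 => b0; rewrite ab' b0 mul0r.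
have := Ahomog_ldeg_ge0 hb' b0; have := Ahomog_ldeg_ge0 ha a0; have := ldeg_pdeg_gt0 clz.
move=> p0 d0 d'0; rewrite ldegD ldegN in d'0.
have [|i [u [e [hu nu bu]]]] := IH (d - pdeg z) b' _ hb' b0.
  by rewrite ldegD ldegN; lia.
exists i.+1, u, e; split=> //.
by rewrite ab' bu exprSr mulrAC.
Qed.

Lemma dvd_pelt_pow z d d' (u a b : A) e : closed_point z -> Ahomog d u -> Ahomog d' a ->
  nvan z u -> u * a = b * pelt z ^+ e -> exists b', a = b' * pelt z ^+ e.
Proof.
move=> clz hu; elim: e d' a b => [|e IH] d' a b ha nu; first by exists a; rewrite mulr1.
rewrite exprSr mulrA => uab; case: (nvanVdvd z a) => [na|[a1 aa1]].
  by have := nvanM clz hu ha nu na uab.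
have [a' ha' aa'] := dvd_homog (Ahomog_pelt z) ha aa1.
have [|c' ec] := IH _ a' b ha' nu.
  apply: (Ahomog_mulI (Ahomog_pelt z) (pelt_neq0 clz)).
  by rewrite mulrC -mulrA -aa' uab mulrC.
by exists c'; rewrite mulrA -ec.
Qed.

Lemma dvd_prod_pelt (I : eqType) (r : seq I) (z : I -> option {poly k}) (e : I -> nat)
    d (a : A) : (forall j, closed_point (z j)) -> injective z -> uniq r -> Ahomog d a ->
  (forall j, exists b, a = b * pelt (z j) ^+ e j) ->
  exists b, a = b * \prod_(j <- r) pelt (z j) ^+ e j.
Proof.
move=> clz zI; elim: r => [|j r IH] ur ha dv; first by exists a; rewrite big_nil mulr1.
have /andP[jr ur'] := ur; have [b ab] := IH ur' ha dv.
(* The product over the other points does not vanish at [z j], so the cofactor of [a] inherits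
   divisibility by the power of [pelt (z j)]. *)
have [D [hP nP]] : exists D, Ahomog D (\prod_(j <- r) pelt (z j) ^+ e j) /\
    nvan (z j) (\prod_(j <- r) pelt (z j) ^+ e j).
  elim: {b ab IH ur ur'} r jr => [|i r IHr].
    by exists 0; rewrite big_nil; split; [apply: Ahomog1 | apply: nvan1].
  rewrite inE negb_or => /andP[ji /IHr[D [h n]]].
  exists (pdeg (z i) *+ e i + D); rewrite big_cons.
  have hp := AhomogX (e i) (Ahomog_pelt (z i)); split; first exact: AhomogM.
  apply: (nvanM (clz j) hp h) => //; apply: nvanX (Ahomog_pelt _) _ => //.
  by apply: nvan_pelt => // /zI ij; rewrite ij eqxx in ji.
have [b' hb' ab'] := dvd_homog hP ha ab.
have [q aq] := dv j; have [|b2 eb2] := @dvd_pelt_pow (z j) D _ _ b' q (e j) (clz j) hP hb' nP.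
  by rewrite mulrC -ab' -aq.
by exists b2; rewrite big_cons mulrA -eb2.
Qed.
End ClosedPoints.

(** * Graded modules up to finite length *)

Section Saturation.
Variables (k : finFieldType) (X : wpl k).
Local Notation t := (npt X).+2.
Local Notation A := (Aalg X).
Local Notation L := (Lgrp X).
Local Notation c := (cvec X).
Implicit Types M N : grmod X.

Definition isY (Y : A) := Y = Y1 X \/ Y = Y2 X.

Lemma isY1 : isY (Y1 X). Proof. by left. Qed.
Lemma isY2 : isY (Y2 X). Proof. by right. Qed.

Lemma Ahomog_isY Y : isY Y -> Ahomog c Y.
Proof. by case=> ->; [apply: Ahomog_Y1 | apply: Ahomog_Y2]. Qed.

Lemma gcomp_sumE M d (I : Type) (r : seq I) (F : I -> M) :
  gcomp d (\sum_(i <- r) F i) = \sum_(i <- r) gcomp d (F i).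
Proof. exact: (big_morph (gcomp d) (gcompD d) (gcomp0 M d)). Qed.

Lemma gcompN M d (v : M) : gcomp d (- v) = - gcomp d v.
Proof. by apply/eqP; rewrite -addr_eq0 -gcompD addNr gcomp0. Qed.

Lemma gcomp_idem M d (v : M) : gcomp d (gcomp d v) = gcomp d v.
Proof. by rewrite gcomp_orth eqxx. Qed.

Lemma gcompZr M d e (a : A) (v : M) : Ahomog d a -> gcomp e (a *: v) = a *: gcomp (e - d) v.
Proof. by move=> ha; rewrite -(gcompZ _ _ ha) addrC subrK. Qed.

Lemma gcomp_scale M d e (a : A) (v : M) : gcomp d v = v ->
  gcomp e (a *: v) = Acomp (e - d) a *: v.
Proof.
move=> hv; have [s us ea] := Acomp_sum a.
have -> : Acomp (e - d) a = \sum_(x <- s) Acomp (e - d) (Acomp x a).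
  by rewrite {1}ea (big_morph _ (AcompD _) (Acomp0 _)).
rewrite {1}ea !scaler_suml gcomp_sumE; apply: eq_bigr => x _.
rewrite (gcompZr _ _ (Ahomog_comp x a)) Acomp_orth -hv gcomp_orth.
have -> : (e - x == d) = (e - d == x).
  by rewrite !subr_eq [d + x]addrC.
by case: ifP => _; rewrite ?scaler0 ?scale0r.
Qed.

Lemma gmem_sum M (P : gsub M) (I : Type) (r : seq I) (F : I -> M) :
  (forall i, P (F i)) -> P (\sum_(i <- r) F i).
Proof.
by move=> h; elim/big_ind: _ => // *; [apply: gmem0 | apply: gmemD].
Qed.

Lemma gmem_comps M (P : gsub M) v : (forall d, P (gcomp d v)) -> P v.
Proof. by move=> h; have [s _ ->] := gcomp_sum v; apply: gmem_sum. Qed.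

Lemma gmemDl M (P : gsub M) u v : P v -> P (u + v) -> P u.
Proof. by move=> Pv Puv; rewrite -[u](addrK v); apply: gmemB. Qed.

(** By [flenP], the largest submodule containing [P] with quotient of finite length; [P] and [sat P]
    become the same subobject in [coh X]. *)
Definition sat M (P : gsub M) : gsub M.
Proof.
refine (@GSub _ _ M (fun v => exists n, forall Y, isY Y -> P (Y ^+ n *: v)) _ _ _ _).
- by exists 0%N => Y _; rewrite scaler0; apply: gmem0.
- move=> u v [n Pu] [m Pv]; exists (n + m)%N => Y hY; rewrite scalerDr; apply: gmemD.
    by rewrite addnC exprD -scalerA; apply/gmemZ/Pu.
  by rewrite exprD -scalerA; apply/gmemZ/Pv.
- move=> a v [n Pv]; exists n => Y hY; rewrite scalerA mulrC -scalerA.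
  exact/gmemZ/Pv.
- move=> d v [n Pv]; exists n => Y hY.
  by rewrite -(gcompZ _ _ (AhomogX n (Ahomog_isY hY))); apply/gmem_comp/Pv.
Defined.

Definition tors M : gsub M := sat (gsub_zero M).

Lemma sat_sub M (P : gsub M) : gsub_le P (sat P).
Proof. by move=> v Pv; exists 0%N => Y _; rewrite scale1r. Qed.

(** [sat] is idempotent, so an element may be multiplied by powers of Y1 and of Y2 before its
    membership is shown. *)
Lemma sat_pow M (P : gsub M) v n : (forall Y, isY Y -> sat P (Y ^+ n *: v)) -> sat P v.
Proof.
move=> h; have [n1 h1] := h _ isY1; have [n2 h2] := h _ isY2.
exists (n1 + n2 + n)%N => Y hY; rewrite exprD -scalerA.
case: hY => ->.
  by rewrite addnC exprD -scalerA; apply/gmemZ/h1/isY1.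
by rewrite exprD -scalerA; apply/gmemZ/h2/isY2.
Qed.

Lemma sat_mono M (P Q : gsub M) : gsub_le P (sat Q) -> gsub_le (sat P) (sat Q).
Proof. by move=> PQ v [n h]; apply: (@sat_pow _ _ _ n) => Y hY; apply/PQ/h. Qed.

Lemma sat_le M (P Q : gsub M) : gsub_le P Q -> gsub_le (sat P) (sat Q).
Proof. by move=> PQ; apply: sat_mono => v /PQ; apply: sat_sub. Qed.

Lemma tors_sat M (P : gsub M) : gsub_le (tors M) (sat P).
Proof. by apply: sat_le => v ->; apply: gmem0. Qed.

Lemma noetherian_Aalg : @noetherian A A^o.
Proof.
apply: (@noetherian_quotient _ A (@Apr k X)); last exact: noetherian_mpoly.
by move=> a; exists (repr a); apply/esym/Apr_repr.
Qed.

Lemma gsub_fingen M (P : gsub M) : fingen P.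
Proof.
have [n [e eP]] := gfingen M.
apply: (noetherian_fingen noetherian_Aalg); first by exists n, e; split=> // v _; apply: eP.
split; first exact: gmem0.
by move=> a u v Pu Pv; apply: gmemD => //; apply: gmemZ.
Qed.

Lemma gsub_homgens M (P : gsub M) : exists s : seq M,
  (forall g, g \in s -> P g /\ exists d, gcomp d g = g) /\
  forall Q : gsub M, (forall g, g \in s -> Q g) -> gsub_le P Q.
Proof.
have [n [e [Pe eP]]] := gsub_fingen P.
have /choice[s sP] : forall i, exists s, e i = \sum_(d <- s) gcomp d (e i).
  by move=> i; have [s _ es] := gcomp_sum (e i); exists s.
exists (flatten [seq [seq gcomp d (e i) | d <- s i] | i <- enum 'I_n]); split=> [g|Q hQ v].
  move=> /flattenP[_ /mapP[i _ ->] /mapP[d _ ->]]; split; first exact: gmem_comp.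
  by exists d; apply: gcomp_idem.
move=> /eP[a ->]; apply: gmem_sum => i; apply: gmemZ; rewrite sP big_seq.
elim/big_ind: _ => [||d ds]; [exact: gmem0 | exact: gmemD |].
apply: hQ; apply/flattenP; exists [seq gcomp d (e i) | d <- s i].
  by apply: map_f; rewrite mem_enum.
exact: map_f.
Qed.

Definition ypre M (n : nat) (P : gsub M) : gsub M.
Proof.
refine (@GSub _ _ M (fun v => forall Y, isY Y -> P (Y ^+ n *: v)) _ _ _ _).
- by move=> Y _; rewrite scaler0; apply: gmem0.
- by move=> u v Pu Pv Y hY; rewrite scalerDr; apply: gmemD; [apply: Pu | apply: Pv].
- by move=> a v Pv Y hY; rewrite scalerA mulrC -scalerA; apply/gmemZ/Pv.
- move=> d v Pv Y hY.
  by rewrite -(gcompZ _ _ (AhomogX n (Ahomog_isY hY))); apply/gmem_comp/Pv.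
Defined.

(** [Q] is finitely generated, so a single exponent serves all its elements. *)
Lemma sat_uniform M (P Q : gsub M) : gsub_le Q (sat P) ->
  exists n, forall v Y, Q v -> isY Y -> P (Y ^+ n *: v).
Proof.
move=> QP; have [s [sQ gen]] := gsub_homgens Q.
pose T n := ypre n P.
have [n nP] : exists n, forall g, g \in s -> T n g.
  elim: s sQ {gen} => [|g s IH] sQ; first by exists 0%N.
  have [|n nP] := IH; first by move=> h hs; apply: sQ; rewrite inE hs orbT.
  have [m mP] := QP g (sQ g (mem_head _ _)).1.
  exists (n + m)%N => h; rewrite inE => /orP[/eqP ->|hs] Y hY.
    by rewrite exprD -scalerA; apply/gmemZ/mP.
  by rewrite addnC exprD -scalerA; apply/gmemZ/nP.
by exists n => v Y Qv hY; apply: (gen (T n) nP v Qv).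
Qed.

Definition cyc M d (v : M) (hv : gcomp d v = v) : gsub M.
Proof.
refine (@GSub _ _ M (fun u => exists a : A, u = a *: v) _ _ _ _).
- by exists 0; rewrite scale0r.
- by move=> _ _ [a ->] [b ->]; exists (a + b); rewrite scalerDl.
- by move=> a _ [b ->]; exists (a * b); rewrite scalerA.
- by move=> e _ [a ->]; exists (Acomp (e - d) a); rewrite (gcomp_scale _ _ hv).
Defined.

Lemma gsub_addl M (P Q : gsub M) : gsub_le P (gsub_add P Q).
Proof. by move=> v Pv; exists v, 0; split; rewrite ?addr0 //; apply: gmem0. Qed.

Lemma gsub_addr M (P Q : gsub M) : gsub_le Q (gsub_add P Q).
Proof. by move=> v Pv; exists 0, v; split; rewrite ?add0r //; apply: gmem0. Qed.

Lemma gsub_add_le M (P Q R : gsub M) : gsub_le P R -> gsub_le Q R -> gsub_le (gsub_add P Q) R.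
Proof. by move=> PR QR _ [u [w [/PR Ru /QR Rw ->]]]; apply: gmemD. Qed.

Lemma gsub_add_le2 M (P P' Q Q' : gsub M) : gsub_le P P' -> gsub_le Q Q' ->
  gsub_le (gsub_add P Q) (gsub_add P' Q').
Proof. by move=> PP QQ _ [u [w [/PP Pu /QQ Qw ->]]]; exists u, w. Qed.

Lemma cyc_mem M d (v : M) (hv : gcomp d v = v) : cyc hv v.
Proof. by exists 1; rewrite scale1r. Qed.

Lemma cyc_le M d (v : M) (hv : gcomp d v = v) (P : gsub M) : P v -> gsub_le (cyc hv) P.
Proof. by move=> Pv _ [a ->]; apply: gmemZ. Qed.

Lemma Aalg_augment (a : A) : exists (a0 : k) (b : 'I_t -> A),
  a = kA X a0 + \sum_i b i * xgen i.
Proof.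
rewrite -(Apr_repr a); elim/mpolyind: (repr a) => [|b m p _ _ [a0 [f ep]]].
  by exists 0, (fun=> 0); rewrite !rmorph0 add0r big1 // => i _; rewrite mul0r.
case: (pickP (fun i => 0 < m i)%N) => [i mi|m0].
  have -> : 'X_[m] = 'X_[m - U_(i)] * 'X_i :> {mpoly k[t]}.
    by rewrite -mpolyXD submK //; apply/mnm_lepP => j; rewrite mnm1E; case: eqP => // <-.
  exists a0, (fun j => f j + if j == i then Apr (b *: 'X_[m - U_(i)]) else 0).
  rewrite rmorphD /= ep addrCA; congr (_ + _).
  under eq_bigr do rewrite mulrDl.
  rewrite big_split /= [LHS]addrC; congr (_ + _).
  rewrite (bigD1 i) //= eqxx big1 ?addr0 => [|j /negbTE ->]; last by rewrite mul0r.
  by rewrite scalerAl rmorphM.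
have -> : m = 0%MM by apply/mnmP => i; have := m0 i; rewrite mnm0E; case: (m i).
by exists (b + a0), f; rewrite rmorphD rmorphD /= ep addrA mpolyX0 alg_mpolyC.
Qed.
End Saturation.

Arguments sat : simpl never.
Arguments tors : simpl never.

(** * Finite length as annihilation by powers of Y1 and Y2 *)

Section FiniteLength.
Variables (k : finFieldType) (X : wpl k).
Local Notation t := (npt X).+2.
Local Notation A := (Aalg X).
Local Notation L := (Lgrp X).
Local Notation c := (cvec X).
Implicit Types M N : grmod X.

(** Modulo [P] the elements of A act on [v] through their constant term, and a nonzero constant is
    invertible. *)
Lemma gsub_max_cyc M d (v : M) (hv : gcomp d v = v) (P : gsub M) : ~ P v ->
  (forall i, P (xgen i *: v)) -> gsub_max P (gsub_add P (cyc hv)).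
Proof.
move=> nPv Pxv; split; first exact: gsub_addl.
  by move=> h; apply/nPv/h/gsub_addr/cyc_mem.
move=> T PT TQ; case: (EM (gsub_le T P)) => [|nTP]; [by left | right].
have [u Tu nPu] : exists2 u, T u & ~ P u.
  by apply: contra_notP nTP => H u Tu; apply: contra_notP H => nPu; exists u.
have [p [_ [Pp [a ->] eu]]] := TQ u Tu.
have [a0 [b ea]] := Aalg_augment a.
have Pb : P ((\sum_i b i * xgen i) *: v).
  by rewrite scaler_suml; apply: gmem_sum => i; rewrite -scalerA; apply: gmemZ.
have a00 : a0 != 0.
  apply: contra_notN nPu => /eqP a00; rewrite eu ea a00 rmorph0 add0r.
  exact: gmemD.
have Tv : T v.
  have -> : v = kA X a0^-1 *: (u - (p + (\sum_i b i * xgen i) *: v)).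
    rewrite eu opprD addrACA subrr add0r ea scalerDl addrK scalerA -rmorphM.
    by rewrite mulVf // rmorph1 scale1r.
  by apply/gmemZ/gmemB => //; apply/PT/gmemD.
by apply: gsub_add_le => //; apply: cyc_le.
Qed.

(** Induction on the sum of the exponents, inserting the submodule generated by [xgen i *: v]: below
    it [n i] drops by one, above it [n i] may be replaced by 1. *)
Lemma flen_cyc M d (v : M) (hv : gcomp d v = v) (P : gsub M) (n : 'I_t -> nat) :
  (forall i, P (xgen i ^+ n i *: v)) -> flen P (gsub_add P (cyc hv)).
Proof.
have [N] := ubnP (\sum_i n i)%N; elim: N => // N IH in d v hv P n *.
rewrite ltnS => lN Pn; case: (EM (P v)) => [Pv|nPv].
  apply: flen0; first exact: gsub_addl.
  by apply: gsub_add_le => //; apply: cyc_le.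
case: (EM (forall i, P (xgen i *: v))) => [Px|/existsNP[i nPx]].
  by apply: flenS (flen_refl P) _; apply: gsub_max_cyc.
have ni : (1 < n i)%N.
  case e : (n i) (Pn i) => [|[|m]] //; first by rewrite scale1r => /nPv.
have hx : gcomp (d + xvec i) (xgen i *: v) = xgen i *: v.
  by rewrite (gcompZr _ _ (Ahomog_xgen i)) addrK hv.
have sum_upd m : (m < n i)%N ->
    (\sum_j (if j == i then m else n j) < N)%N.
  move=> mi; apply: leq_trans lN; rewrite (bigD1 i) //= eqxx [X in (_ < X)%N](bigD1 i) //=.
  have -> : (\sum_(j | j != i) (if j == i then m else n j) = \sum_(j | j != i) n j)%N.
    by apply: eq_bigr => j /negbTE ->.
  by rewrite ltn_add2r.
have h1 : flen P (gsub_add P (cyc hx)).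
  apply: (IH _ _ hx P (fun j => if j == i then (n i).-1 else n j)).
    by apply: sum_upd; rewrite prednK // ltnW.
  move=> j; rewrite scalerA; case: eqP => [->|_]; first by rewrite -exprSr prednK // ltnW.
  by rewrite mulrC -scalerA; apply: gmemZ.
have h2 : flen (gsub_add P (cyc hx)) (gsub_add (gsub_add P (cyc hx)) (cyc hv)).
  apply: (IH _ _ hv _ (fun j => if j == i then 1%N else n j)); first exact: sum_upd.
  move=> j; case: eqP => [->|_]; last exact/gsub_addl/Pn.
  by rewrite expr1; apply/gsub_addr/cyc_mem.
apply: flen_eqr (flen_trans h1 h2) _ _.
  apply: gsub_add_le; last exact: gsub_addr.
  apply: gsub_add_le; first exact: gsub_addl.
  by apply: cyc_le; apply/gsub_addr/gmemZ/cyc_mem.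
by apply: gsub_add_le2 => //; apply: gsub_addl.
Qed.

(** Otherwise a homogeneous [v] is [r + a *: (Y *: v)] with [r] in [R]; in the degree of [v] the
    coefficient has degree [- c], where A is zero, so [v] would lie in [R]. *)
Lemma gsub_max_Y M (R Q : gsub M) v Y : gsub_max R Q -> Q v -> isY Y -> R (Y *: v).
Proof.
move=> [RQ nQR mx] Qv hY; have hYc := Ahomog_isY hY; apply: gmem_comps => e.
rewrite (gcompZr _ _ hYc); move: (e - c) => d {e}.
have hv := gcomp_idem d v; have Qdv := gmem_comp d Qv.
move: (gcomp d v) hv Qdv => {Qv}v hv Qv.
have hYv : gcomp (d + c) (Y *: v) = Y *: v by rewrite (gcompZr _ _ hYc) addrK hv.
case: (mx (gsub_add R (cyc hYv))).
- exact: gsub_addl.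
- by apply: gsub_add_le => //; apply/cyc_le/gmemZ.
- by apply; apply/gsub_addr/cyc_mem.
move=> QT; have [r [_ [Rr [a ->] ev]]] := QT v Qv; apply: gmemZ.
rewrite -hv {}ev gcompD (gcomp_scale _ _ hYv) opprD addNKr.
suff -> : Acomp (- c) a = 0 by rewrite scale0r addr0; apply: gmem_comp.
apply/eqP; apply: contraT => a0; have := Ahomog_ldeg_ge0 (Ahomog_comp (- c) a) a0.
rewrite ldegN ldeg_cvec oppr_ge0 lez_nat leqn0.
by rewrite eqn0Ngt total_weight_gt0.
Qed.

Lemma flenP M (P Q : gsub M) : flen P Q <-> gsub_le P Q /\ gsub_le Q (sat P).
Proof.
split.
  move=> h; split; first exact: flen_le.
  elim: h => [{}P {}Q _ QP v /QP|{}P R {}Q _ IH mx v Qv]; first exact: sat_sub.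
  apply: (@sat_pow _ _ _ _ _ 1%N) => Y hY; apply: IH; rewrite expr1.
  exact: gsub_max_Y mx Qv hY.
move=> [PQ QP]; have [s [sQ gen]] := gsub_homgens Q.
suff [P' [PP' P'Q fP P's]] : exists P' : gsub M, [/\ gsub_le P P', gsub_le P' Q, flen P P' &
    forall g, g \in s -> P' g].
  exact: flen_eqr fP P'Q (gen _ P's).
elim: s sQ {gen} => [|g s IH] sQ; first by exists P; split=> //; apply: flen_refl.
have [|P' [PP' P'Q fP P's]] := IH; first by move=> h hs; apply: sQ; rewrite inE hs orbT.
have [Qg [d hg]] := sQ g (mem_head _ _).
exists (gsub_add P' (cyc hg)); split.
- by move=> v /PP'; apply: gsub_addl.
- by apply: gsub_add_le => //; apply: cyc_le.
- apply: flen_trans fP _; have [n nP] := QP g Qg.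
  (* This exponent puts the power of [xgen i] into the ideal generated by [Y1 ^+ n] and
     [Y2 ^+ n]. *)
  apply: (@flen_cyc _ _ _ _ _ (fun i => (weight i * (n + n))%N)) => i.
  have [r [r' e]] := xgen_Ypow n i; rewrite [X in X *: _]e scalerDl -scalerA -scalerA.
  by apply: gmemD; apply/gmemZ/PP'/nP; [apply: isY1 | apply: isY2].
- move=> h; rewrite inE => /orP[/eqP ->|/P's]; first exact/gsub_addr/cyc_mem.
  exact: gsub_addl.
Qed.

Lemma qdomP M N (f : qhom M N) u :
  exists n, forall Y, isY Y -> exists v, f (Y ^+ n *: u) v.
Proof.
have [_ h] := (flenP _ _).1 (qdom f); have [n nP] := h u I.
by exists n => Y hY; have [v _ fv] := nP Y hY; exists v.
Qed.

Lemma qkerP M N (f : qhom M N) v : f 0 v -> tors N v.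
Proof.
by have [_ h] := (flenP _ _).1 (qker f); move=> fv; apply: h; exists 0.
Qed.

Definition mkqhom M N (f : corr M N)
  (dom : forall u, exists n, forall Y, isY Y -> exists v, f (Y ^+ n *: u) v)
  (ker : forall v, f 0 v -> tors N v) : qhom M N.
Proof.
refine (@QHom _ _ _ _ f _ _).
- apply/flenP; split=> // u _; have [n nP] := dom u; exists n => Y hY.
  by have [v fv] := nP Y hY; exists v.
- apply/flenP; split=> [v ->|v [u -> fv]]; last exact: ker.
  by exists 0 => //; apply: crel0.
Defined.

Lemma qhom_torsB M N (f : qhom M N) u v w : f u v -> f u w -> tors N (v - w).
Proof. by move=> fv fw; apply: (@qkerP _ _ f); rewrite -(subrr u); apply: crelB. Qed.

Lemma qhom_tors M N (f : qhom M N) u v : tors M u -> f u v -> tors N v.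
Proof.
move=> [n tu] fv; apply: (@sat_pow _ _ _ _ _ n) => Y hY; apply: (@qkerP _ _ f).
by rewrite -(tu Y hY); apply: crelZ.
Qed.

(** Torsion is saturated, so agreement on a submodule of finite colength extends to every [u]:
    multiply by [Y ^+ n] to land in that submodule. *)
Lemma qeqP M N (f g : qhom M N) :
  qeq f g <-> forall u v w, f u v -> g u w -> tors N (v - w).
Proof.
split.
  move=> [P [Q [[/flenP[_ hP] /flenP[_ hQ]] _ fg]]] u v w fv gw.
  have [n nP] := hP u I; apply: (@sat_pow _ _ _ _ _ n) => Y hY; apply: hQ.
  by rewrite scalerBr; apply: fg (nP Y hY) _ _; apply: crelZ.
move=> fg; exists (gsub_cap (cdom f) (cdom g)), (tors N); split.
- split; first by apply: flen_cap; apply: qdom.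
  by apply/flenP; split=> // v ->; apply: gmem0.
- by split=> u [].
- by move=> u v w _; apply: fg.
Qed.

Lemma qeq0P M N (f : qhom M N) : qeq f (qzero M N) <-> forall u v, f u v -> tors N v.
Proof.
rewrite qeqP; split=> h u v; first by move=> /h/(_ (erefl _)) /=; rewrite subr0.
by move=> w /h tv -> /=; rewrite subr0.
Qed.
End FiniteLength.

(** * Subobjects and quotients *)

Section SubQuotient.
Variables (k : finFieldType) (X : wpl k).
Local Notation A := (Aalg X).
Local Notation L := (Lgrp X).
Variables (M : grmod X) (P : gsub M).

Definition gpred : {pred M} := fun v => `[< P v >].

Lemma gpred_submod_closed : submod_closed gpred.
Proof.
split=> [|a u v /asboolP Pu /asboolP Pv]; apply/asboolP; first exact: gmem0.
by apply: gmemD => //; apply: gmemZ.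
Qed.

HB.instance Definition _ := GRing.isSubmodClosed.Build A M gpred gpred_submod_closed.

Record gsub_type := GSubType { gval : M; _ : gval \in gpred }.

HB.instance Definition _ := [isSub for gval].
HB.instance Definition _ := [Choice of gsub_type by <:].
HB.instance Definition _ := [SubChoice_isSubLmodule of gsub_type by <:].

Lemma gvalP (u : gsub_type) : P (gval u).
Proof. by case: u => v /= /asboolP. Qed.

Lemma gval_surj v : P v -> exists u, gval u = v.
Proof.
move=> Pv; have Pv' : v \in gpred by apply/asboolP.
by exists (GSubType Pv').
Qed.

Definition gsub_comp (d : L) (u : gsub_type) : gsub_type :=
  @GSubType (gcomp d (gval u)) (introT (asboolP _) (gmem_comp d (gvalP u))).

Definition gsub_mod : grmod X.
Proof.
refine (@GrMod _ _ (gsub_type : lmodType A) gsub_comp _ _ _ _ _).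
- by move=> d u v; apply: val_inj; rewrite /= gcompD.
- move=> d e v; case: eqP => [->|/eqP ne]; apply: val_inj; rewrite /= gcomp_orth.
    by rewrite eqxx.
  by rewrite (negbTE ne).
- move=> v; have [s us ev] := gcomp_sum (gval v); exists s => //.
  by apply: val_inj; rewrite raddf_sum /=; apply: ev.
- by move=> d e a v ha; apply: val_inj; rewrite /= gcompZ.
- have [n [e [Pe eP]]] := gsub_fingen P.
  have /choice[f fP] : forall i, exists u, gval u = e i by move=> i; apply: gval_surj.
  exists n, f => v; have [a ea] := eP _ (gvalP v); exists a.
  apply: val_inj; rewrite raddf_sum /=; apply: etrans ea _; apply: eq_bigr => i _.
  by rewrite -fP.
Defined.

Definition gval_linear : {linear gsub_mod -> M} := (val : {linear gsub_type -> M}).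

Definition gincl : qhom gsub_mod M.
Proof. by refine (@qgraph _ _ gsub_mod M gval_linear _). Defined.

HB.instance Definition _ := GRing.ZmodClosed.on gpred.

Definition gquot_type : Type := Quotient.quot gpred.
HB.instance Definition _ := GRing.Zmodule.on gquot_type.
Local Notation pi := (\pi_(Quotient.quot gpred)).

Lemma gquot_eq u v : (pi u == pi v :> gquot_type) = (u - v \in gpred).
Proof. by rewrite Quotient.idealrBE. Qed.

Lemma gquot_eqP u v : pi u = pi v :> gquot_type <-> P (u - v).
Proof.
split=> [/eqP|h]; first by rewrite gquot_eq => /asboolP.
by apply/eqP; rewrite gquot_eq; apply/asboolP.
Qed.

Lemma gquot_pi0 : pi 0 = 0 :> gquot_type.
Proof. exact: (raddf0 pi). Qed.

Definition gquot_scale (a : A) (u : gquot_type) : gquot_type := pi (a *: repr u).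

Lemma gquot_scale_pi a v : gquot_scale a (pi v) = pi (a *: v).
Proof.
apply/gquot_eqP; rewrite -scalerBr; apply/gmemZ/gquot_eqP.
by rewrite reprK.
Qed.

Lemma gquot_scaleA a b v : gquot_scale a (gquot_scale b v) = gquot_scale (a * b) v.
Proof.
rewrite -[v]reprK (gquot_scale_pi b) (gquot_scale_pi a) (gquot_scale_pi (a * b)).
by rewrite scalerA.
Qed.

Lemma gquot_scale1 : left_id 1 gquot_scale.
Proof. by move=> v; rewrite -[v]reprK gquot_scale_pi scale1r. Qed.

Lemma gquot_scaleDr : right_distributive gquot_scale +%R.
Proof.
move=> a u v; rewrite -[u]reprK -[v]reprK -raddfD /= !gquot_scale_pi scalerDr.
by rewrite raddfD.
Qed.

Lemma gquot_scaleDl v : {morph gquot_scale^~ v : a b / a + b}.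
Proof. by move=> a b; rewrite -[v]reprK !gquot_scale_pi scalerDl raddfD. Qed.

HB.instance Definition _ := GRing.Zmodule_isLmodule.Build A gquot_type
  gquot_scaleA gquot_scale1 gquot_scaleDr gquot_scaleDl.

Definition gquot_comp (d : L) (u : gquot_type) : gquot_type := pi (gcomp d (repr u)).

Lemma gquot_comp_pi d v : gquot_comp d (pi v) = pi (gcomp d v).
Proof.
apply/gquot_eqP; rewrite -gcompN -gcompD; apply/gmem_comp/gquot_eqP.
by rewrite reprK.
Qed.

Definition gquot_mod : grmod X.
Proof.
refine (@GrMod _ _ (gquot_type : lmodType A) gquot_comp _ _ _ _ _).
- move=> d u v; rewrite -[u]reprK -[v]reprK -raddfD /= !gquot_comp_pi gcompD.
  by rewrite raddfD.
- move=> d e v; rewrite -[v]reprK (gquot_comp_pi e) (gquot_comp_pi d) gcomp_orth.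
  by case: ifP => // _; apply: gquot_pi0.
- move=> v; have [s us ev] := gcomp_sum (repr v); exists s => //.
  rewrite -{1}[v]reprK ev raddf_sum; apply: eq_bigr => d _ /=.
  by rewrite -[v in RHS]reprK gquot_comp_pi.
- move=> d e a v ha; rewrite -[v]reprK [a *: _]gquot_scale_pi !gquot_comp_pi gcompZ //.
  by rewrite -gquot_scale_pi.
- have [n [e eP]] := gfingen M; exists n, (fun i => pi (e i)) => v.
  have [a ea] := eP (repr v); exists a; rewrite -[v]reprK ea raddf_sum /=.
  by apply: eq_bigr => i _; rewrite -gquot_scale_pi.
Defined.

Lemma gpi_is_linear : linear (pi : M -> gquot_mod).
Proof.
move=> a u v; rewrite raddfD /=; congr (_ + _).
by rewrite -gquot_scale_pi.
Qed.

Definition gpi : {linear M -> gquot_mod} :=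
  HB.pack (pi : M -> gquot_mod) (GRing.isLinear.Build _ _ _ _ (pi : M -> gquot_mod) gpi_is_linear).

Lemma gpi_comp d u : gpi (gcomp d u) = gcomp d (gpi u).
Proof. by apply/esym/gquot_comp_pi. Qed.

Definition gproj : qhom M gquot_mod := qgraph gpi_comp.

Lemma gpi_eq0 u : gpi u = 0 <-> P u.
Proof.
by rewrite -[0](raddf0 gpi) [gpi u = _]gquot_eqP subr0.
Qed.

Lemma gpi_surj w : exists u, gpi u = w.
Proof. by exists (repr w); apply: reprK. Qed.
End SubQuotient.

(** * Monomorphisms, exactness and direct sums, elementwise *)

Section Elementwise.
Variables (k : finFieldType) (X : wpl k).
Local Notation A := (Aalg X).
Local Notation L := (Lgrp X).
Local Notation c := (cvec X).
Local Notation C := (coh X).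
Implicit Types M N K W : grmod X.

Definition qim M N (f : corr M N) : gsub N := cimg f (gsub_full M).
Definition qmono M N (f : corr M N) := forall u v, f u v -> tors N v -> tors M u.
Definition qsurj M N (f : corr M N) := gsub_le (gsub_full N) (sat (qim f)).

Lemma qdom_sat M N (f : qhom M N) u : sat (cdom f) u.
Proof. by have [n h] := qdomP f u; exists n => Y /h[v fv]; exists v. Qed.

Definition mkqhom_sat M N (f : corr M N) (dom : forall u, sat (cdom f) u)
  (ker : forall v, f 0 v -> tors N v) : qhom M N.
Proof.
apply: (@mkqhom _ _ M N f _ ker) => u.
by have [n h] := dom u; exists n => Y /h[v _ fv]; exists v.
Defined.

Lemma tors_scale M (a : A) v : tors M v -> tors M (a *: v).
Proof. exact: gmemZ. Qed.

Lemma cyc_linear M (v : M) : linear (fun a : (Aalg X)^o => a *: v).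
Proof. by move=> a u w; rewrite scalerDl scalerA. Qed.

Definition cyc_map M d (v : M) : {linear shift (Osheaf X) (- d) -> M} :=
  HB.pack (fun a : (Aalg X)^o => a *: v)
    (GRing.isLinear.Build _ _ _ _ (fun a : (Aalg X)^o => a *: v) (cyc_linear v)).

Lemma cyc_map_comp M d (v : M) (hv : gcomp d v = v) e a :
  cyc_map d v (gcomp e a) = gcomp e (cyc_map d v a).
Proof. by rewrite /= (gcomp_scale _ _ hv). Qed.

(** A homogeneous element of degree [d] amounts to a graded map from O([- d]); these maps let
    universal properties in [coh X] be tested on elements. *)
Definition qcyc M d (v : M) (hv : gcomp d v = v) : qhom (shift (Osheaf X) (- d)) M :=
  qgraph (cyc_map_comp hv).

Lemma monoP M N (f : qhom M N) : @is_mono C M N f <-> qmono f.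
Proof.
split=> [mf u v fv tv|mf Z g h /qeqP fgh]; last first.
  apply/qeqP => z v w gv hw; have [n dn] := qdomP f v; have [m dm] := qdomP f w.
  apply: (@sat_pow _ _ _ _ _ (n + m)%N) => Y hY.
  have [a fa] := dn Y hY; have [b fb] := dm Y hY.
  have fa' : f (Y ^+ (n + m) *: v) (Y ^+ m *: a).
    by rewrite addnC exprD -scalerA; apply: crelZ.
  have fb' : f (Y ^+ (n + m) *: w) (Y ^+ n *: b).
    by rewrite exprD -scalerA; apply: crelZ.
  rewrite scalerBr; apply: mf (crelB fa' fb') _.
  apply: (fgh (Y ^+ (n + m) *: z)); first by exists (Y ^+ (n + m) *: v) => //; apply: crelZ.
  by exists (Y ^+ (n + m) *: w) => //; apply: crelZ.
apply: gmem_comps => d; have hu := gcomp_idem d u.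
have : @heq C _ _ (qcyc hu) (zmor _ _).
  apply: mf; apply/qeqP => a w w' [_ -> fw] [_ -> fw'].
  have tw' : tors N w' by apply: (qkerP fw').
  apply: gmemB => //.
  have fd : f (gcomp d u) (gcomp d v) by apply: crel_comp.
  have := qhom_torsB fw (crelZ a fd).
  by apply: gmemDl; apply/gmemN/gmemZ/gmem_comp.
move=> /qeq0P /(_ 1 (gcomp d u)); apply.
by rewrite /= scale1r.
Qed.

Lemma zeroP M : @is_zero C M <-> forall v, tors M v.
Proof.
rewrite /is_zero /=; split=> [/qeq0P h v|h]; first exact: (h v v).
by apply/qeq0P => u v _; apply: h.
Qed.

Lemma qcomp_qim M N K (g : qhom N K) (f : qhom M N) : qsurj g -> qsurj f -> qsurj (qcomp g f).
Proof.
move=> sg sf w _; have [n h] := sg w I; apply: (@sat_pow _ _ _ _ _ n) => Y hY.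
have [v _ gv] := h Y hY; have [m hm] := sf v I; exists m => Z hZ.
have [u _ fu] := hm Z hZ; exists u => //; exists (Z ^+ m *: v) => //.
exact: crelZ.
Qed.

Lemma qsurj_eq M N (f g : qhom M N) : qeq f g -> qsurj f -> qsurj g.
Proof.
move=> /qeqP fg sf v _; apply: (sat_mono _ (sf v I)) => w [u _ fw].
have [n h] := qdomP g u; apply: (@sat_pow _ _ _ _ _ n) => Y hY.
have [w' gw'] := h Y hY; have fw' := crelZ (Y ^+ n) fw.
rewrite -[_ *: w](subrK w'); apply: gmemD.
  by apply: tors_sat; apply: fg fw' gw'.
by apply: sat_sub; exists (Y ^+ n *: u).
Qed.

Definition qinv M N (f : qhom M N) (mf : qmono f) (sf : qsurj f) : qhom N M.
Proof.
refine (@mkqhom_sat N M (cinv f) _ _).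
- by move=> v; have [n h] := sf v I; exists n => Y /h[u _ fu]; exists u.
- by move=> u fu; apply: mf fu _; apply: gmem0.
Defined.

(** The two elementwise conditions are what the reversed relation [cinv f] needs to be a morphism,
    and it is then the inverse. *)
Lemma invertibleP M N (f : qhom M N) : @invertible C M N f <-> qmono f /\ qsurj f.
Proof.
split=> [[g [/qeqP gf fg]]|[mf sf]].
  split; last first.
    have : qsurj (qcomp f g).
      apply: (qsurj_eq (heq_sym fg)) => v _; apply: sat_sub.
      by exists v.
    move=> s v _; apply: (sat_le _ (s v I)) => w [x _ [u gu fw]].
    by exists u.
  move=> u v fv tv; have [n h] := qdomP g v; apply: (@sat_pow _ _ _ _ _ n) => Y hY.
  have [w gw] := h Y hY; have tw : tors M w by apply: qhom_tors gw; apply: tors_scale.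
  rewrite -[_ *: u](subKr w); apply: gmemB => //.
  by apply: (gf (Y ^+ n *: u)) => //; exists (Y ^+ n *: v) => //; apply: crelZ.
exists (qinv mf sf); split; apply/qeqP.
  move=> u u' u'' [v fv fv'] <-.
  by apply: (mf _ _ (crelB fv' fv)); rewrite subrr; apply: gmem0.
move=> v v' v'' [u fv fv'] <-; exact: qhom_torsB fv' fv.
Qed.

Definition qfactor M N K (i : qhom M K) (j : qhom N K) (mj : qmono j)
  (ij : gsub_le (qim i) (sat (qim j))) : qhom M N.
Proof.
refine (@mkqhom_sat M N (ccomp (cinv j) i) _ _).
- move=> x; have [n h] := qdomP i x; apply: (@sat_pow _ _ _ _ _ n) => Y hY.
  have [z iz] := h Y hY; have [|m hm] := ij z; first by exists (Y ^+ n *: x).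
  exists m => Z hZ; have [y _ jy] := hm Z hZ; exists y => //.
  by exists (Z ^+ m *: z) => //; apply: crelZ.
- by move=> y [z iz jy]; apply: mj jy _; apply: (qkerP iz).
Defined.

Lemma qfactorP M N K (i : qhom M K) (j : qhom N K) (mj : qmono j)
  (ij : gsub_le (qim i) (sat (qim j))) : qeq (qcomp j (qfactor mj ij)) i.
Proof.
apply/qeqP => x z z' [y [w iw jy] jz] iz'.
by rewrite -[z - z'](subrKA w); apply: gmemD; [apply: qhom_torsB jz jy | apply: qhom_torsB iw iz'].
Qed.

Lemma sub_leI M N K (i : qhom M K) (j : qhom N K) : qmono j ->
  gsub_le (qim i) (sat (qim j)) -> @sub_le C M N K i j.
Proof. by move=> mj ij; exists (qfactor mj ij); apply: qfactorP. Qed.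

Lemma sub_leE M N K (i : qhom M K) (j : qhom N K) : @sub_le C M N K i j ->
  gsub_le (qim i) (sat (qim j)).
Proof.
move=> [u /qeqP ju] z [x _ iz]; have [n h] := qdomP (qcomp j u) x.
apply: (@sat_pow _ _ _ _ _ n) => Y hY; have [z' jz'] := h Y hY.
rewrite -[_ *: z](subKr z'); apply: gmemB.
  by apply: sat_sub; case: jz' => y _ jy; exists y.
by apply: tors_sat; apply: ju jz' _; apply: crelZ.
Qed.

Definition qkerle M N K (f : corr M N) (g : corr N K) :=
  forall v w, g v w -> tors K w -> sat (qim f) v.

Definition qcompl M N K (f : corr M N) (g : corr N K) :=
  forall u v w, f u v -> g v w -> tors K w.

Lemma qcomplP M N K (f : qhom M N) (g : qhom N K) :
  qeq (qcomp g f) (qzero M K) <-> qcompl f g.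
Proof.
rewrite qeq0P; split=> h u v; first by move=> w fv gw; apply: (h u); exists v.
by move=> [x fx gv]; apply: h fx gv.
Qed.

Lemma qkerleI M N K (f : qhom M N) (g : qhom N K) :
  (forall v, g v 0 -> sat (qim f) v) -> qkerle f g.
Proof.
move=> h v w gw [n tw]; apply: (@sat_pow _ _ _ _ _ n) => Y hY; apply: h.
by rewrite -(tw Y hY); apply: crelZ.
Qed.

Lemma kernelP M N K (f : qhom M N) (g : qhom N K) :
  @is_kernel C M N K f g <-> [/\ qmono f, qcompl f g & qkerle f g].
Proof.
split=> [[/qcomplP fg univ]|[mf fg kg]].
  split=> //.
    apply/monoP => Z a b ab.
    have [|u [_ uP]] := univ Z (qcomp f a).
      by apply/qcomplP => x y w [z az fy] gw; apply: fg fy gw.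
    apply: heq_trans (uP a _) (heq_sym (uP b _)); first exact: heq_refl.
    exact/heq_sym.
  apply: qkerleI => v gv; apply: gmem_comps => d; have hv := gcomp_idem d v.
  have gd : g (gcomp d v) 0 by rewrite -(gcomp0 _ d); apply: crel_comp.
  have [|u [fu _]] := univ _ (qcyc hv).
    apply/qcomplP => a _ w -> gw.
    by have := qhom_torsB gw (crelZ a gd); rewrite scaler0 subr0.
  apply: (@sub_leE _ _ _ (qcyc hv) f (ex_intro _ u fu)).
  by exists 1 => //=; rewrite scale1r.
split; first exact/qcomplP.
move=> W h /qcomplP gh.
have hle : gsub_le (qim h) (sat (qim f)).
  move=> v [x _ hv]; have [n dn] := qdomP g v.
  apply: (@sat_pow _ _ _ _ _ n) => Y hY; have [w gw] := dn Y hY.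
  by apply: kg (gw) _; apply: gh (gw); apply: crelZ hv.
exists (qfactor mf hle); split; first exact: qfactorP.
move=> u' fu'; apply: (monoP f).2 => //.
exact: (qeq_trans fu' (qeq_sym (qfactorP mf hle))).
Qed.

Lemma qproj0 M (P : gsub M) v w : gproj P v w -> tors (gquot_mod P) w -> sat P v.
Proof.
move=> /= -> [n h]; exists n => Y hY; apply/gpi_eq0; rewrite linearZ /=.
exact: h.
Qed.

Lemma gpi_tors M (P : gsub M) v : sat P v -> tors (gquot_mod P) (gpi P v).
Proof.
move=> [n h]; exists n => Y hY; have /gpi_eq0 := h Y hY.
by rewrite linearZ.
Qed.

Lemma gproj_qim M N (f : qhom M N) : qeq (qcomp (gproj (qim f)) f) (qzero M _).
Proof.
apply/qcomplP => u v w fv /= ->.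
by apply/gpi_tors/sat_sub; exists u.
Qed.

(** The test morphism is the projection onto the quotient by the image of [f]; it is zero only if
    this quotient has finite length. *)
Lemma qsurjP M N (f : qhom M N) :
  (forall W (g : qhom N W), qeq (qcomp g f) (qzero M W) -> qeq g (qzero N W)) -> qsurj f.
Proof.
move=> h v _; have /qeq0P h' := h _ _ (gproj_qim f).
by apply: (@qproj0 _ (qim f) v (gpi _ v)) => //; apply: (h' v).
Qed.

Definition qdescend M N W (p : qhom M N) (h : qhom M W) (sp : qsurj p)
  (ph : forall v w, p v 0 -> h v w -> tors W w) : qhom N W.
Proof.
refine (@mkqhom_sat N W (ccomp h (cinv p)) _ _).
- move=> y; have [n hn] := sp y I; apply: (@sat_pow _ _ _ _ _ n) => Y hY.
  have [x _ px] := hn Y hY; have [m hm] := qdomP h x; exists m => Z hZ.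
  have [w hw] := hm Z hZ; exists w => //; exists (Z ^+ m *: x) => //.
  by apply: crelZ px.
- by move=> w [x px hw]; apply: ph px hw.
Defined.

Lemma qdescendP M N W (p : qhom M N) (h : qhom M W) (sp : qsurj p)
  (ph : forall v w, p v 0 -> h v w -> tors W w) : qeq (qcomp (qdescend sp ph) p) h.
Proof.
apply/qeqP => x w w' [y px [x' px' hw]] hw'; apply: (ph (x' - x)).
  by rewrite -(subrr y); apply: crelB px' px.
exact: crelB.
Qed.

Lemma qsurj_cancel M N W (p : qhom M N) (g h : qhom N W) : qsurj p ->
  qeq (qcomp g p) (qcomp h p) -> qeq g h.
Proof.
move=> sp /qeqP gh; apply/qeqP => y w w' gw hw'; have [n hn] := sp y I.
apply: (@sat_pow _ _ _ _ _ n) => Y hY; have [x _ px] := hn Y hY.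
rewrite scalerBr; apply: (gh x).
  by exists (Y ^+ n *: y) => //; apply: crelZ gw.
by exists (Y ^+ n *: y) => //; apply: crelZ hw'.
Qed.

Lemma qcompl_sat M N K W (f : qhom M N) (g : qhom N K) (h : qhom N W) :
  qkerle f g -> qcompl f h -> forall v w w', g v w -> tors K w -> h v w' -> tors W w'.
Proof.
move=> kg fh v w w' gw tw hw'; have [n hn] := kg v w gw tw.
apply: (@sat_pow _ _ _ _ _ n) => Y hY; have [u _ fu] := hn Y hY.
by apply: fh fu _; apply: crelZ hw'.
Qed.

(** Forward, [p] is compared with the projection modulo the image of [f]; backward, the
    factorization is [p] reversed, followed by [h]. *)
Lemma cokernelP M N K (f : qhom M N) (p : qhom N K) :
  @is_cokernel C M N K f p <-> [/\ qsurj p, qcompl f p & qkerle f p].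
Proof.
split=> [[/qcomplP fp univ]|[sp fp kp]].
  have sp : qsurj p.
    apply: qsurjP => W g gp.
    have [|u [_ uP]] := univ W (qzero N W).
      exact: (@comp0l C).
    apply: (@heq_trans C) (uP g gp) _; apply: (@heq_sym C); apply: uP.
    exact: (@comp0l C).
  split=> // v w pv tw.
  have [|u [/qeqP uP _]] := univ _ (gproj (qim f)); first exact: gproj_qim.
  apply: (@qproj0 _ (qim f) v (gpi _ v)) => //.
  have [n hn] := qdomP u w; apply: (@sat_pow _ _ _ _ _ n) => Y hY.
  have [x ux] := hn Y hY; rewrite -[_ *: _](subKr x); apply: gmemB.
    by apply: qhom_tors ux; apply: tors_scale.
  apply: (uP (Y ^+ n *: v)); last by apply: crelZ.
  by exists (Y ^+ n *: w) => //; apply: crelZ pv.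
split; first exact/qcomplP.
move=> W h /qcomplP fh.
have ph v w : p v 0 -> h v w -> tors W w.
  by move=> pv; apply: (qcompl_sat kp fh pv); apply: gmem0.
exists (qdescend sp ph); split; first exact: qdescendP.
move=> u' pu'; apply: (qsurj_cancel sp).
exact: (qeq_trans pu' (qeq_sym (qdescendP sp ph))).
Qed.

Lemma short_exactP M N K (f : qhom M N) (g : qhom N K) :
  @short_exact C M N K f g <-> [/\ qmono f, qsurj g, qcompl f g & qkerle f g].
Proof.
split=> [[/kernelP[mf fg kg] /cokernelP[sg _ _]] //|[mf sg fg kg]].
by split; [apply/kernelP | apply/cokernelP].
Qed.

Lemma gincl_mono M (P : gsub M) : qmono (gincl P).
Proof.
move=> u _ -> [n h]; exists n => Y hY; apply: val_inj.
exact: h.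
Qed.

Lemma qim_gincl M (P : gsub M) v : qim (gincl P) v <-> P v.
Proof.
split=> [[u _ ->]|Pv]; first exact: gvalP.
by have [u eu] := gval_surj Pv; exists u => //; rewrite -eu.
Qed.

Lemma tors_gsub_mod M (P : gsub M) (u : gsub_mod P) : tors (gsub_mod P) u <-> tors M (gval u).
Proof.
split=> [[n h]|tu]; last exact: (@gincl_mono _ P u (gval u)).
by exists n => Y hY; rewrite /= -[_ *: _]/(gval (Y ^+ n *: u)) (h Y hY).
Qed.
End Elementwise.

(** * Internal direct sums of two submodules *)

Section DirectSums.
Variables (k : finFieldType) (X : wpl k).
Local Notation A := (Aalg X).
Local Notation L := (Lgrp X).
Local Notation c := (cvec X).
Local Notation C := (coh X).
Implicit Types M N K W : grmod X.

Lemma gvalB M (P : gsub M) (u v : gsub_mod P) : gval (u - v) = gval u - gval v.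
Proof. by []. Qed.

Lemma gvalZ M (P : gsub M) a (u : gsub_mod P) : gval (a *: u) = a *: gval u.
Proof. by []. Qed.

(** The morphism out of [M] with restrictions [f] and [g]; since a decomposition of [s] need be
    unique only up to torsion, it is given as a relation. *)
Definition csum2 M W (P Q : gsub M) (f : corr (gsub_mod P) W) (g : corr (gsub_mod Q) W) :
  corr M W.
Proof.
refine (@Corr _ _ M W (fun s w => exists (p : gsub_mod P) (q : gsub_mod Q) (w1 w2 : W),
  [/\ s = gval p + gval q, f p w1, g q w2 & w = w1 + w2]) _ _ _ _).
- by exists 0, 0, 0, 0; split; rewrite ?addr0 //; apply: crel0.
- move=> u u' v v' [p [q [w1 [w2 [-> fp gq ->]]]]] [p' [q' [w1' [w2' [-> fp' gq' ->]]]]].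
  exists (p + p'), (q + q'), (w1 + w1'), (w2 + w2').
  by split; rewrite 1?addrACA //; apply: crelD.
- move=> a u v [p [q [w1 [w2 [-> fp gq ->]]]]].
  by exists (a *: p), (a *: q), (a *: w1), (a *: w2); split; rewrite ?scalerDr //; apply: crelZ.
- move=> d u v [p [q [w1 [w2 [-> fp gq ->]]]]].
  exists (gcomp d p), (gcomp d q), (gcomp d w1), (gcomp d w2).
  by split; rewrite ?gcompD //; apply: crel_comp.
Defined.

Lemma direct_sum2 M (P Q : gsub M) :
  (forall v, P v -> Q v -> tors M v) -> gsub_le (gsub_full M) (sat (gsub_add P Q)) ->
  @is_direct_sum C bool (fun b => gsub_mod (if b then P else Q)) M
    (fun b => gincl (if b then P else Q)).
Proof.
move=> PQ sPQ W f.
have split0 (p : gsub_mod P) (q : gsub_mod Q) : gval p + gval q = 0 ->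
    tors (gsub_mod P) p /\ tors (gsub_mod Q) q.
  move=> /eqP; rewrite addr_eq0 => /eqP e.
  have tp : tors M (gval p) by apply: PQ (gvalP p) _; rewrite e; apply/gmemN/gvalP.
  split; apply/tors_gsub_mod => //.
  by rewrite -[gval q]opprK -e; apply: gmemN.
pose r := csum2 (f true) (f false).
have rdom s : sat (cdom r) s.
  have [n h] := sPQ s I; apply: (@sat_pow _ _ _ _ _ n) => Y hY.
  have [p0 [q0 [Pp Qq e]]] := h Y hY.
  have [p ep] := gval_surj Pp; have [q eq] := gval_surj Qq.
  have [n1 h1] := qdomP (f true) p; have [n2 h2] := qdomP (f false) q.
  exists (n1 + n2)%N => Z hZ; have [w1 fw1] := h1 Z hZ; have [w2 fw2] := h2 Z hZ.
  exists (Z ^+ n2 *: w1 + Z ^+ n1 *: w2) => //.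
  exists (Z ^+ (n1 + n2) *: p), (Z ^+ (n1 + n2) *: q), (Z ^+ n2 *: w1), (Z ^+ n1 *: w2).
  split=> //.
  - by rewrite e -ep -eq gvalZ gvalZ -scalerDr.
  - by rewrite addnC exprD -scalerA; apply: crelZ.
  - by rewrite exprD -scalerA; apply: crelZ.
have rker w : r 0 w -> tors W w.
  move=> [p [q [w1 [w2 [e fp fq ->]]]]]; have [tp tq] := split0 p q (esym e).
  by apply: gmemD; [apply: qhom_tors tp fp | apply: qhom_tors tq fq].
exists (mkqhom_sat rdom rker); split.
  case; apply/qeqP => x w w'.
    move=> [_ -> [p [q [w1 [w2 [e fp fq ->]]]]]] fx.
    have [|tp tq] := split0 (p - x) q.
      by rewrite gvalB (e : gval x = _) opprD addrA subrr add0r addNr.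
    rewrite addrAC; apply: gmemD; last exact: qhom_tors tq fq.
    exact: (qhom_tors tp (crelB fp fx)).
  move=> [_ -> [p [q [w1 [w2 [e fp fq ->]]]]]] fx.
  have [|tp tq] := split0 p (q - x).
    by rewrite gvalB (e : gval x = _) addrA subrr.
  rewrite -addrA; apply: gmemD; first exact: qhom_tors tp fp.
  exact: (qhom_tors tq (crelB fq fx)).
move=> u' hu'; apply/qeqP => s w w' us [p [q [w1 [w2 [e fp fq ->]]]]].
have [n1 h1] := qdomP u' (gval p); have [n2 h2] := qdomP u' (gval q).
apply: (@sat_pow _ _ _ _ _ (n1 + n2)%N) => Y hY.
have [v1 uv1] := h1 Y hY; have [v2 uv2] := h2 Y hY.
have uv1' : u' (Y ^+ (n1 + n2) *: gval p) (Y ^+ n2 *: v1).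
  by rewrite addnC exprD -scalerA; apply: crelZ.
have uv2' : u' (Y ^+ (n1 + n2) *: gval q) (Y ^+ n1 *: v2).
  by rewrite exprD -scalerA; apply: crelZ.
have /qeqP/(_ (Y ^+ (n1 + n2) *: p) (Y ^+ n2 *: v1) (Y ^+ (n1 + n2) *: w1)) t1 := hu' true.
have /qeqP/(_ (Y ^+ (n1 + n2) *: q) (Y ^+ n1 *: v2) (Y ^+ (n1 + n2) *: w2)) t2 := hu' false.
have {}t1 : tors W (Y ^+ n2 *: v1 - Y ^+ (n1 + n2) *: w1).
  apply: t1; last exact: crelZ.
  by exists (Y ^+ (n1 + n2) *: gval p).
have {}t2 : tors W (Y ^+ n1 *: v2 - Y ^+ (n1 + n2) *: w2).
  apply: t2; last exact: crelZ.
  by exists (Y ^+ (n1 + n2) *: gval q).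
have us' := crelZ (Y ^+ (n1 + n2)) us; rewrite e scalerDr in us'.
have := gmemD (qhom_torsB us' (crelD uv1' uv2')) (gmemD t1 t2).
by rewrite -[X in _ + X]addrACA -opprD -scalerDr addrA subrK scalerBr.
Qed.

Lemma indecomposable_split M (P Q : gsub M) : @indecomposable C M ->
  (forall v, P v -> Q v -> tors M v) -> gsub_le (gsub_full M) (sat (gsub_add P Q)) ->
  (gsub_le P (tors M)) \/ (gsub_le Q (tors M)).
Proof.
move=> [_ ind] PQ sPQ; case: (ind _ _ (direct_sum2 PQ sPQ)) => /zeroP h; [left | right].
  by move=> v Pv; have [u <-] := gval_surj Pv; apply/tors_gsub_mod/h.
by move=> v Pv; have [u <-] := gval_surj Pv; apply/tors_gsub_mod/h.
Qed.
End DirectSums.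

(** * Projections and components of a finite direct sum *)

Section Summands.
Variables (k : finFieldType) (X : wpl k).
Local Notation A := (Aalg X).
Local Notation C := (coh X).
Implicit Types M N K W : grmod X.

Variables (m : nat) (S : grmod X) (F : 'I_m -> grmod X).
Variable inj : forall j, qhom (F j) S.
Hypothesis dsum : @is_direct_sum C _ F S inj.

(** The Kronecker delta, from which the coproduct property yields the projections. The cast
    transports the identity along [j' = j]. *)
Definition dproj_fam (j j' : 'I_m) : qhom (F j') (F j) :=
  match @eqP _ j' j with
  | ReflectT e => ecast i (qhom (F j') (F i)) e (qid (F j'))
  | ReflectF _ => qzero _ _
  end.

Lemma dproj_fam_id j : dproj_fam j j = qid (F j).
Proof. by rewrite /dproj_fam; case: eqP => // e; rewrite (eq_axiomK e). Qed.

Lemma dproj_fam_ne j j' : j' != j -> dproj_fam j j' = qzero _ _.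
Proof. by rewrite /dproj_fam; case: eqP. Qed.

Lemma dproj_exists j : exists p : qhom S (F j), forall j', qeq (qcomp p (inj j')) (dproj_fam j j').
Proof. by have [p [pP _]] := dsum (dproj_fam j); exists p. Qed.

Definition dproj j : qhom S (F j) := sval (cid (dproj_exists j)).

Lemma dproj_inj j x s y : inj j x s -> dproj j s y -> tors (F j) (y - x).
Proof.
rewrite /dproj; case: cid => p pP ix py; have /qeqP := pP j.
rewrite dproj_fam_id; apply; last by [].
by exists s.
Qed.

Lemma dproj_ne j j' x s y : j' != j -> inj j' x s -> dproj j s y -> tors (F j) y.
Proof.
rewrite /dproj; case: cid => p pP ne ix py; have := pP j'.
rewrite dproj_fam_ne // => /qeq0P h; apply: (h x).
by exists s.
Qed.

Lemma inj_mono j : qmono (inj j).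
Proof.
move=> x s ix ts; have [n h] := qdomP (dproj j) s.
apply: (@sat_pow _ _ _ _ _ n) => Y hY; have [y py] := h Y hY.
rewrite -[_ *: x](subKr y); apply: gmemB; first by apply: qhom_tors py; apply: tors_scale.
by apply: dproj_inj py; apply: crelZ ix.
Qed.

Lemma dproj_surj j : qsurj (dproj j).
Proof.
move=> y _; have [n h] := qdomP (qcomp (dproj j) (inj j)) y.
apply: (@sat_pow _ _ _ _ _ n) => Y hY; have [y' [s is_ py']] := h Y hY.
rewrite -[_ *: y](subKr y'); apply: gmemB; first by apply: sat_sub; exists s.
by apply: tors_sat; apply: dproj_inj is_ py'.
Qed.

Lemma qdom_family (G : 'I_m -> grmod X) M (g : forall j, qhom M (G j)) (u : 'I_m -> M) :
  exists n, forall Y, isY Y -> forall j, exists v, g j (Y ^+ n *: u j) v.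
Proof.
have /choice[n nP] : forall j, exists n, forall Y, isY Y -> exists v, g j (Y ^+ n *: u j) v.
  by move=> j; apply: qdomP.
exists (\sum_j n j)%N => Y hY j; have [v gv] := nP j Y hY.
exists (Y ^+ (\sum_(i | i != j) n i) *: v); rewrite (bigD1 j) //= addnC exprD -scalerA.
exact: crelZ.
Qed.

Section FamilySum.
Variables (M : grmod X) (g : forall j, qhom M (F j)).

(** Hom-sets of a [zcat] carry no addition, so the sum of the composites of [inj j] with [g j] is
    formed as a relation. *)
Definition csum : corr M S.
Proof.
refine (@Corr _ _ M S (fun s s' => exists sg : 'I_m -> S,
  s' = \sum_j sg j /\ forall j, exists2 x, g j s x & inj j x (sg j)) _ _ _ _).
- exists (fun=> 0); split; first by rewrite big1.
  by move=> j; exists 0; apply: crel0.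
- move=> u u' v v' [sg [-> h]] [sg' [-> h']]; exists (fun j => sg j + sg' j).
  rewrite big_split; split=> // j; have [x px ix] := h j; have [x' px' ix'] := h' j.
  by exists (x + x'); apply: crelD.
- move=> a u v [sg [-> h]]; exists (fun j => a *: sg j); rewrite scaler_sumr.
  by split=> // j; have [x px ix] := h j; exists (a *: x); apply: crelZ.
- move=> d u v [sg [-> h]]; exists (fun j => gcomp d (sg j)); rewrite gcomp_sumE.
  by split=> // j; have [x px ix] := h j; exists (gcomp d x); apply: crel_comp.
Defined.

Lemma csum_dom s : sat (cdom csum) s.
Proof.
have [n h] := qdom_family (fun j => qcomp (inj j) (g j)) (fun=> s).
exists n => Y hY.
have /choice[sg sgP] : forall j, exists v, qcomp (inj j) (g j) (Y ^+ n *: s) v.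
  by move=> j; apply: h.
by exists (\sum_j sg j) => //; exists sg.
Qed.

Lemma csum_ker s : csum 0 s -> tors S s.
Proof.
move=> [sg [-> h]]; apply: gmem_sum => j; have [x px ix] := h j.
by apply: qhom_tors ix; apply: (qkerP px).
Qed.

Definition qsum : qhom M S := mkqhom_sat csum_dom csum_ker.

(** Projecting the sum to [F j] leaves its [j]-th component up to torsion. *)
Lemma qsum_tors u s j x : qsum u s -> tors S s -> g j u x -> tors (F j) x.
Proof.
move=> [sg [es h]] ts gx; have [xj gxj ixj] := h j.
have txj : tors (F j) (x - xj) by apply: qhom_torsB gx gxj.
rewrite -[x](subrK xj); apply: gmemD => //.
have [n hn] := qdom_family (fun=> dproj j) sg.
apply: (@sat_pow _ _ _ _ _ n) => Y hY.
have /choice[v vP] : forall l, exists v, dproj j (Y ^+ n *: sg l) v by move=> l; apply: hn.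
have tv l : l != j -> tors (F j) (v l).
  move=> nl; have [xl _ ixl] := h l.
  by apply: dproj_ne nl (crelZ (Y ^+ n) ixl) (vP l).
have tj := dproj_inj (crelZ (Y ^+ n) ixj) (vP j).
have ps : dproj j (Y ^+ n *: s) (\sum_l v l).
  rewrite es scaler_sumr; elim/big_ind2: _ => [||l _]; [exact: crel0 | | exact: vP].
  by move=> *; apply: crelD.
have tS : tors (F j) (\sum_l v l) by apply: qhom_tors ps; apply: tors_scale.
rewrite (bigD1 j) // in tS.
have t0 : tors (F j) (\sum_(l | l != j) v l).
  elim/big_ind: _ => [||l nl]; [exact: gmem0 | exact: gmemD | exact: tv].
rewrite -[_ *: xj](subKr (v j)); apply: gmemB => //.
exact: gmemDl t0 tS.
Qed.
End FamilySum.

(** Both sides restrict to [inj j] on each summand, and the coproduct property makes such a morphism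
    unique. *)
Lemma qidem_id : qeq (qsum dproj) (qid S).
Proof.
have [u [_ uP]] := dsum inj.
apply: qeq_trans (uP (qsum dproj) _) (qeq_sym (uP (qid S) _)).
  move=> j; apply/qeqP => x s' s [s0 is0 [sg [-> h]]] is_.
  have ts : tors S (s0 - s) by apply: qhom_torsB is0 is_.
  rewrite -[_ - s](subrKA s0); apply: gmemD => //.
  rewrite (bigD1 j) // addrAC; apply: gmemD.
    have [y py iy] := h j; apply: qhom_tors (crelB iy is0).
    exact: dproj_inj is0 py.
  rewrite big_seq_cond; elim/big_ind: _ => [||l /andP[_ nl]]; [exact: gmem0 | exact: gmemD |].
  have [y py iy] := h l; apply: qhom_tors iy.
  by apply: dproj_ne is0 py; rewrite eq_sym.
by move=> j; apply: qcomp1l.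
Qed.

Definition gsum (Q : 'I_m -> gsub S) : gsub S.
Proof.
refine (@GSub _ _ S (fun v => exists sg : 'I_m -> S, v = \sum_j sg j /\ forall j, Q j (sg j)) _ _ _ _).
- by exists (fun=> 0); rewrite big1 //; split=> // j; apply: gmem0.
- move=> u v [f [-> hf]] [g [-> hg]]; exists (fun j => f j + g j).
  by rewrite big_split; split=> // j; apply: gmemD.
- by move=> a u [f [-> hf]]; exists (fun j => a *: f j); rewrite scaler_sumr; split=> // j; apply: gmemZ.
- by move=> d u [f [-> hf]]; exists (fun j => gcomp d (f j)); rewrite gcomp_sumE; split=> // j; apply: gmem_comp.
Defined.

Lemma dsum_span s : sat (gsum (fun j => qim (inj j))) s.
Proof.
have [n h] := csum_dom dproj s; apply: (@sat_pow _ _ _ _ _ n) => Y hY.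
have [s' _ es'] := h Y hY; have /qeqP e := qidem_id.
rewrite -[_ *: s](subKr s'); apply: gmemB; last by apply: tors_sat; apply: e es' _.
apply: sat_sub; case: es' => sg [-> hs]; exists sg; split=> // j.
by have [x _ ix] := hs j; exists x.
Qed.

End Summands.

(** * Finite length passes to subobjects *)

Section FiniteLengthSub.
Variables (k : finFieldType) (X : wpl k).
Local Notation C := (coh X).
Implicit Types M N K W : grmod X.

(** Induction on a composition series. Either the image of [Z] in the last simple factor is zero,
    and [Z] embeds into the smaller term, or it is everything, and the kernel embeds there. *)
Lemma finite_length_sub (Y : C) : finite_length Y ->
  forall (Z : C) (i : qhom Z Y), qmono i -> finite_length Z.
Proof.
elim=> [{}Y /zeroP zY|X' {}Y S f p _ IH /short_exactP[mf sp fp kp] [nzS simS]] Z i mi.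
  by apply: finite_length0; apply/zeroP => v; have [n h] := qdomP i v;
    apply: (@sat_pow _ _ _ _ _ n) => y hy; have [w iw] := h y hy; apply: mi iw _.
pose g := qcomp p i; pose T := qim g.
case: (simS (gsub_mod T) (gincl T)); first by apply/monoP/gincl_mono.
  move=> /zeroP zT.
  have Tt v : T v -> tors S v by move=> /gval_surj[u <-]; apply/tors_gsub_mod/zT.
  have if_ : gsub_le (qim i) (sat (qim f)).
    move=> y [z _ iz]; have [n h] := qdomP p y; apply: (@sat_pow _ _ _ _ _ n) => Yn hY.
    have [w pw] := h Yn hY; apply: kp (pw) _; apply: Tt.
    by exists (Yn ^+ n *: z) => //; exists (Yn ^+ n *: y) => //; apply: crelZ.
  apply: (IH Z (qfactor mf if_)) => z x [y iy fx] tx.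
  by apply: mi iy _; apply: qhom_tors tx fx.
move=> /invertibleP[_ sT].
have sg : qsurj g by move=> v _; apply: (sat_le _ (sT v I)) => w /qim_gincl.
pose K := cimg (cinv g) (gsub_zero S).
have se : @short_exact C (gsub_mod K) Z S (gincl K) g.
  apply/short_exactP; split=> //; first exact: gincl_mono.
    move=> u v w uv gw; have [y ey gy] : K v by rewrite uv; apply: gvalP.
    rewrite {}ey in gy; have := qhom_torsB gw gy; by rewrite subr0.
  apply: qkerleI => v gv; apply: sat_sub; apply/qim_gincl.
  by exists 0.
apply: finite_lengthS se (conj nzS simS).
have if_ : gsub_le (qim (qcomp i (gincl K))) (sat (qim f)).
  move=> y [z _ [z' ez iz]]; rewrite ez in iz.
  have [w ew [y' iy' py']] := gvalP z; rewrite {}ew in py'.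
  have yy : tors Y (y - y') by apply: qhom_torsB iz iy'.
  rewrite -[y](subrK y'); apply: gmemD; first exact: tors_sat.
  by apply: kp py' _; apply: gmem0.
apply: (IH _ (qfactor mf if_)) => z x [y [z' ez iy] fx] tx.
rewrite {}ez in iy; apply/tors_gsub_mod; apply: mi iy _; exact: qhom_tors tx fx.
Qed.
End FiniteLengthSub.

(** * Indecomposable torsion sheaves *)

Section Killing.
Variables (k : finFieldType) (X : wpl k).
Local Notation A := (Aalg X).
Local Notation L := (Lgrp X).
Local Notation c := (cvec X).
Local Notation C := (coh X).
Implicit Types M K W : grmod X.

Definition kills (a : A) M := forall v, tors M (a *: v).

Definition annih M (a : A) d (ha : Ahomog d a) : gsub M.
Proof.
refine (@GSub _ _ M (fun v => tors M (a *: v)) _ _ _ _).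
- by rewrite scaler0; apply: gmem0.
- by move=> u v tu tv; rewrite scalerDr; apply: gmemD.
- by move=> b v tv; rewrite scalerA mulrC -scalerA; apply: gmemZ.
- by move=> e v tv; rewrite -(gcompZ _ _ ha); apply: gmem_comp.
Defined.

Definition coprimeA (a b : A) :=
  exists n, forall Y : A, isY Y -> exists r s, Y ^+ n = r * a + s * b.

(** [M] is the direct sum of the parts killed by [a] and by [b], so one of these parts is zero. *)
Lemma coprime_kill M d e (a b : A) : Ahomog d a -> Ahomog e b -> @indecomposable C M ->
  coprimeA a b -> kills (a * b) M -> kills a M \/ kills b M.
Proof.
move=> ha hb ind [N cop] kab.
case: (@indecomposable_split _ _ M (annih M ha) (annih M hb) ind) => [v tav tbv|v _|h|h].
- apply: (@sat_pow _ _ _ _ _ N) => Y hY; have [r [s ->]] := cop Y hY.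
  by rewrite scalerDl -scalerA -scalerA; apply: gmemD; apply: gmemZ.
- exists N => Y hY; have [r [s ->]] := cop Y hY; rewrite scalerDl addrC.
  exists ((s * b) *: v), ((r * a) *: v); split=> //.
    by rewrite -scalerA /=; apply: (gmemZ (g := annih M ha)); rewrite /= scalerA; apply: kab.
  rewrite -scalerA; apply: (gmemZ (g := annih M hb)); rewrite /= scalerA mulrC.
  exact: kab.
- by right=> v; apply: h; rewrite /= scalerA; apply: kab.
- by left=> v; apply: h; rewrite /= scalerA mulrC; apply: kab.
Qed.

Lemma coprime_bform n m (b h : {poly k}) : coprimep b h -> (size b <= n.+1)%N ->
  (size h <= m.+1)%N -> size b = n.+1 \/ size h = m.+1 ->
  coprimeA (bform X n b) (bform X m h).
Proof.
move=> cop sb sh full; exists (n + m)%N => Y [] ->.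
  have s1 : (size (1 : {poly k})%R <= (n + m).+1)%N by rewrite size_poly1.
  have [r [s e]] := bezout_bform X cop sb sh full (leqnn _) s1.
  by exists r, s; rewrite -e -(expr0 'X) bformXn // expr0 mul1r subn0.
have s1 : (size ('X^(n + m) : {poly k})%R <= (n + m).+1)%N by rewrite size_polyXn.
have [r [s e]] := bezout_bform X cop sb sh full (leqnn _) s1.
by exists r, s; rewrite -e bformXn // subnn expr0 mulr1.
Qed.

Lemma irreducible_factor (b : {poly k}) : (1 < size b)%N ->
  exists h : {poly k}, [/\ h \is monic, irreducible_poly h & h %| b].
Proof.
have [n] := ubnP (size b); elim: n => // n IH in b *; rewrite ltnS => ln sb.
case: (EM (irreducible_poly b)) => [irr|nirr].
  have b0 : b != 0 by rewrite -size_poly_gt0 ltnW.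
  have lc : lead_coef b != 0 by rewrite lead_coef_eq0.
  exists ((lead_coef b)^-1 *: b); split.
  - by rewrite monicE lead_coefZ mulVf.
  - split=> [|q sq dq]; first by rewrite size_scale ?invr_eq0.
    have e : (lead_coef b)^-1 *: b %= b by apply: eqp_scale; rewrite invr_eq0.
    apply: eqp_trans (irr.2 q sq _) _; last by rewrite eqp_sym.
    by rewrite -(eqp_dvdr _ e).
  - by rewrite dvdpZl ?invr_eq0.
have [q [sq dq ne]] : exists q : {poly k}, [/\ size q != 1%N, q %| b & ~~ (q %= b)].
  apply: contra_notP nirr => H; split=> // q sq dq; apply: contraT => ne.
  by case: H; exists q.
have b0 : b != 0 by rewrite -size_poly_gt0 ltnW.
have q0 : q != 0 by apply: contraTneq dq => ->; rewrite dvd0p.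
have sqb : (size q < size b)%N.
  rewrite ltn_neqAle dvdp_leq // andbT; apply: contra ne => /eqP sqb.
  by rewrite -dvdp_size_eqp // sqb.
have [||h [mh ih dh]] := IH q.
- exact: leq_trans sqb ln.
- by rewrite ltn_neqAle eq_sym sq size_poly_gt0.
by exists h; split=> //; apply: dvdp_trans dh dq.
Qed.

Lemma coprime_part (h b : {poly k}) : irreducible_poly h -> b != 0 ->
  exists e (b' : {poly k}), b = h ^+ e * b' /\ coprimep h b'.
Proof.
move=> irr; have [n] := ubnP (size b); elim: n => // n IH in b *; rewrite ltnS => ln b0.
have [dh|ndh] := boolP (h %| b); last first.
  by exists 0%N, b; rewrite expr0 mul1r irreducible_poly_coprime.
have h0 := irredp_neq0 irr; have sh := irr.1.
have eb : b = b %/ h * h by rewrite divpK.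
have q0 : b %/ h != 0 by apply: contraNneq b0 => q0; rewrite eb q0 mul0r.
have [||e [b' [e1 cop]]] := IH (b %/ h) => //.
  have b0' : (0 < size b)%N by rewrite size_poly_gt0.
  rewrite size_divp //; move: ln b0' sh; move: (size b) (size h) => u v; lia.
by exists e.+1, b'; split=> //; rewrite eb e1 exprSr mulrAC.
Qed.

Lemma kills_eq M (a b : A) : a = b -> kills a M -> kills b M.
Proof. by move=> ->. Qed.

(** Induction on the degree, splitting off the full power of one closed point at a time; by
    [coprime_kill] one of the two factors still kills [M]. *)
Lemma indecomposable_kills_bform M n (b : {poly k}) : @indecomposable C M -> b != 0 ->
  (size b <= n.+1)%N -> kills (bform X n b) M ->
  exists z N, closed_point z /\ kills (zform X z ^+ N) M.
Proof.
move=> ind; have [m] := ubnP n; elim: m => // m IH in n b *; rewrite ltnS => ln b0 sb kb.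
have szb : (0 < size b)%N by rewrite size_poly_gt0.
have nzM : ~ forall v, tors M v by have [nz _] := ind; move=> h; apply/nz/zeroP.
(* A size below [n.+1] means a factor Y1, that is, a zero at infinity. *)
move: sb; rewrite leq_eqVlt ltnS => /orP[/eqP sb|sb]; last first.
  have e : bform X (n - (size b).-1) 1 * bform X (size b).-1 b = bform X n b.
    rewrite bformM ?size_poly1 ?mul1r ?leqSpred // subnK //.
    by move: szb sb; move: (size b) => q; lia.
  have eY : bform X (n - (size b).-1) 1 = zform X None ^+ (n - (size b).-1).
    rewrite zform_form // bform_exp ?size_poly1 //= mul1n expr1n //.
  have [|kY|kb'] := coprime_kill (Ahomog_bform X _ _) (Ahomog_bform X _ _) ind _ (kills_eq (esym e) kb).
  - apply: coprime_bform; rewrite ?coprime1p ?size_poly1 ?leqSpred //.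
    by right; rewrite prednK.
  - by exists None, (n - (size b).-1)%N; split=> //; rewrite -eY.
  - apply: (IH _ b) kb' => //; last by rewrite leqSpred.
    by move: szb sb ln; move: (size b) => q; lia.
(* In degree 0 the form is a nonzero constant, which kills only the zero sheaf. *)
case: n => [|n] in ln sb kb *.
  case: nzM => v; have := kb (kA X (b`_0)^-1 *: v); rewrite scalerA.
  have -> : bform X 0 b = kA X b`_0.
    by rewrite /bform big_ord1 subnn !expr0 !mulr1.
  rewrite -rmorphM mulfV ?rmorph1 ?scale1r //.
  by have := b0; rewrite -lead_coef_eq0 /lead_coef sb.
have [|h [mh ih dh]] := irreducible_factor (b := b); first by rewrite sb.
have [e [b' [eb cop]]] := coprime_part ih b0.
have he0 : h ^+ e != 0 by rewrite expf_neq0 // monic_neq0.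
have b'0 : b' != 0 by apply: contraNneq b0 => b'0; rewrite eb b'0 mulr0.
have clz : closed_point (Some h) by [].
have sh := closed_point_size clz.
have se : size (h ^+ e) = ((size h).-1 * e).+1.
  by rewrite -size_exp prednK // size_poly_gt0.
have e0 : (0 < e)%N.
  case: (posnP e) => // e0; rewrite e0 expr0 mul1r in eb; rewrite -eb in cop.
  have := coprimepP _ _ cop h (dvdpp h) dh; rewrite -size_poly_eq1 => /eqP sh1.
  by rewrite sh1 in sh.
have sb' : size b = ((size h).-1 * e + size b')%N.
  by rewrite eb size_mul // se.
have szb' : (0 < size b')%N by rewrite size_poly_gt0.
have en : n.+1 = ((size h).-1 * e + (size b').-1)%N.
  by move: sb' szb'; rewrite sb; move: (size b') (_ * e)%N => q r; lia.
have ef : zform X (Some h) ^+ e * bform X (size b').-1 b' = bform X n.+1 b.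
  rewrite zform_form // bform_exp ?size_zlin // bformM ?leqSpred ?se //.
  by rewrite -en -eb.
have [|kY|kb'] := coprime_kill (Ahomog_zform X (Some h) e) (Ahomog_bform X _ _) ind _ (kills_eq (esym ef) kb).
- rewrite zform_form // bform_exp ?size_zlin //; apply: coprime_bform.
  + by apply: coprimep_expl.
  + by rewrite se.
  + by rewrite leqSpred.
  + by right; rewrite prednK.
- by exists (Some h), e.
- apply: (IH _ b') kb' => //; last by rewrite leqSpred.
  have : (0 < (size h).-1 * e)%N by rewrite muln_gt0 e0 andbT; case: (size h) sh => [|[]].
  by move: en ln; move: (_ * e)%N (size b').-1 => q r; lia.
Qed.

Lemma indecomposable_tube M d (a : A) : @indecomposable C M -> Ahomog d a -> a != 0 ->
  kills a M -> exists z N, closed_point z /\ kills (zform X z ^+ N) M.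
Proof.
move=> ind ha a0 ka; have [l [n [b [_ sb ea _]]]] := normal_form ha a0.
have b0 : b != 0 by apply: contraNneq a0 => b0; rewrite ea b0 bform0 mulr0.
pose w : A := xmon (fun i => (weight i).-1 * l i)%N.
have ew : w * a = bform X (\sum_i l i + n) (linprod l * b).
  rewrite -bformM ?size_linprod // -xmon_weight ea mulrA -xmonD; congr (_ * _).
  by apply: eq_xmon => i; rewrite -{2}[l i]mul1n -mulnDl addn1 prednK ?weight_gt0.
apply: (@indecomposable_kills_bform M (\sum_i l i + n)%N (linprod l * b)) => //.
- rewrite mulf_neq0 //; apply/prodf_neq0 => i _; exact/expf_neq0/lin_neq0.
- by apply: size_mul_leS => //; apply: size_linprod.
- by move=> v; rewrite -ew -scalerA; apply: gmemZ.
Qed.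
End Killing.

(** * Sheaves killed by a power of one prime *)

Section Primary.
Variables (k : finFieldType) (X : wpl k).
Local Notation A := (Aalg X).
Local Notation L := (Lgrp X).
Local Notation c := (cvec X).
Local Notation C := (coh X).
Implicit Types M K W : grmod X.
Variables (z : option {poly k}) (clz : closed_point z).
Local Notation pz := (pelt X z).

Lemma Ahomog_pzX n : Ahomog (pdeg X z *+ n) (pz ^+ n).
Proof. exact/AhomogX/Ahomog_pelt. Qed.

(** By [bezout_nvan], [u] is invertible modulo [pz ^+ e] up to finite length, so it can be cancelled
    as in a local ring. *)
Lemma loc_sat M e d (u : A) (P : gsub M) v : kills (pz ^+ e) M -> Ahomog d u -> nvan z u ->
  sat P (u *: v) -> sat P v.
Proof.
move=> ke hu nu Pu; have [n [b1 b2]] := bezout_nvan e clz hu nu.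
apply: (@sat_pow _ _ _ _ _ n) => Y hY.
have [r [s ->]] : exists r s, Y ^+ n = r * u + s * pz ^+ e by case: hY => ->.
rewrite scalerDl -scalerA -scalerA; apply: gmemD; first exact: gmemZ.
by apply/gmemZ/tors_sat/ke.
Qed.

Lemma nvan_isY : exists2 Y : A, isY Y & nvan z Y.
Proof. by have [Y hY nY] := nvan_Y X clz; exists Y. Qed.

Lemma nvan_isYX (Y : A) n : isY Y -> nvan z Y -> nvan z (Y ^+ n).
Proof. by move=> hY; apply: nvanX => //; apply: Ahomog_isY. Qed.

(** [Q] is enlarged by a corrected multiple of [s] so that it still meets the span of [x] in
    torsion. The two hypotheses on [pz] say that [x] has maximal length, which is what permits the
    correction. *)
Lemma complement_step M n dx (x : M) (hx : gcomp dx x = x) ds s (Q : gsub M) :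
  kills (pz ^+ n.+1) M -> ~ tors M (pz ^+ n *: x) -> gcomp ds s = s ->
  (forall v, Q v -> cyc hx v -> tors M v) -> sat (gsub_add Q (cyc hx)) (pz *: s) ->
  exists Q' : gsub M, [/\ gsub_le Q Q', forall v, Q' v -> cyc hx v -> tors M v &
    sat (gsub_add Q' (cyc hx)) s].
Proof.
move=> kn nx hs Qx sQ.
case: (EM (sat (gsub_add Q (cyc hx)) s)) => [|ns]; first by exists Q; split.
have [Y hY nY] := nvan_isY; have [m hm] := sQ.
have [c0 [_ [Qc [a0 ->] e0]]] := hm Y hY.
have hYm := AhomogX m (Ahomog_isY hY); have nYm := @nvan_isYX Y m hY nY.
have hp := Ahomog_pelt X z.
pose E := ds + pdeg X z + c *+ m.
have hE : gcomp E (Y ^+ m *: (pz *: s)) = Y ^+ m *: (pz *: s).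
  by rewrite (gcompZr _ _ hYm) /E addrK (gcompZr _ _ hp) addrK hs.
have [c1 Qc1 [a ha e1]] : exists2 c1, Q c1 & exists2 a, Ahomog (E - dx) a &
    Y ^+ m *: (pz *: s) = c1 + a *: x.
  exists (gcomp E c0); first exact: gmem_comp.
  exists (Acomp (E - dx) a0); first exact: Ahomog_comp.
  by rewrite -hE e0 gcompD (gcomp_scale _ _ hx).
(* If [a] did not vanish at [z], multiplying by [pz ^+ n] would put [a *: (pz ^+ n *: x)], up to
   powers of Y1 and Y2, into both [Q] and the span of [x], hence into torsion. *)
case: (nvanVdvd z a) => [na|[a1 ea]].
  case: nx; apply: (loc_sat kn ha na).
  have tt : tors M (pz ^+ n *: c1 + pz ^+ n *: (a *: x)).
    rewrite -scalerDr -e1 scalerA mulrC -scalerA; apply: gmemZ.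
    by rewrite scalerA -exprSr; apply: kn.
  have [q hq] := tt; apply: (@sat_pow _ _ _ _ _ q) => Z hZ.
  have e2 : Z ^+ q *: (pz ^+ n *: c1) = - ((Z ^+ q * (pz ^+ n * a)) *: x).
    by apply/eqP; rewrite -addr_eq0 -scalerA -scalerA -scalerDr; apply/eqP/hq.
  have -> : Z ^+ q *: (a *: (pz ^+ n *: x)) = - (Z ^+ q *: (pz ^+ n *: c1)).
    by rewrite e2 opprK scalerA scalerA -mulrA (mulrC a).
  apply/gmemN/Qx; first exact/gmemZ/gmemZ.
  by rewrite e2 -scaleNr; exists (- (Z ^+ q * (pz ^+ n * a))).
have [a' ha' ea'] := dvd_homog hp ha ea.
(* The corrected element: [pz *: y] is [c1], hence in [Q]. *)
pose y := Y ^+ m *: s - a' *: x.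
have hy : gcomp (ds + c *+ m) y = y.
  rewrite /y gcompD gcompN (gcompZr _ _ hYm) addrK hs (gcompZr _ _ ha').
  have -> : ds + c *+ m - (E - dx - pdeg X z) = dx.
    by rewrite /E [ds + _ + c *+ m]addrAC [_ - dx - _]addrAC addrK subKr.
  by rewrite hx.
have py : pz *: y = c1.
  rewrite /y scalerBr scalerA mulrC -scalerA e1 scalerA (mulrC pz) -ea' addrK //.
exists (gsub_add Q (cyc hy)); split; first exact: gsub_addl.
  move=> v [c2 [_ [Qc2 [b0 ->] ev]]] xv; apply: gmem_comps => d.
  have xd : cyc hx (gcomp d v) by apply: gmem_comp.
  have hb := Ahomog_comp (d - (ds + c *+ m)) b0.
  have evd : gcomp d v = gcomp d c2 + Acomp (d - (ds + c *+ m)) b0 *: y.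
    by rewrite ev gcompD (gcomp_scale _ _ hy).
  have Qd : Q (gcomp d c2) by apply: gmem_comp.
  (* A coefficient not vanishing at [z] would put [y], hence [s], into the saturation of [Q] plus
     the span of [x], which was excluded; a coefficient divisible by the prime turns its multiple of
     [y] into an element of [Q]. *)
  case: (nvanVdvd z (Acomp (d - (ds + c *+ m)) b0)) => [nb|[b eb]].
    case: ns; apply: (loc_sat kn hYm nYm).
    have -> : Y ^+ m *: s = y + a' *: x by rewrite /y subrK.
    apply: gmemD; last by apply/sat_sub/gsub_addr; exists a'.
    apply: (loc_sat kn hb nb); apply: sat_sub.
    exists (- gcomp d c2), (gcomp d v); split=> //; first exact: gmemN.
    by rewrite evd addKr.
  apply: Qx => //; rewrite evd eb -scalerA py; apply: gmemD => //.
  exact: gmemZ.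
apply: (loc_sat kn hYm nYm); have -> : Y ^+ m *: s = y + a' *: x by rewrite /y subrK.
apply: sat_sub; exists y, (a' *: x); split=> //; first exact/gsub_addr/cyc_mem.
by exists a'.
Qed.

(** Applies the step to [pz ^+ j *: s] for descending [j], starting from the power that kills
    [M]. *)
Lemma complement_elt M n dx (x : M) (hx : gcomp dx x = x) ds s (Q : gsub M) :
  kills (pz ^+ n.+1) M -> ~ tors M (pz ^+ n *: x) -> gcomp ds s = s ->
  (forall v, Q v -> cyc hx v -> tors M v) ->
  exists Q' : gsub M, [/\ gsub_le Q Q', forall v, Q' v -> cyc hx v -> tors M v &
    sat (gsub_add Q' (cyc hx)) s].
Proof.
move=> kn nx hs Qx.
have : sat (gsub_add Q (cyc hx)) (pz ^+ n.+1 *: s) by apply/tors_sat/kn.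
elim: (n.+1) Q Qx => [|j IH] Q Qx; first by rewrite expr0 scale1r => ?; exists Q; split.
rewrite exprS -scalerA => sj.
have hj : gcomp (ds + pdeg X z *+ j) (pz ^+ j *: s) = pz ^+ j *: s.
  by rewrite (gcompZr _ _ (Ahomog_pzX j)) addrK hs.
have [Q1 [QQ1 Q1x sQ1]] := complement_step kn nx hj Qx sj.
have [Q2 [Q12 Q2x sQ2]] := IH Q1 Q1x sQ1.
by exists Q2; split=> // v /QQ1/Q12.
Qed.

Definition generates M d (w : M) (hw : gcomp d w = w) :=
  gsub_le (gsub_full M) (sat (cyc hw)).

Lemma not_kills M (a : A) e : Ahomog e a -> ~ kills a M ->
  exists d (x : M), gcomp d x = x /\ ~ tors M (a *: x).
Proof.
move=> ha; apply: contra_notP => H v.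
apply: (@gmem_comps _ _ M (annih M ha)) => d.
by apply: contra_notP H => nt; exists d, (gcomp d v); rewrite gcomp_idem.
Qed.

Lemma min_kills M n : @indecomposable C M -> kills (pz ^+ n) M ->
  exists e, kills (pz ^+ e.+1) M /\ ~ kills (pz ^+ e) M.
Proof.
move=> [nz _]; elim: n => [|n IH] kn.
  by case: nz; apply/zeroP => v; have := kn v; rewrite expr0 scale1r.
by case: (EM (kills (pz ^+ n) M)) => [/IH//|nk]; exists n.
Qed.

(* A cyclic submodule of maximal length splits off, since its complement can be
   extended one homogeneous generator at a time. *)
Lemma indecomposable_cyclic M n : @indecomposable C M -> kills (pz ^+ n) M ->
  exists d (w : M) (hw : gcomp d w = w), generates hw.
Proof.
move=> ind kn; have [e [ke nke]] := min_kills ind kn.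
have [dx [x [hx nx]]] := not_kills (Ahomog_pzX e) nke.
exists dx, x, hx; have [s [sM gen]] := gsub_homgens (gsub_full M).
have [Q [Qx Qs]] : exists Q : gsub M, (forall v, Q v -> cyc hx v -> tors M v) /\
    forall g, g \in s -> sat (gsub_add Q (cyc hx)) g.
  elim: s sM {gen} => [|g s IH] sM.
    by exists (gsub_zero M); split=> // v -> _; apply: gmem0.
  have [|Q [Qx Qs]] := IH; first by move=> h hs; apply: sM; rewrite inE hs orbT.
  have [_ [dg hg]] := sM g (mem_head _ _).
  have [Q' [QQ' Q'x sg]] := complement_elt ke nx hg Qx.
  exists Q'; split=> // h; rewrite inE => /orP[/eqP -> //|/Qs].
  by apply: sat_le; apply: gsub_add_le2.
have full := gen _ Qs; case: (indecomposable_split ind Qx full) => [Qt|xt].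
  move=> v _; apply: (sat_mono _ (full v I)) => u [q [w [/Qt tq xw ->]]].
  by apply: gmemD; [apply: tors_sat | apply: sat_sub].
by case: nx; apply/gmemZ/xt/cyc_mem.
Qed.

Lemma kills_generator M (a : A) d (w : M) (hw : gcomp d w = w) :
  generates hw -> tors M (a *: w) -> kills a M.
Proof.
move=> gw tw v; have [n h] := gw v I; apply: (@sat_pow _ _ _ _ _ n) => Y hY.
have [b eb] := h Y hY.
by rewrite scalerA mulrC -scalerA eb scalerA mulrC -scalerA; apply: gmemZ.
Qed.

(** For [a = pz ^+ i * u] with [u] nonvanishing at [z], [i <= e] would make [pz ^+ e] kill the
    generator. *)
Lemma generator_kernel M e d (w : M) (hw : gcomp d w = w) (a : A) x :
  generates hw -> kills (pz ^+ e.+1) M -> ~ kills (pz ^+ e) M -> Ahomog x a ->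
  tors M (a *: w) -> exists b, a = b * pz ^+ e.+1.
Proof.
move=> gw ke nke ha ta; have [->|a0] := eqVneq a 0; first by exists 0; rewrite mul0r.
have [i [u [du [hu nu ea]]]] := factor_pelt clz ha a0.
case: (leqP e.+1 i) => [lei|lti].
  by exists (pz ^+ (i - e.+1) * u); rewrite ea mulrAC -exprD subnK.
case: nke; apply: (kills_generator gw); rewrite -(subnK (lti : (i <= e)%N)) exprD -scalerA.
by apply: gmemZ; apply: (loc_sat ke hu nu); rewrite scalerA mulrC -ea.
Qed.

Lemma pzX_neq0 n : pz ^+ n != 0.
Proof.
elim: n => [|n IH]; first by rewrite expr0 oner_eq0.
by rewrite exprS (Ahomog_mul_neq0 (Ahomog_pelt X z) (Ahomog_pzX n)) // pelt_neq0.
Qed.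

Definition pimg M : gsub M.
Proof.
refine (@GSub _ _ M (fun v => exists u, v = pz *: u) _ _ _ _).
- by exists 0; rewrite scaler0.
- by move=> _ _ [u ->] [v ->]; exists (u + v); rewrite scalerDr.
- by move=> a _ [u ->]; exists (a *: u); rewrite !scalerA mulrC.
- move=> d _ [u ->]; exists (gcomp (d - pdeg X z) u).
  by rewrite (gcompZr _ _ (Ahomog_pelt X z)).
Defined.

(** Descending induction on [j] puts [pz ^+ j *: v] into the saturation of [V], starting where
    [pz ^+ j] kills [M]. *)
Lemma pimg_nakayama M n (V : gsub M) : kills (pz ^+ n) M ->
  gsub_le (gsub_full M) (sat (gsub_add V (pimg M))) -> gsub_le (gsub_full M) (sat V).
Proof.
move=> kn h.
have main j : forall v, sat V (pz ^+ j *: v).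
  have [q] := ubnP (n - j)%N; elim: q => // q IH in j *; rewrite ltnS => lq v.
  case: (leqP n j) => [lenj|ltjn].
    rewrite -(subnK lenj) exprD -scalerA; apply/gmemZ/tors_sat/kn.
  have [a ha] := h v I; apply: (@sat_pow _ _ _ _ _ a) => Y hY.
  have [u [_ [Vu [v' ->] e]]] := ha Y hY.
  rewrite scalerA mulrC -scalerA e scalerDr; apply: gmemD; first exact/sat_sub/gmemZ.
  by rewrite scalerA -exprSr; apply: IH; lia.
by move=> v _; have := main 0%N v; rewrite expr0 scale1r.
Qed.

(** The sum of the maximal subobject and the image of [pz] is the subobject itself or all of [M],
    and Nakayama rules out the latter. *)
Lemma maximal_sub_pimg M n W (i : qhom W M) : kills (pz ^+ n) M ->
  @maximal_sub C W M i -> gsub_le (pimg M) (sat (qim i)).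
Proof.
move=> kn [/monoP mi ninv mx]; pose Q := gsub_add (qim i) (pimg M).
have mQ : qmono (gincl Q) by apply: gincl_mono.
case: (mx _ (gincl Q)).
- exact/monoP.
- by apply: sub_leI => // v iv; apply/sat_sub/qim_gincl/gsub_addl.
- by move=> /sub_leE h v pv; apply/h/qim_gincl/gsub_addr.
move=> /invertibleP[_ sQ]; case: ninv; apply/invertibleP; split=> //.
apply: (pimg_nakayama kn) => v _; apply: (sat_le _ (sQ v I)) => u.
by move=> /qim_gincl.
Qed.

(** The kernel [R] of [pz ^+ e] lies in the saturated image of [pz], hence in every maximal
    subobject, and is itself maximal, so it is the radical. *)
Lemma top_cyclic M e d (w : M) (hw : gcomp d w = w) :
  generates hw -> kills (pz ^+ e.+1) M -> ~ kills (pz ^+ e) M ->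
  exists (T : grmod X) (p : qhom M T), [/\ @is_top C M T, qsurj p & ~ forall t, tors T t].
Proof.
move=> gw ke nke; pose R := annih M (Ahomog_pzX e).
have satR : gsub_le (sat R) R.
  move=> v [n hn]; apply: (@sat_pow _ _ _ _ _ n) => Y hY.
  by rewrite scalerA mulrC -scalerA; apply: hn.
have mR : qmono (gincl R) by apply: gincl_mono.
(* If [pz ^+ e * a] kills the generator, it is divisible by [pz ^+ e.+1], so [a] is divisible by
   [pz]. *)
have Rp : gsub_le R (sat (pimg M)).
  move=> v Rv; apply: gmem_comps => dv; have {Rv} := gmem_comp dv Rv.
  have := gcomp_idem dv v; move: (gcomp dv v) => {}v hv Rv.
  have [n hn] := gw v I; exists n => Y hY; have [a0 ea0] := hn Y hY.
  have hYn := AhomogX n (Ahomog_isY hY).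
  pose E := dv + c *+ n; have ha := Ahomog_comp (E - d) a0.
  have ea : Y ^+ n *: v = Acomp (E - d) a0 *: w.
    by rewrite -(gcomp_scale _ _ hw) -ea0 (gcompZr _ _ hYn) addrK hv.
  have [|b eb] := generator_kernel gw ke nke (AhomogM (Ahomog_pzX e) ha).
    by rewrite -scalerA -ea scalerA mulrC -scalerA; apply/gmemZ/Rv.
  exists (b *: w); rewrite ea scalerA; congr (_ *: _).
  apply: (Ahomog_mulI (Ahomog_pzX e) (pzX_neq0 e)).
  by rewrite eb exprSr mulrC -mulrA.
have mxR : @maximal_sub C _ M (gincl R).
  split; first exact/monoP.
    move=> /invertibleP[_ sR]; apply: nke => v; apply: satR.
    by apply: (sat_le _ (sR v I)) => u /qim_gincl.
  move=> W j mj Rj; case: (EM (gsub_le (qim j) (sat R))) => [jR|njR].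
    by left; apply: sub_leI => // v /jR; apply: sat_le => u Ru; apply/qim_gincl.
  right; apply/invertibleP; split; first exact/monoP.
  (* An element outside the saturation of [R] is, up to a power of [Y], a multiple of [w] by an
     element not vanishing at [z]; so the larger subobject contains [w]. *)
  have [dv [v [hv jv nRv]]] : exists dv v, [/\ gcomp dv v = v, qim j v & ~ sat R v].
    apply: contra_notP njR => H v jv; apply: gmem_comps => dv.
    apply: contra_notP H => nR; exists dv, (gcomp dv v).
    by split=> //; [apply: gcomp_idem | apply: gmem_comp].
  have [Y hY nY] := nvan_isY; have [n hn] := gw v I; have [a0 ea0] := hn Y hY.
  have hYn := AhomogX n (Ahomog_isY hY); have nYn := @nvan_isYX Y n hY nY.
  pose E := dv + c *+ n; have ha := Ahomog_comp (E - d) a0.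
  have ea : Y ^+ n *: v = Acomp (E - d) a0 *: w.
    by rewrite -(gcomp_scale _ _ hw) -ea0 (gcompZr _ _ hYn) addrK hv.
  case: (nvanVdvd z (Acomp (E - d) a0)) => [na|[b eb]]; last first.
    case: nRv; apply: (loc_sat ke hYn nYn); apply: sat_sub.
    rewrite ea eb -[R _]/(tors M (pz ^+ e *: ((b * pz) *: w))) scalerA mulrCA -exprSr -scalerA.
    exact/gmemZ/ke.
  have sw : sat (qim j) w.
    by apply: (loc_sat ke ha na); rewrite -ea; apply/sat_sub/gmemZ.
  by move=> u _; apply: (sat_mono _ (gw u I)); apply: cyc_le.
exists (gquot_mod R), (gproj R).
have sp : qsurj (gproj R).
  by move=> t _; have [u <-] := gpi_surj t; apply: sat_sub; exists u.
split=> //; last first.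
  move=> zT; apply: nke => v; apply: satR.
  by apply: (@qproj0 _ _ _ R v (gpi R v)).
exists (gsub_mod R), (gincl R), (gproj R); split; last first.
  apply/cokernelP; split=> //.
    move=> u v t -> ->; have -> : gpi R (gval_linear R u) = 0 by apply/gpi_eq0/gvalP.
    exact: gmem0.
  move=> v t pt tt; apply: (sat_le _ (qproj0 pt tt)) => u Ru.
  exact/qim_gincl.
split; first exact/monoP.
- move=> W i mi; have [/monoP mi' _ _] := mi; apply: sub_leI => // v /qim_gincl/Rp.
  by apply: sat_mono; apply: maximal_sub_pimg mi; apply: ke.
- by move=> R' r' mr' h; apply: h.
Qed.

(** The image of [pz] lies in every maximal subobject, hence in the radical, which the map to the
    top kills. *)
Lemma is_top_surj M n T : kills (pz ^+ n) M -> @is_top C M T ->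
  exists p : qhom M T, qsurj p /\ forall v t, p (pz *: v) t -> tors T t.
Proof.
move=> kn [R [r [p [[mr rmax rad] /cokernelP[sp rp kp]]]]]; exists p; split=> // v t pt.
have pr : @sub_le C (gsub_mod (pimg M)) R M (gincl (pimg M)) r.
  apply: rad; first by apply/monoP/gincl_mono.
  move=> W i mi; have [/monoP mi' _ _] := mi; apply: sub_leI => // u /qim_gincl.
  exact: maximal_sub_pimg mi u.
have [q hq] : sat (qim r) (pz *: v).
  by apply: (sub_leE pr); apply/qim_gincl; exists v.
apply: (@sat_pow _ _ _ _ _ q) => Y hY; have [x _ rx] := hq Y hY.
by apply: rp rx _; apply: crelZ pt.
Qed.

Lemma kills_surj M T a (p : qhom M T) : qsurj p -> kills a M -> kills a T.
Proof.
move=> sp ka t; have [n hn] := sp t I; apply: (@sat_pow _ _ _ _ _ n) => Y hY.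
have [v _ pv] := hn Y hY; rewrite scalerA mulrC -scalerA.
by apply: qhom_tors (ka v) _; apply: crelZ pv.
Qed.

(** * Epimorphisms from O(y) onto a cyclic sheaf *)

Section Lift.
Variables (M : grmod X) (n e : nat) (y d dd : L) (w : M) (hw : gcomp d w = w) (a Y : A).
Hypotheses (hY : isY Y) (nY : nvan z Y) (ke : kills (pz ^+ e) M).
Hypotheses (ha : Ahomog dd a) (na : nvan z a) (gw : generates hw).
Hypothesis deg : dd + d = c *+ n - y.

(** The map sending 1 to [a *: w] divided by [Y ^+ n], which makes sense because [Y] acts invertibly
    on [M]. The division lowers the degree to [- y], the degree of 1 in O(y). *)
Definition clift : corr (shift (Osheaf X) y) M.
Proof.
refine (@Corr _ _ (shift (Osheaf X) y) M
  (fun (b : Aalg X) s => tors M (Y ^+ n *: s - b *: (a *: w))) _ _ _ _).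
- by rewrite scaler0 scale0r subrr; apply: gmem0.
- move=> u u' v v' h h'; rewrite scalerDr scalerDl opprD addrACA; exact: gmemD.
- move=> b u v h; have -> : Y ^+ n *: (b *: v) - (b *: u : Aalg X) *: (a *: w) =
      b *: (Y ^+ n *: v - u *: (a *: w)).
    rewrite scalerBr; congr (_ - _); first by rewrite scalerA mulrC -scalerA.
    by rewrite [RHS]scalerA.
  exact: gmemZ.
- move=> x u v h; have haw : gcomp (c *+ n - y) (a *: w) = a *: w.
    by rewrite (gcompZr _ _ ha) -deg addrC addKr hw.
  have -> : Y ^+ n *: gcomp x v - (@gcomp _ _ (shift (Osheaf X) y) x u : Aalg X) *: (a *: w) =
      gcomp (x + c *+ n) (Y ^+ n *: v - u *: (a *: w)).
    rewrite gcompD gcompN (gcompZr _ _ (AhomogX n (Ahomog_isY hY))) addrK.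
    have ed : x + c *+ n - (c *+ n - y) = x + y by rewrite opprB addrA addrAC addrK.
    by rewrite (gcomp_scale _ _ haw) ed.
  exact: gmem_comp.
Defined.

Lemma clift_dom u : sat (cdom clift) u.
Proof.
have [N [b1 b2]] := bezout_nvan e clz (AhomogX n (Ahomog_isY hY)) (@nvan_isYX Y n hY nY).
exists N => Z hZ.
have [r [s eZ]] : exists r s, Z ^+ N = r * Y ^+ n + s * pz ^+ e by case: hZ => ->.
(* Modulo [pz ^+ e], [r] is an inverse of [Y ^+ n] up to the factor [Z ^+ N], so this is a value at
   [Z ^+ N *: u]. *)
exists ((r * u) *: (a *: w)) => //.
rewrite -[cinv _ _ _]/(tors M (Y ^+ n *: ((r * u) *: (a *: w)) - (Z ^+ N * u) *: (a *: w))).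
have -> : Y ^+ n *: ((r * u) *: (a *: w)) - (Z ^+ N * u) *: (a *: w) =
    - ((s * u) *: (pz ^+ e *: (a *: w))).
  rewrite scalerA -scalerBl scalerA -scaleNr; congr (_ *: _).
  by rewrite eZ mulrDl mulrA [Y ^+ n * r]mulrC opprD addrA subrr add0r mulrAC.
exact/gmemN/gmemZ/ke.
Qed.

Lemma clift_ker s : clift 0 s -> tors M s.
Proof.
move=> h; have {}h : tors M (Y ^+ n *: s).
  by have := h; rewrite -[clift 0 s]/(tors M (Y ^+ n *: s - 0 *: (a *: w))) scale0r subr0.
exact: (loc_sat ke (AhomogX n (Ahomog_isY hY)) (@nvan_isYX Y n hY nY) h).
Qed.

Definition qlift : qhom (shift (Osheaf X) y) M := mkqhom_sat clift_dom clift_ker.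

Lemma qlift_surj : qsurj qlift.
Proof.
have sw : sat (qim qlift) w.
  apply: (loc_sat ke ha na); apply: sat_sub; exists (Y ^+ n) => //.
  rewrite -[qlift _ _]/(tors M (Y ^+ n *: (a *: w) - Y ^+ n *: (a *: w))) subrr.
  exact: gmem0.
have h : gsub_le (cyc hw) (sat (qim qlift)) by apply: cyc_le.
by move=> u _; apply: (sat_mono h (gw I)).
Qed.
End Lift.
End Primary.

(** * The Hilbert function as an invariant of the Grothendieck group *)

Section HilbertFunction.
Variables (k : finFieldType) (X : wpl k).
Local Notation t := (npt X).+2.
Local Notation A := (Aalg X).
Local Notation L := (Lgrp X).
Local Notation c := (cvec X).
Local Notation C := (coh X).
Implicit Types M K W : grmod X.

Lemma gsub_ind M (Q : gsub M) (Phi : gsub M -> Prop) :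
  Phi (gsub_zero M) ->
  (forall P d g (hg : gcomp d g = g), Q g -> Phi P -> Phi (gsub_add P (cyc hg))) ->
  (forall P P', gsub_le P' P -> Phi P -> Phi P') -> Phi Q.
Proof.
move=> h0 hS hle; have [s [sQ gen]] := gsub_homgens Q.
suff [P [PhiP Ps]] : exists P, Phi P /\ forall g, g \in s -> P g by apply: hle (gen P Ps) PhiP.
elim: s sQ {gen} => [|g s IH] sQ; first by exists (gsub_zero M).
have [|P [PhiP Ps]] := IH; first by move=> h hs; apply: sQ; rewrite inE hs orbT.
have [Qg [d hg]] := sQ g (mem_head _ _); exists (gsub_add P (cyc hg)); split; first exact: hS.
by move=> h; rewrite inE => /orP[/eqP ->|/Ps]; [apply/gsub_addr/cyc_mem | apply: gsub_addl].
Qed.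

(** One exponent [N] carries [Q] into [P], and coefficients of large degree lie in the ideal
    generated by [Y1 ^+ N] and [Y2 ^+ N]. *)
Lemma sat_large M (P Q : gsub M) x : gsub_le Q (sat P) ->
  exists n0, forall n v, (n0 <= n)%N -> Q v -> gcomp (x + c *+ n) v = v -> P v.
Proof.
move=> QP; have [N NP] := sat_uniform QP.
pose Phi (Q' : gsub M) := exists n0, forall n v, (n0 <= n)%N -> Q' v ->
  gcomp (x + c *+ n) v = v -> P v.
apply: (@gsub_ind M Q Phi) => [|P' d g hg Qg [n0 h]|P1 P2 le [n0 h]].
- by exists 0%N => n v _ -> _; apply: gmem0.
- have [n1 h1] := Ahomog_Ypow (x - d) N.
  exists (n0 + n1)%N => n v len [p [_ [P'p [a ->] ev]]] hv.
  rewrite -hv ev gcompD (gcomp_scale _ _ hg); apply: gmemD.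
    by apply: (h n); [lia | apply: gmem_comp | apply: gcomp_idem].
  have ha := Ahomog_comp (x - d + c *+ n) a.
  have [|r [s e]] := h1 n _ _ ha; first lia.
  have -> : x + c *+ n - d = x - d + c *+ n by rewrite addrAC.
  rewrite e scalerDl -scalerA -scalerA.
  by apply: gmemD; apply: gmemZ; apply: NP => //; [apply: isY1 | apply: isY2].
- by exists n0 => n v len /le; apply: h.
Qed.

Lemma Ahomog_uniq_form (l l' : 'I_t -> nat) n n' :
  (forall i, l i < weight i)%N -> (forall i, l' i < weight i)%N ->
  \sum_i xvec i *+ l i + c *+ n = \sum_i xvec i *+ l' i + c *+ n' -> l =1 l' /\ n = n'.
Proof.
move=> hl hl' e.
(* The multiple of [c] is absorbed into the exponent of the variable of index 0, so that the
   invariants of monomials apply. *)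
have e0 (m : 'I_t -> nat) q : \sum_i xvec i *+ m i + c *+ q =
    wdeg [multinom (m i + (if i == ord0 then weight i * q else 0))%N | i < t].
  rewrite /wdeg [RHS](eq_bigr (fun i => xvec i *+ m i +
    xvec i *+ (if i == ord0 then weight i * q else 0))); last first.
    by move=> i _; rewrite mnmE mulrnDr.
  rewrite big_split /=; congr (_ + _).
  rewrite (bigD1 ord0) //= mulrnA xvec_weight big1 ?addr0 // => i /negbTE ->.
  by rewrite mulr0n.
rewrite !e0 in e; have ll : l =1 l'.
  move=> i; have := wdeg_mod i e; rewrite !mnmE.
  case: eqP => _; last by rewrite !addn0 !modn_small.
  by rewrite ![(_ + weight i * _)%N]addnC !(mulnC (weight i)) !modnMDl !modn_small.
split=> //; apply: (@cvecMn_inj _ X); apply: (addrI (\sum_i xvec i *+ l' i)).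
rewrite [RHS]e0 -e -e0; congr (_ + _); apply: eq_bigr => i _; by rewrite ll.
Qed.

Definition coefs n (g : {ffun 'I_n.+1 -> k}) : {poly k} := \poly_(i < n.+1) g (inord i).

Lemma size_coefs n g : (size (@coefs n g) <= n.+1)%N.
Proof. exact: size_poly. Qed.

Lemma coefs_surj n (b : {poly k}) : (size b <= n.+1)%N -> exists g, @coefs n g = b.
Proof.
move=> sb; exists [ffun i : 'I_n.+1 => b`_i]; apply/polyP => i; rewrite coef_poly.
case: ltnP => li; first by rewrite ffunE inordK.
by rewrite nth_default // (leq_trans sb).
Qed.

Lemma coefs_inj n : injective (@coefs n).
Proof.
move=> g g' e; apply/ffunP => i; have := congr1 (fun p : {poly k} => p`_i) e.
by rewrite !coef_poly ltn_ord inord_val.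
Qed.

Lemma Ahomog_finite x : exists (I : finType) (f : I -> A),
  forall a, Ahomog x a -> exists i, f i = a.
Proof.
case: (EM (exists2 a : A, Ahomog x a & a != 0)) => [[a ha a0]|H]; last first.
  exists unit, (fun=> 0) => a ha; exists tt; apply/esym/eqP.
  by apply: contra_notT H => a0; exists a.
have [l [n [_ [hl _ _ ex]]]] := normal_form ha a0.
exists {ffun 'I_n.+1 -> k}, (fun g => xmon l * bform X n (coefs g)) => a' ha'.
have [->|a'0] := eqVneq a' 0.
  have [|g eg] := @coefs_surj n 0; first by rewrite size_poly0.
  by exists g; rewrite eg bform0 mulr0.
have [l' [n' [b' [hl' sb' -> ex']]]] := normal_form ha' a'0.
have [ll nn] := Ahomog_uniq_form hl hl' (etrans (esym ex) ex').
rewrite -nn in sb' *; have [g <-] := coefs_surj sb'; exists g.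
by rewrite (eq_xmon ll).
Qed.

Lemma gcomp_finite M D : exists (I : finType) (f : I -> M),
  forall v, gcomp D v = v -> exists i, f i = v.
Proof.
pose Phi (Q : gsub M) := exists (I : finType) (f : I -> M),
  forall v, Q v -> gcomp D v = v -> exists i, f i = v.
suff [I [f h]] : Phi (gsub_full M) by exists I, f => v; apply: h.
apply: gsub_ind => [|P d g hg _ [I [f h]]|P P' le [I [f h]]].
- by exists unit, (fun=> 0) => v -> _; exists tt.
- have [J [a aP]] := Ahomog_finite (D - d).
  exists (I * J)%type, (fun ij => f ij.1 + a ij.2 *: g) => v [p [_ [Pp [b ->] ev]]] hv.
  have [i ei] := h _ (gmem_comp D Pp) (gcomp_idem D p).
  have [j ej] := aP _ (Ahomog_comp (D - d) b).
  exists (i, j); rewrite /= ei ej -(gcomp_scale _ _ hg) -gcompD -ev; exact: hv.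
- by exists I, f => v /le; apply: h.
Qed.

Definition has_card M D n := exists (I : finType) (f : I -> M),
  [/\ #|I| = n, injective f, forall i, gcomp D (f i) = f i &
      forall v, gcomp D v = v -> exists i, f i = v].

Lemma has_card_exists M D : exists n, has_card M D n.
Proof.
have [I [f fP]] := gcomp_finite M D.
pose s := undup [seq v <- codom f | gcomp D v == v].
exists #|{: seq_sub s}|, (seq_sub s), (@ssval _ s); split=> //.
- exact: val_inj.
- by move=> i; have := ssvalP i; rewrite mem_undup mem_filter => /andP[/eqP].
- move=> v hv; have [i ei] := fP v hv.
  have vs : v \in s by rewrite mem_undup mem_filter hv eqxx /= -ei codom_f.
  by exists (SeqSub vs).
Qed.

Lemma has_card_uniq M D n n' : has_card M D n -> has_card M D n' -> n = n'.
Proof.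
have le (I J : finType) (f : I -> M) (g : J -> M) (fI : injective f) (hf : forall i : I, gcomp D (f i) = f i)
    (hg : forall v, gcomp D v = v -> exists j : J, g j = v) : (#|I| <= #|J|)%N.
  have /choice[h hP] : forall i, exists j, g j = f i by move=> i; apply: hg.
  by apply: (@leq_card _ _ h) => i i' e; apply: fI; rewrite -!hP e.
move=> [I [f [<- fI hf sf]]] [J [g [<- gI hg sg]]]; apply/eqP; rewrite eqn_leq.
by rewrite (le I J f g) // (le J I g f).
Qed.

Definition hilb M D : nat := sval (cid (has_card_exists M D)).

Lemma hilbP M D : has_card M D (hilb M D).
Proof. by rewrite /hilb; case: cid. Qed.

Lemma hilb_gt0 M D : (0 < hilb M D)%N.
Proof.
have [I [f [<- _ _ sf]]] := hilbP M D; have [i _] := sf 0 (gcomp0 M D).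
by apply/card_gt0P; exists i.
Qed.

Lemma tors_large M x : exists n0, forall n v, (n0 <= n)%N ->
  gcomp (x + c *+ n) v = v -> tors M v -> v = 0.
Proof.
have [|n0 h] := @sat_large M (gsub_zero M) (tors M) x; first by [].
by exists n0 => n v len hv tv; apply: (h n).
Qed.

(** In degrees [x + c *+ n] with [n] large, saturation adds nothing and torsion is zero, so the
    relations restrict to a short exact sequence of finite groups. *)
Lemma hilb_exact (M N K : grmod X) (f : qhom M N) (g : qhom N K) x :
  @short_exact C M N K f g ->
  exists n0, forall n, (n0 <= n)%N ->
    hilb N (x + c *+ n) = (hilb M (x + c *+ n) * hilb K (x + c *+ n))%N.
Proof.
move=> /short_exactP[mf sg fg kg].
have [a1 df] := @sat_large M (cdom f) (gsub_full M) x (fun v _ => qdom_sat f v).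
have [a2 dg] := @sat_large N (cdom g) (gsub_full N) x (fun v _ => qdom_sat g v).
have [a3 ig] := @sat_large K (qim g) (gsub_full K) x sg.
have kgf : gsub_le (cimg (cinv g) (gsub_zero K)) (sat (qim f)).
  by move=> v [w ew gw]; apply: kg gw _; rewrite ew; apply: gmem0.
have [a4 kf] := @sat_large N (qim f) _ x kgf.
have [a5 tM] := tors_large M x; have [a6 tN] := tors_large N x.
have [a7 tK] := tors_large K x.
exists (a1 + a2 + a3 + a4 + a5 + a6 + a7)%N => n len; set D := x + c *+ n.
have {}df u : gcomp D u = u -> exists v, gcomp D v = v /\ f u v.
  move=> hu; have [||v _ fv] := df n u _ I => //; first lia.
  exists (gcomp D v); split; first exact: gcomp_idem.
  by rewrite -hu; apply: crel_comp.
have {}dg u : gcomp D u = u -> exists v, gcomp D v = v /\ g u v.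
  move=> hu; have [||v _ gv] := dg n u _ I => //; first lia.
  exists (gcomp D v); split; first exact: gcomp_idem.
  by rewrite -hu; apply: crel_comp.
have {}ig w : gcomp D w = w -> exists v, gcomp D v = v /\ g v w.
  move=> hw; have [||v _ gv] := ig n w _ I => //; first lia.
  exists (gcomp D v); split; first exact: gcomp_idem.
  by rewrite -hw; apply: crel_comp.
have {}kf v : gcomp D v = v -> g v 0 -> exists u, gcomp D u = u /\ f u v.
  move=> hv gv; have [|||u _ fu] := kf n v => //; first lia.
    by exists 0.
  exists (gcomp D u); split; first exact: gcomp_idem.
  by rewrite -hv; apply: crel_comp.
have {}tM v : gcomp D v = v -> tors M v -> v = 0 by apply: tM; lia.
have {}tN v : gcomp D v = v -> tors N v -> v = 0 by apply: tN; lia.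
have {}tK v : gcomp D v = v -> tors K v -> v = 0 by apply: tK; lia.
have sub0 (W : grmod X) (u v : W) : gcomp D u = u -> gcomp D v = v -> gcomp D (u - v) = u - v.
  by move=> hu hv; rewrite gcompD gcompN hu hv.
have [I [eM [cI eMI hM sM]]] := hilbP M D; have [J [eK [cJ eKI hK sK]]] := hilbP K D.
have /choice[F FP] : forall i, exists v, gcomp D v = v /\ f (eM i) v by move=> i; apply: df.
have /choice[S SP] : forall j, exists v, gcomp D v = v /\ g v (eK j) by move=> j; apply: ig.
have gF i : g (F i) 0.
  have [hF fF] := FP i; have [w [hw gw]] := dg _ hF.
  by rewrite -(tK w hw (fg _ _ _ fF gw)).
apply: (has_card_uniq (hilbP N D)); rewrite -cI -cJ -card_prod.
(* In this degree an element of [N] is uniquely an image from [M] plus a chosen lift of an element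
   of [K]. *)
exists (I * J)%type, (fun ij => F ij.1 + S ij.2); split=> //.
- move=> [i j] [i' j'] /= e.
  have ej : j = j'.
    apply: eKI; apply/eqP; rewrite -subr_eq0; apply/eqP/tK; first exact: sub0.
    have [_ gS] := SP j; have [_ gS'] := SP j'.
    have := qhom_torsB (crelD (gF i) gS) (_ : g _ (0 + eK j')).
    rewrite !add0r; apply; rewrite e -[X in g _ X]add0r; exact: crelD.
  rewrite ej in e *; congr (_, _); apply: eMI; move/addIr: e => e.
  apply/eqP; rewrite -subr_eq0; apply/eqP/tM; first exact: sub0.
  have [_ fF] := FP i; have [_ fF'] := FP i'; apply: mf (crelB fF fF') _.
  by rewrite e subrr; apply: gmem0.
- by move=> [i j]; rewrite gcompD (FP i).1 (SP j).1.
move=> v hv; have [w [hw gw]] := dg v hv; have [j ej] := sK w hw; rewrite -ej in gw.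
have [|u [hu fu]] := kf (v - S j) (sub0 _ _ _ hv (SP j).1).
  by rewrite -(subrr (eK j)); apply: crelB => //; case: (SP j).
have [i ei] := sM u hu; rewrite -ei in fu; exists (i, j) => /=.
have -> : F i = v - S j; last by rewrite subrK.
apply/eqP; rewrite -subr_eq0; apply/eqP/tN; last exact: qhom_torsB (FP i).2 fu.
exact: (sub0 _ _ _ (FP i).1 (sub0 _ _ _ hv (SP j).1)).
Qed.

(** Counting turns sums in K_0 into products, so opposites need inverses and the values lie in
    [rat]. *)
Fixpoint K0hilb (a : K0term C) (D : L) : rat :=
  match a with
  | K0cls M => (hilb M D)%:R
  | K0zero => 1
  | K0opp a => (K0hilb a D)^-1
  | K0add a b => K0hilb a D * K0hilb b D
  end.

Lemma K0hilb_neq0 a D : K0hilb a D != 0.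
Proof.
elim: a => [M||a IH|a IHa b IHb] /=.
- by rewrite pnatr_eq0 -lt0n hilb_gt0.
- by [].
- by rewrite invr_eq0.
- exact: mulf_neq0.
Qed.

(** Each exact sequence used in the derivation brings its own bound, so equality is claimed only for
    large [n]. *)
Lemma K0eq_hilb a b x : K0eq a b ->
  exists n0, forall n, (n0 <= n)%N -> K0hilb a (x + c *+ n) = K0hilb b (x + c *+ n).
Proof.
elim=> {a b}.
- by exists 0%N.
- by move=> a b _ [n0 h]; exists n0 => n /h.
- move=> a b d _ [n0 h] _ [n1 h1]; exists (n0 + n1)%N => n len.
  by rewrite h ?h1 //; lia.
- by move=> a b _ [n0 h]; exists n0 => n /h /= ->.
- move=> a a' b b' _ [n0 h] _ [n1 h1]; exists (n0 + n1)%N => n len /=.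
  by rewrite h ?h1 //; lia.
- by exists 0%N => n _; rewrite /= mulrA.
- by exists 0%N => n _; rewrite /= mulrC.
- by exists 0%N => n _; rewrite /= mul1r.
- by move=> a; exists 0%N => n _; rewrite /= mulVf // K0hilb_neq0.
- move=> M N K f g se; have [n0 h] := hilb_exact x se; exists n0 => n len.
  by rewrite /= h // natrM.
Qed.

Lemma xmon_neq0 l : xmon (X := X) l != 0.
Proof.
have h0 i : xgen (X := X) i != 0.
  apply/eqP => e; have := xgen_weight i; rewrite e expr0n eqn0Ngt weight_gt0 /= => /esym.
  by move=> /(bform_eq0 (size_lin i)) /eqP; rewrite (negbTE (lin_neq0 i)).
have hX i n : xgen (X := X) i ^+ n != 0.
  elim: n => [|n IH]; first by rewrite expr0 oner_eq0.
  by rewrite exprS (Ahomog_mul_neq0 (Ahomog_xgen i) (AhomogX n (Ahomog_xgen i))).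
suff [d []] : exists d, Ahomog d (xmon (X := X) l) /\ xmon (X := X) l != 0 by [].
rewrite /xmon; elim/big_ind: _ => [|a b [d [ha a0]] [e [hb b0]]|i _].
- by exists 0; split; [apply: Ahomog1 | rewrite oner_eq0].
- by exists (d + e); split; [apply: AhomogM | apply: Ahomog_mul_neq0 ha hb a0 b0].
- by exists (xvec i *+ l i); split=> //; apply/AhomogX/Ahomog_xgen.
Qed.

Lemma hilb_Osheaf x D (l : 'I_t -> nat) n : (forall i, l i < weight i)%N ->
  D + x = \sum_i xvec i *+ l i + c *+ n ->
  hilb (shift (Osheaf X) x) D = (#|k| ^ n.+1)%N.
Proof.
move=> hl ex; apply: (has_card_uniq (hilbP _ _)).
exists {ffun 'I_n.+1 -> k}, (fun g => xmon l * bform X n (coefs g)); split.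
- by rewrite card_ffun card_ord.
- move=> g g' /(Ahomog_mulI (Ahomog_xmon l) (xmon_neq0 l)) e; apply: (@coefs_inj n).
  apply/eqP; rewrite -subr_eq0; apply/eqP; apply: (@bform_eq0 _ X n).
    by apply: leq_trans (size_polyD _ _) _; rewrite size_polyN geq_max !size_coefs.
  by rewrite bformD -scaleN1r bformZ e -bformZ -bformD scaleN1r subrr bform0.
- move=> g; apply: Acomp_id; rewrite ex.
  by apply: AhomogM; [apply: Ahomog_xmon | apply: Ahomog_bform].
move=> a ha; have ha' : Ahomog (D + x) a by rewrite -ha; apply: Ahomog_comp.
have [->|a0] := eqVneq a 0.
  have [|g eg] := @coefs_surj n 0; first by rewrite size_poly0.
  by exists g; rewrite eg bform0 mulr0.
have [l' [n' [b' [hl' sb' -> ex']]]] := normal_form ha' a0.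
have [ll nn] := Ahomog_uniq_form hl hl' (etrans (esym ex) ex').
rewrite -nn in sb' *; have [g <-] := coefs_surj sb'; exists g.
by rewrite (eq_xmon ll).
Qed.

Lemma Lgrp_normal_form (d : L) : exists (l : 'I_t -> nat) (N : int),
  (forall i, l i < weight i)%N /\ d = \sum_i xvec i *+ l i + c *~ N.
Proof.
pose u (i : 'I_t) : int := repr d 0 i; pose l i := `|(u i %% weight i)%Z|%N.
have w0 (i : 'I_t) : (weight i : int) != 0 by rewrite eqz_nat -lt0n weight_gt0.
have lE i : (l i : int) = (u i %% weight i)%Z by rewrite /l gez0_abs // modz_ge0.
exists l, (\sum_i (u i %/ weight i)%Z); split=> [i|].
  by rewrite -ltz_nat lE ltz_pmod // ltz_nat weight_gt0.
have ed : d = \sum_i xvec i *~ u i.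
  rewrite -[LHS]reprK [X in \pi X]row_sum_delta raddf_sum /=; apply: eq_bigr => i _.
  by rewrite -[repr d 0 i]intz scaler_int raddfMz.
rewrite {1}ed (big_morph _ (mulrzDr c) (mulr0z c)) -big_split /=; apply: eq_bigr => i _.
rewrite {1}(divz_eq (u i) (weight i)) mulrzDr -lE addrC -pmulrn mulrC mulrzA -pmulrn.
by rewrite xvec_weight.
Qed.

(** For any [D0] the multiples of [c] in the normal forms of [D0 + x] and [D0 + x'] agree, being
    read off from the counts. Suitable [D0] then show that the normal form of [x' - x] is zero. *)
Lemma K0eq_Osheaf (x x' : L) :
  @K0eq C (K0cls (shift (Osheaf X) x : C)) (K0cls (shift (Osheaf X) x' : C)) -> x = x'.
Proof.
move=> e; have [l [N [hl ed]]] := Lgrp_normal_form (x' - x).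
have q1 : (1 < #|k|)%N by apply: card_finNzRing_gt1.
(* [N1] and [N2] may be negative; a large multiple of [c] is added to turn them into degrees of
   forms. *)
have cmp D0 (l1 l2 : 'I_t -> nat) N1 N2 :
    (forall i, l1 i < weight i)%N -> (forall i, l2 i < weight i)%N ->
    D0 + x = \sum_i xvec i *+ l1 i + c *~ N1 -> D0 + x' = \sum_i xvec i *+ l2 i + c *~ N2 ->
    N1 = N2.
  move=> h1 h2 e1 e2; have [n0 h] := K0eq_hilb D0 e.
  pose n := (n0 + absz N1 + absz N2)%N.
  have [m1 p1] : exists m1 : nat, (m1 : int) = N1 + n.
    by exists (absz (N1 + n%:Z)); rewrite gez0_abs //; lia.
  have [m2 p2] : exists m2 : nat, (m2 : int) = N2 + n.
    by exists (absz (N2 + n%:Z)); rewrite gez0_abs //; lia.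
  have : (hilb (shift (Osheaf X) x) (D0 + c *+ n))%:R =
      (hilb (shift (Osheaf X) x') (D0 + c *+ n))%:R :> rat.
    by apply: h; rewrite /n; lia.
  rewrite (@hilb_Osheaf x _ l1 m1) //; last first.
    by rewrite addrAC e1 -addrA !pmulrn p1 mulrzDr.
  rewrite (@hilb_Osheaf x' _ l2 m2) //; last first.
    by rewrite addrAC e2 -addrA !pmulrn p2 mulrzDr.
  move=> /eqP; rewrite eqr_nat eqn_exp2l // => /eqP[] /(congr1 Posz).
  by rewrite p1 p2 => /addIr.
have x0 : \sum_(i < t) xvec (X := X) i *+ 0 = 0 by rewrite big1.
have N0 : 0 = N.
  apply: (@cmp (- x) (fun=> 0%N) l) => //.
  - by move=> i; apply: weight_gt0.
  - by rewrite addNr x0 add0r mulr0z.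
  - by rewrite addrC ed.
have l0 i : l i = 0%N.
  case: (posnP (l i)) => // li.
  suff : 0 = 1 :> int by [].
  (* Adding [(weight i).-1] copies of [xvec i] to [x' - x] produces one more [c] when [l i] is
     positive, but none for [x - x]. *)
  apply: (@cmp (- x + xvec i *+ (weight i).-1) (fun j => if j == i then (weight i).-1 else 0)
    (fun j => if j == i then (l i).-1 else l j)).
  - by move=> j; case: eqP => [->|_]; rewrite ?prednK ?weight_gt0.
  - by move=> j; case: eqP => [->|_] //; apply: leq_ltn_trans (leq_pred _) (hl i).
  - rewrite mulr0z addr0 addrAC addNr add0r (bigD1 i) //= eqxx big1 ?addr0 // => j /negbTE ->.
    by rewrite mulr0n.
  - rewrite addrAC [- x + x']addrC ed -N0 mulr0z addr0 (bigD1 i) //= [in RHS](bigD1 i) //= eqxx mulr1z.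
    have -> : \sum_(j | j != i) xvec j *+ (if j == i then (l i).-1 else l j) =
        \sum_(j | j != i) xvec j *+ l j by apply: eq_bigr => j /negbTE ->.
    rewrite addrAC -[RHS]addrA [_ + cvec X]addrC [RHS]addrA; congr (_ + _).
    rewrite -(xvec_weight i) -!mulrnDr; congr (_ *+ _).
    by have := weight_gt0 i; lia.
apply/eqP; rewrite eq_sym -subr_eq0 ed -N0 mulr0z addr0 big1 // => i _.
by rewrite l0 mulr0n.
Qed.
End HilbertFunction.

(** * Line bundles and their torsion quotients *)

Section LineBundles.
Variables (k : finFieldType) (X : wpl k).
Local Notation t := (npt X).+2.
Local Notation A := (Aalg X).
Local Notation L := (Lgrp X).
Local Notation c := (cvec X).
Local Notation C := (coh X).
Local Notation O y := (shift (Osheaf X) y).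
Implicit Types M N K W : grmod X.

Lemma tors_shift M x v : tors (shift M x) v <-> tors M v.
Proof. by split=> -[n h]; exists n => Y hY; have := h Y hY; rewrite /=. Qed.

(** The same relation, reversed: [shift] changes only the grading, so an isomorphism of [M] with
    O(l) carries over to all shifts. *)
Definition ctwist M l x (f : corr M (O l)) : corr (O (x + l)) (shift M x).
Proof.
refine (@Corr _ _ (O (x + l)) (shift M x) (fun a u => f u a) _ _ _ _).
- exact: crel0.
- by move=> u u' v v'; apply: crelD.
- by move=> a u v; apply: crelZ.
- by move=> d a u /(crel_comp (d + x)); rewrite /= addrA.
Defined.

Lemma twist_line_bundle M l x : @isomorphic C M (O l) ->
  exists psi : qhom (O (x + l)) (shift M x), qmono psi /\ qsurj psi.
Proof.
move=> [f /invertibleP[mf sf]].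
pose r := ctwist x f.
have rdom a : sat (cdom r) a.
  by have [n h] := sf a I; exists n => Y /h[u _ fu]; exists u.
have rker u : r 0 u -> tors (shift M x) u.
  by move=> h; apply/tors_shift; apply: mf h _; apply: gmem0.
exists (mkqhom_sat rdom rker); split.
  move=> a u fu /tors_shift tu.
  have /tors_shift ta : tors (O l) a by apply: qhom_tors tu _; apply: fu.
  exact/tors_shift.
by move=> u _; have [n h] := qdomP f u; exists n => Y /h[a fa]; exists a.
Qed.

Lemma Y1_neq0 : Y1 X != 0.
Proof.
have := xmon_neq0 (fun i : 'I_t => if i == ord0 then weight i else 0%N).
by rewrite /xmon (bigD1 ord0) //= big1 ?mulr1 // => i /negbTE ->.
Qed.

Lemma Y1X_neq0 n : Y1 X ^+ n != 0.
Proof.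
elim: n => [|n IH]; first by rewrite expr0 oner_eq0.
by rewrite exprS (Ahomog_mul_neq0 (Ahomog_Y1 X) (AhomogX n (Ahomog_Y1 X))) // Y1_neq0.
Qed.

Lemma tors_O y (a : O y) : tors (O y) a -> a = 0.
Proof.
move=> [n h]; have /= e := h _ (isY1 X).
apply: (@Ahomog_mulI _ X _ (Y1 X ^+ n) (a : A) 0 (AhomogX n (Ahomog_Y1 X)) (Y1X_neq0 n)).
by rewrite mulr0.
Qed.

Section Kernel.
Variables (y : L) (N Q : grmod X) (psi : qhom (O y) N) (p : qhom N Q).
Hypotheses (spsi : qsurj psi) (sp : qsurj p).

(* Commutativity of A: the kernel of a quotient of O(y) is its annihilator. *)
Lemma kills_of_kernel (b : A) v w : psi b v -> p v w -> tors Q w -> kills b Q.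
Proof.
move=> pb pv tw q; have [n hn] := qcomp_qim sp spsi (v := q) I.
apply: (@sat_pow _ _ _ _ _ n) => Y hY; have [b' _ [v' pb' pv']] := hn Y hY.
have e1 : psi (b * b' : A) (b *: v') by apply: crelZ pb'.
have e2 : psi (b * b' : A) (b' *: v) by rewrite mulrC; apply: crelZ pb.
have tv := qhom_torsB e1 e2.
have tq := qhom_tors tv (crelB (crelZ b pv') (crelZ b' pv)).
rewrite scalerA mulrC -scalerA -[_ *: _](subrK (b' *: w)).
by apply: gmemD => //; apply: tors_scale.
Qed.

(** Up to powers of Y1 and Y2, the image of [b] is [b] times the image of 1. *)
Lemma kernel_of_kills (b : A) v w : psi b v -> p v w -> kills b Q -> tors Q w.
Proof.
move=> pb pv kb; have [m hm] := qdomP psi (1 : A).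
apply: (@sat_pow _ _ _ _ _ m) => Z hZ; have [u pu] := hm Z hZ.
rewrite [_ *: _](_ : _ = Z ^+ m) in pu; last by rewrite /GRing.scale /= mulr1.
have [q hq] := qdomP p u; apply: (@sat_pow _ _ _ _ _ q) => Y hY; have [s ps] := hq Y hY.
have e1 : psi (b * Z ^+ m : A) (b *: u) by apply: crelZ pu.
have e2 : psi (b * Z ^+ m : A) (Z ^+ m *: v) by rewrite mulrC; apply: crelZ pb.
have tv := tors_scale (Y ^+ q) (qhom_torsB e2 e1).
have ps' : p (Y ^+ q *: (b *: u)) (b *: s) by rewrite scalerA mulrC -scalerA; apply: crelZ ps.
have pv' := crelZ (Y ^+ q) (crelZ (Z ^+ m) pv).
have := qhom_tors (tv : tors N _) (_ : p _ (Y ^+ q *: (Z ^+ m *: w) - b *: s)).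
rewrite scalerBr => /(_ (crelB pv' ps')) tw.
by rewrite -[_ *: _](subrK (b *: s)); apply: gmemD => //; apply: kb.
Qed.
End Kernel.

Lemma kernel_transfer y N Q S (psi : qhom (O y) N) (p : qhom N Q) (g : qhom N S) :
  qsurj psi -> qsurj p -> (forall b, kills b Q -> kills b S) ->
  forall v w s, p v w -> tors Q w -> g v s -> tors S s.
Proof.
move=> spsi sp QS v w s pv tw gv; have [n hn] := spsi v I.
apply: (@sat_pow _ _ _ _ _ n) => Y hY; have [b _ pb] := hn Y hY.
apply: (kernel_of_kills pb (crelZ (Y ^+ n) gv)); apply: QS.
by apply: (kills_of_kernel spsi sp pb (crelZ (Y ^+ n) pv)); apply: tors_scale.
Qed.

Lemma kills_iso M N a : @isomorphic C M N -> kills a M <-> kills a N.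
Proof.
move=> [f /invertibleP[mf sf]]; split=> [|ka u]; first exact: (kills_surj sf).
have [n h] := qdomP f u; apply: (@sat_pow _ _ _ _ _ n) => Y /h[v fv].
rewrite scalerA mulrC -scalerA; apply: mf (crelZ a fv) (ka v).
Qed.

Lemma isomorphic_refl M : @isomorphic C M M.
Proof.
exists (qid M); apply/invertibleP; split=> [u v -> //|v _].
by apply: sat_sub; exists v.
Qed.

(** Isomorphic quotients have the same annihilator, so any competing subobject coincides with [f];
    each inclusion is one use of [kernel_transfer]. *)
Lemma hall_unique y M N S (psi : qhom (O y) N) (f : qhom M N) (g : qhom N S) :
  qsurj psi -> @short_exact C M N S f g -> @hall_number_is C S M N 1.
Proof.
move=> spsi se; have [_ cg] := se; have /short_exactP[mf sg fg kg] := se.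
exists (fun=> M), (fun=> f); split=> [a|a b _ _|V j [/monoP mj _ [Q [p [/cokernelP[sp jp kp] iso]]]]].
- split; [exact/monoP | exact: isomorphic_refl |].
  by exists S, g; split=> //; apply: isomorphic_refl.
- by rewrite !ord1.
exists ord0; split; apply: sub_leI => //.
- move=> v [u _ ju]; have [n h] := qdomP g v.
  have [n1 h1] := qdomP p v; apply: (@sat_pow _ _ _ _ _ (n + n1)%N) => Y hY.
  have [s gs] := h Y hY; have [w pw] := h1 Y hY.
  have gs' : g (Y ^+ (n + n1) *: v) (Y ^+ n1 *: s).
    by rewrite addnC exprD -scalerA; apply: crelZ.
  have pw' : p (Y ^+ (n + n1) *: v) (Y ^+ n *: w) by rewrite exprD -scalerA; apply: crelZ.
  apply: kg (gs') _; apply: (kernel_transfer spsi sp _ pw' _ gs').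
    by move=> b; apply: (kills_iso b iso).1.
  by apply: jp pw'; apply: crelZ ju.
- move=> v [u _ fu]; have [n h] := qdomP g v.
  have [n1 h1] := qdomP p v; apply: (@sat_pow _ _ _ _ _ (n + n1)%N) => Y hY.
  have [s gs] := h Y hY; have [w pw] := h1 Y hY.
  have gs' : g (Y ^+ (n + n1) *: v) (Y ^+ n1 *: s).
    by rewrite addnC exprD -scalerA; apply: crelZ.
  have pw' : p (Y ^+ (n + n1) *: v) (Y ^+ n *: w) by rewrite exprD -scalerA; apply: crelZ.
  apply: kp (pw') _; apply: (kernel_transfer spsi sg _ gs' _ pw').
    by move=> b; apply: (kills_iso b iso).2.
  by apply: fg gs'; apply: crelZ fu.
Qed.

(** The image of 1 need not exist, but that of [Y ^+ n] does, and it generates because [Y] acts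
    invertibly on [M]. *)
Lemma generator_of_surj z e y M (g : qhom (O y) M) :
  closed_point z -> kills (pelt X z ^+ e) M -> qsurj g ->
  exists (Y : A) n (w : M) d (hw : gcomp d w = w),
    [/\ isY Y, nvan z Y, g (Y ^+ n) w & generates hw].
Proof.
move=> clz ke sg; have [Y hY nY] := nvan_isY X clz.
have [n hn] := qdomP g (1 : A); have [w0 gw0] := hn Y hY.
have hYn := AhomogX n (Ahomog_isY hY); have nYn := @nvan_isYX _ _ _ clz Y n hY nY.
have gw : g (Y ^+ n : A) (gcomp (c *+ n - y) w0).
  have := crel_comp (c *+ n - y) gw0; rewrite /= subrK.
  by rewrite [_ *: _](_ : _ = Y ^+ n) ?(Acomp_id hYn) // /GRing.scale /= mulr1.
exists Y, n, (gcomp (c *+ n - y) w0), (c *+ n - y), (gcomp_idem _ _); split=> //.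
move=> v _; have [m hm] := sg v I; apply: (@sat_pow _ _ _ _ _ m) => Z hZ.
have [b _ gb] := hm Z hZ; apply: (loc_sat clz ke hYn nYn).
have e1 : g (b * Y ^+ n : A) (Y ^+ n *: (Z ^+ m *: v)) by rewrite mulrC; apply: crelZ gb.
have e2 : g (b * Y ^+ n : A) (b *: gcomp (c *+ n - y) w0) by apply: crelZ gw.
rewrite -[X in sat _ X](subrK (b *: gcomp (c *+ n - y) w0)); apply: gmemD.
  by apply/tors_sat/(qhom_torsB e1 e2).
by apply: sat_sub; exists b.
Qed.

Lemma kernel_primary z e y M (g : qhom (O y) M) (b : A) d v :
  closed_point z -> qsurj g -> kills (pelt X z ^+ e.+1) M -> ~ kills (pelt X z ^+ e) M ->
  Ahomog d b -> g b v -> tors M v -> exists b', b = b' * pelt X z ^+ e.+1.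
Proof.
move=> clz sg ke nke hb gb tv.
have [Y [n [w [dw [hw [hY nY gw gen]]]]]] := generator_of_surj clz ke sg.
apply: (generator_kernel clz gen ke nke hb).
have e1 : g (b * Y ^+ n : A) (b *: w) by apply: crelZ gw.
have e2 : g (b * Y ^+ n : A) (Y ^+ n *: v) by rewrite mulrC; apply: crelZ gb.
rewrite -[_ *: w](subrK (Y ^+ n *: v)); apply: gmemD; first exact: qhom_torsB e1 e2.
exact: tors_scale.
Qed.

(** A nonzero image of 1 in the top is lifted to [M] along [p]. The lift is a multiple of the
    generator by an element not vanishing at [z], since multiples of the prime die in the top, so it
    is again a generator. *)
Lemma lift_exists z n y M T (h : qhom (O y) T) : closed_point z -> @indecomposable C M ->
  kills (pelt X z ^+ n) M -> @is_top C M T -> ~ qeq h (qzero _ _) ->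
  exists g : qhom (O y) M, qsurj g.
Proof.
move=> clz ind ke top nh.
have [d [w [hw gw]]] := indecomposable_cyclic clz ind ke.
have [p [sp pp]] := is_top_surj ke top.
have keT := kills_surj sp ke.
have [Y hY nY] := nvan_isY X clz; have [q hq] := qdomP h (1 : A).
have one (Z : A) : Z ^+ q *: (1 : A^o) = Z ^+ q by rewrite /GRing.scale /= mulr1.
have [t0 ht0] := hq Y hY; rewrite one in ht0.
have hYX j := AhomogX j (Ahomog_isY hY); have nYX j := @nvan_isYX _ _ _ clz Y j hY nY.
pose D := c *+ q - y; pose t1 := gcomp D t0.
have ht1 : h (Y ^+ q : A) t1.
  by have := crel_comp D ht0; rewrite /= subrK (Acomp_id (hYX q)).
have nt1 : ~ tors T t1.
  move=> tt1; apply: nh; apply/qeq0P => b s hb.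
  apply: (@sat_pow _ _ _ _ _ q) => Z hZ; have [tZ htZ] := hq Z hZ; rewrite one in htZ.
  have e1 : h (b * Z ^+ q : A) (Z ^+ q *: s) by rewrite mulrC; apply: crelZ hb.
  have e2 : h (b * Z ^+ q : A) (b *: tZ) by apply: crelZ htZ.
  rewrite -[_ *: s](subrK (b *: tZ)); apply: gmemD; first exact: qhom_torsB e1 e2.
  apply/gmemZ/(loc_sat clz keT (hYX q) (nYX q)).
  have e3 : h (Z ^+ q * Y ^+ q : A) (Y ^+ q *: tZ) by rewrite mulrC; apply: crelZ htZ.
  have e4 : h (Z ^+ q * Y ^+ q : A) (Z ^+ q *: t1) by apply: crelZ ht1.
  rewrite -[_ *: tZ](subrK (Z ^+ q *: t1)); apply: gmemD; first exact: qhom_torsB e3 e4.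
  exact: tors_scale.
have [r hr] := sp t1 I; have [s0 _ ps0] := hr Y hY; pose s := gcomp (D + c *+ r) s0.
have ps : p s (Y ^+ r *: t1).
  have := crel_comp (D + c *+ r) ps0.
  by rewrite (gcompZr _ _ (hYX r)) addrK gcomp_idem.
have [j hj] := gw s I; have [a0 ea0] := hj Y hY.
pose E := D + c *+ r + c *+ j; pose a := Acomp (E - d) a0.
have ha : Ahomog (E - d) a by apply: Ahomog_comp.
have ea : Y ^+ j *: s = a *: w.
  by rewrite -(gcomp_scale _ _ hw) -ea0 (gcompZr _ _ (hYX j)) addrK gcomp_idem.
have na : nvan z a.
  case: (nvanVdvd z a) => // -[b eb]; case: nt1.
  apply: (loc_sat clz keT (hYX r) (nYX r)); apply: (loc_sat clz keT (hYX j) (nYX j)).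
  apply: (pp (b *: w)); rewrite scalerA mulrC -eb -ea; exact: crelZ ps.
(* [q], [r] and [j] count the powers of [Y] spent on evaluating [h], on lifting along [p] and on
   writing the lift as a multiple of [w]; all are divided out at once. *)
have deg : E - d + d = c *+ (q + r + j) - y.
  have aux (a1 b1 c1 y1 : L) : a1 - y1 + b1 + c1 = a1 + b1 + c1 - y1.
    by rewrite [a1 - y1 + b1]addrAC [_ - y1 + c1]addrAC.
  by rewrite subrK /E /D aux -mulrnDr -mulrnDr.
by exists (qlift clz hw hY nY ke ha deg); apply: qlift_surj.
Qed.
End LineBundles.

(** * Isomorphism invariance of K_0 classes and exact sequences *)

Section GrothendieckGroup.
Variables (k : finFieldType) (X : wpl k).
Local Notation C := (coh X).
Implicit Types M N K : grmod X.

Lemma K0_addI (a b s : K0term C) : K0eq (K0add a s) (K0add b s) -> K0eq a b.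
Proof.
have inv (u : K0term C) : K0eq (K0add (K0add u s) (K0opp s)) u.
  apply: K0eq_trans (K0eq_sym (K0eq_addA _ _ _)) _.
  apply: K0eq_trans (K0eq_addC _ _) _.
  apply: (@K0eq_trans _ _ (K0add (@K0zero C) u)); last exact: K0eq_add0.
  apply: K0eq_add; last exact: K0eq_refl.
  by apply: K0eq_trans (K0eq_addC _ _) (K0eq_addN _).
move=> e; apply: K0eq_trans (K0eq_sym (inv a)) _; apply: K0eq_trans _ (inv b).
exact: K0eq_add e (K0eq_refl _).
Qed.

Lemma K0_iso M N (f : qhom M N) : qmono f -> qsurj f -> @K0eq C (K0cls (M : C)) (K0cls (N : C)).
Proof.
move=> mf sf; pose Z : grmod X := gsub_mod (gsub_zero N).
have zZ (v : Z) : tors Z v by apply/tors_gsub_mod; have -> : gval v = 0 := gvalP v; apply: gmem0.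
have seZ : @short_exact C Z Z Z (qid Z) (qid Z).
  by apply/short_exactP; split=> [u v _ _|v _|u v w _ _|v w _ _] //; apply/tors_sat/zZ.
have se : @short_exact C M N Z f (qzero N Z).
  apply/short_exactP; split=> // [v _|v w _ _]; first exact/tors_sat/zZ.
  exact: sf.
(* The exact sequence of zero sheaves gives [0] = [0] + [0]. *)
have z0 : @K0eq C (@K0zero C) (K0cls (Z : C)).
  apply: (@K0_addI _ _ (K0cls (Z : C))); apply: K0eq_trans (K0eq_add0 _) _.
  exact: K0eq_exact seZ.
apply: K0eq_sym; apply: K0eq_trans (K0eq_exact se) _.
apply: K0eq_trans (K0eq_addC _ _) _; apply: K0eq_trans _ (K0eq_add0 _).
exact: K0eq_add (K0eq_sym z0) (K0eq_refl _).
Qed.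

Lemma short_exact_transport M M' N N' S (f : qhom M N) (g : qhom N S)
    (al : qhom M M') (be : qhom N N') :
  qmono al -> qsurj al -> qmono be -> qsurj be -> @short_exact C M N S f g ->
  exists (f' : @mor C M' N') (g' : @mor C N' S), short_exact f' g'.
Proof.
move=> ma sa mb sb /short_exactP[mf sg fg kg].
exists (qcomp be (qcomp f (qinv ma sa))), (qcomp g (qinv mb sb)); apply/short_exactP; split.
- move=> u' v' [v [u au fu] bv] tv'.
  by apply: (qhom_tors _ (au : al u u')); apply: mf fu _; apply: mb bv tv'.
- move=> s _; have [n hn] := sg s I; apply: (@sat_pow _ _ _ _ _ n) => Y hY.
  have [v _ gv] := hn Y hY; have [q hq] := qdomP be v; exists q => Z hZ.
  have [v' bv'] := hq Z hZ; exists v' => //; exists (Z ^+ q *: v) => //.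
  by apply: crelZ gv.
- move=> u' v' s [v [u au fu] bv] [v2 bv2 gs].
  have tv : tors N (v2 - v).
    by apply: (mb _ _ (crelB (bv2 : be v2 v') bv)); rewrite subrr; apply: gmem0.
  have [n hn] := qdomP g v; apply: (@sat_pow _ _ _ _ _ n) => Y hY.
  have [s' gs'] := hn Y hY; rewrite -[_ *: s](subrK s'); apply: gmemD; last exact: fg (crelZ _ fu) gs'.
  apply: qhom_tors (crelB (crelZ (Y ^+ n) gs) gs').
  by rewrite -scalerBr; apply: tors_scale.
- move=> v' s [v bv gs] ts; have [n hn] := kg v s gs ts.
  apply: (@sat_pow _ _ _ _ _ n) => Y hY; have [u _ fu] := hn Y hY.
  have [q hq] := qdomP al u; exists q => Z hZ; have [u' au'] := hq Z hZ.
  exists u' => //; exists (Z ^+ q *: (Y ^+ n *: v)); last by do 2 apply: crelZ.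
  by exists (Z ^+ q *: u) => //; apply: crelZ fu.
Qed.
End GrothendieckGroup.

(** * Chinese remainder theorem for summands in distinct tubes *)

Section Quotients.
Variables (k : finFieldType) (X : wpl k).
Local Notation A := (Aalg X).
Local Notation L := (Lgrp X).
Local Notation c := (cvec X).
Local Notation C := (coh X).
Local Notation O y := (shift (Osheaf X) y).

Variables (m : nat) (S : grmod X) (F : 'I_m -> grmod X) (y : L).
Variable inj : forall j, qhom (F j) S.
Hypothesis dsum : @is_direct_sum C _ F S inj.
Hypothesis ind : forall j, @indecomposable C (F j).

Lemma indecomposable_nonzero j : ~ forall v, tors (F j) v.
Proof. by move=> h; case: (ind j) => nz _; apply/nz/zeroP. Qed.

Section ToSum.
Variables (z : 'I_m -> option {poly k}) (e : 'I_m -> nat) (g : forall j, qhom (O y) (F j)).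
Hypotheses (clz : forall j, closed_point (z j)) (zI : injective z).
Hypotheses (ke : forall j, kills (pelt X (z j) ^+ (e j).+1) (F j)).
Hypotheses (nke : forall j, ~ kills (pelt X (z j) ^+ e j) (F j)).
Hypothesis sg : forall j, qsurj (g j).

Local Notation G := (qsum inj g).

(** The product of the other prime powers plays the part of an idempotent in the Chinese remainder
    theorem: it acts invertibly on [F j] and as zero on the other summands. *)
Lemma coprime_others j : exists (u : A) d, [/\ Ahomog d u, nvan (z j) u &
  forall l, l != j -> kills u (F l)].
Proof.
pose u (r : seq 'I_m) : A := \prod_(l <- r | l != j) pelt X (z l) ^+ (e l).+1.
have h r : exists d, [/\ Ahomog d (u r), nvan (z j) (u r) &
    forall l, l \in r -> l != j -> kills (u r) (F l)].
  elim: r => [|i r [d [hu nu ku]]].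
    by exists 0; rewrite /u big_nil; split=> //; [apply: Ahomog1 | apply: nvan1].
  rewrite /u big_cons -/(u r); case: eqP => [->|/eqP ni].
    exists d; split=> // l; rewrite inE => /orP[/eqP ->|]; last exact: ku.
    by rewrite eqxx.
  have hp := Ahomog_pzX X (z i) (e i).+1; exists (pdeg X (z i) *+ (e i).+1 + d); split.
  - exact: AhomogM.
  - apply: (nvanM (clz j) hp hu) => //; apply: (nvanX (d := pdeg X (z i))) => //.
      exact: Ahomog_pelt.
    by apply: nvan_pelt => // /zI ij; rewrite ij eqxx in ni.
  - move=> l; rewrite inE => /orP[/eqP ->|lr] nl v.
      by rewrite mulrC -scalerA; apply/gmemZ/ke.
    by rewrite -scalerA; apply/gmemZ/ku.
have [d [hu nu ku]] := h (enum 'I_m).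
by exists (u (enum 'I_m)), d; split=> // l; apply: ku; rewrite mem_enum.
Qed.

(** Multiplying a value of [qsum inj g] by [u] leaves only its [j]-th component up to torsion, and
    [u] can be cancelled on [F j]; so each summand lies in the saturated image. *)
Lemma qsum_surj : qsurj G.
Proof.
move=> s _; apply: (sat_mono _ (dsum_span dsum s)) => _ [sg' [-> hs]].
apply: gmem_sum => j; have [x _ ix] := hs j.
have [u [d [hu nu ku]]] := coprime_others j.
pose P : gsub (F j) := cimg (cinv (inj j)) (sat (qim G)).
suff [n hn] : sat P x.
  apply: (@sat_pow _ _ _ _ _ n) => Y hY; have [v Gv iv] := hn Y hY.
  rewrite -[_ *: _](subrK v); apply: gmemD => //; apply: tors_sat.
  exact: qhom_torsB (crelZ (Y ^+ n) ix) iv.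
apply: (loc_sat (clz j) (@ke j) hu nu).
have [n hn] := @sg j x I; apply: (@sat_pow _ _ _ _ _ n) => Y hY.
have [b _ gb] := hn Y hY.
have [q hq] := csum_dom inj g (b : O y); apply: (@sat_pow _ _ _ _ _ q) => Z hZ.
have [_ _ [sg2 [_ hs2]]] := hq Z hZ.
have [xj gxj ixj] := hs2 j.
have tx : tors (F j) (xj - Z ^+ q *: (Y ^+ n *: x)).
  exact: qhom_torsB gxj (crelZ (Z ^+ q) gb).
have -> : Z ^+ q *: (Y ^+ n *: (u *: x)) = u *: xj - u *: (xj - Z ^+ q *: (Y ^+ n *: x)).
  rewrite scalerBr subKr scalerA scalerA mulrC -scalerA -scalerA //.
apply: gmemB; last exact/tors_sat/tors_scale.
apply: sat_sub; exists (u *: sg2 j); last exact: crelZ ixj.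
apply: (@gmemDl _ _ _ _ _ (\sum_(l | l != j) u *: sg2 l)).
  apply: tors_sat; elim/big_ind: _ => [||l nl]; [exact: gmem0 | exact: gmemD |].
  have [xl _ ixl] := hs2 l; apply: qhom_tors (crelZ u ixl).
  exact: ku.
have -> : u *: sg2 j + \sum_(l | l != j) u *: sg2 l = u *: \sum_l sg2 l.
  by rewrite scaler_sumr [RHS](bigD1 j).
apply: sat_sub; exists (u *: (Z ^+ q *: (b : O y))) => //.
by apply: crelZ; exists sg2.
Qed.

Definition Fprod : A := \prod_j pelt X (z j) ^+ (e j).+1.

Lemma Fprod_homog : exists2 D, Ahomog D Fprod & Fprod != 0.
Proof.
suff [D []] : exists D, Ahomog D Fprod /\ Fprod != 0 by exists D.
rewrite /Fprod; elim/big_ind: _ => [|a b [d [ha a0]] [d' [hb b0]]|j _].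
- by exists 0; split; [apply: Ahomog1 | rewrite oner_eq0].
- by exists (d + d'); split; [apply: AhomogM | apply: Ahomog_mul_neq0 ha hb a0 b0].
- by exists (pdeg X (z j) *+ (e j).+1); split; [apply: Ahomog_pzX | apply: pzX_neq0].
Qed.

Lemma Fprod_dvd j : exists b, Fprod = b * pelt X (z j) ^+ (e j).+1.
Proof.
by exists (\prod_(l | l != j) pelt X (z l) ^+ (e l).+1); rewrite /Fprod (bigD1 j) // mulrC.
Qed.

Lemma qsum_kernel d (b : A) s : Ahomog d b -> G b s -> tors S s -> exists b', b = b' * Fprod.
Proof.
move=> hb Gb ts.
apply: (@dvd_prod_pelt _ X _ (index_enum 'I_m) z (fun j => (e j).+1) d b) => //.
  exact: index_enum_uniq.
move=> j; have [sg2 [_ hs]] := Gb; have [x gx _] := hs j.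
apply: (kernel_primary (clz j) (@sg j) (@ke j) (@nke j) hb gx).
exact: (qsum_tors dsum Gb ts gx).
Qed.

Lemma kernel_qsum (a : A) s : G (a * Fprod : A) s -> tors S s.
Proof.
move=> [sg2 [-> hs]]; apply: gmem_sum => j; have [x gx ix] := hs j.
apply: qhom_tors ix.
have [n hn] := qdomP (g j) (1 : A); apply: (@sat_pow _ _ _ _ _ n) => Y hY.
have [x1 gx1] := hn Y hY; rewrite [_ *: _](_ : _ = Y ^+ n) in gx1; last by rewrite /GRing.scale /= mulr1.
have e1 : g j (a * Fprod * Y ^+ n : A) ((a * Fprod) *: x1) by apply: crelZ gx1.
have e2 : g j (a * Fprod * Y ^+ n : A) (Y ^+ n *: x) by rewrite mulrC; apply: crelZ gx.
rewrite -[_ *: x](subrK ((a * Fprod) *: x1)); apply: gmemD; first exact: qhom_torsB e2 e1.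
have [b ->] := Fprod_dvd j; rewrite mulrA -scalerA; apply/gmemZ/ke.
Qed.

Section Multiplication.
Variables (D : L) (hF : Ahomog D Fprod).

Lemma mulF_linear : linear (fun a : (Aalg X)^o => (a * Fprod : (Aalg X)^o)).
Proof. by move=> a u v; rewrite /= mulrDl -[a *: u]/(a * u) -mulrA. Qed.

Definition mulF : {linear O (y - D) -> O y} :=
  HB.pack (fun a : (Aalg X)^o => (a * Fprod : (Aalg X)^o))
    (GRing.isLinear.Build _ _ _ _ (fun a : (Aalg X)^o => (a * Fprod : (Aalg X)^o)) mulF_linear).

Lemma mulF_comp d a : mulF (gcomp d a) = gcomp d (mulF a).
Proof.
rewrite /= mulrC -(AcompM _ _ hF); congr (Acomp _ _); last exact: mulrC.
by rewrite [d + (y - D)]addrA [LHS]addrC subrK.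
Qed.

Lemma short_exact_mulF : Fprod != 0 -> @short_exact C _ _ _ (qgraph mulF_comp) G.
Proof.
move=> F0; apply/short_exactP; split.
- move=> a b -> /tors_O ab; have ab' : (a : A) * Fprod = 0 by exact: ab.
  suff -> : a = 0 :> A by apply: (gmem0 (tors (O (y - D)))).
  apply: (@Ahomog_mulI _ X _ Fprod (a : A) 0 hF F0).
  by rewrite mulr0 mulrC.
- exact: qsum_surj.
- by move=> a b s ->; apply: kernel_qsum.
apply: qkerleI => b Gb; apply: (@gmem_comps _ _ (O y)) => d.
have Gd : G (gcomp d b) 0 by rewrite -(gcomp0 S d); apply: crel_comp.
have [|b' eb] := qsum_kernel (Ahomog_comp (d + y) (b : A)) Gd; first exact: gmem0.
by apply: sat_sub; exists b'.
Qed.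
End Multiplication.
End ToSum.

(** Every element of [F j] turns out to be a multiple of the prime, up to saturation, which Nakayama
    forbids for a nonzero sheaf. *)
Lemma surj_distinct (g : qhom (O y) S) z e j l : qsurj g -> j != l -> closed_point z ->
  kills (pelt X z ^+ e) (F j) -> kills (pelt X z ^+ e) (F l) -> False.
Proof.
move=> sg jl clz kj kl.
have sgl : qsurj (qcomp (dproj dsum l) g) by apply: qcomp_qim => //; apply: dproj_surj.
apply: (indecomposable_nonzero (j := j)).
suff h : gsub_le (gsub_full (F j)) (sat (gsub_add (gsub_zero (F j)) (pimg z (F j)))).
  by move=> v; apply: (pimg_nakayama kj h).
move=> x0 _; apply: gmem_comps => d; have := gcomp_idem d x0.
move: (gcomp d x0) => {x0}x hx.
have [Y hY nY] := nvan_isY X clz.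
have hYX i := AhomogX i (Ahomog_isY hY); have nYX i := @nvan_isYX _ _ _ clz Y i hY nY.
have [n hn] := qdomP (inj j) x; have [s0 is0] := hn Y hY.
pose s := gcomp (d + c *+ n) s0.
have is_ : inj j (Y ^+ n *: x) s.
  have := crel_comp (d + c *+ n) is0.
  by rewrite (gcompZr _ _ (hYX n)) addrK hx.
have [q hq] := sg s I; have [b0 _ gb0] := hq Y hY.
pose E := d + c *+ n + c *+ q; pose b : A := Acomp (E + y) b0.
have hb : Ahomog (E + y) b by apply: Ahomog_comp.
have gb : g b (Y ^+ q *: s).
  have := crel_comp E gb0; by rewrite (gcompZr _ _ (hYX q)) addrK gcomp_idem.
have ix : inj j (Y ^+ q *: (Y ^+ n *: x)) (Y ^+ q *: s) by apply: crelZ is_.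
apply: (loc_sat clz kj (hYX n) (nYX n)); apply: (loc_sat clz kj (hYX q) (nYX q)).
(* [g] sends [b] into the summand [F j], so [b] annihilates [F l] up to a power of [Y]; were [b]
   nonvanishing at [z], it would also act invertibly there. Hence the prime divides [b] and, up to
   torsion, its component in [F j]. *)
case: (nvanVdvd z b) => [nb|[b' eb]].
  have [r hr] := qdomP (dproj dsum l) (Y ^+ q *: s); have [t pt] := hr Y hY.
  have tt : tors (F l) t by apply: dproj_ne jl (crelZ (Y ^+ r) ix) pt.
  have gr : qcomp (dproj dsum l) g (Y ^+ r * b : A) t.
    by exists (Y ^+ r *: (Y ^+ q *: s)) => //; apply: crelZ gb.
  have kb : kills (Y ^+ r * b) (F l).
    apply: (kills_of_kernel (psi := qid (O y)) _ sgl (erefl _) gr tt).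
    by move=> v _; apply: sat_sub; exists v.
  case: (indecomposable_nonzero (j := l)) => v.
  exact: (loc_sat clz kl (AhomogM (hYX r) hb) (nvanM clz (hYX r) hb (nYX r) nb) (kb v)).
have [r hr] := qdomP (qcomp (dproj dsum j) g) (b' : A).
have [t2 [s2 gs2 ps2]] := hr Y hY; apply: (loc_sat clz kj (hYX r) (nYX r)).
have gb' : g (Y ^+ r * b : A) (Y ^+ r *: (Y ^+ q *: s)) by apply: crelZ gb.
have gb2 : g (Y ^+ r * b : A) (pelt X z *: s2).
  have <- : pelt X z * (Y ^+ r * b') = Y ^+ r * b by rewrite eb mulrC -mulrA.
  exact: crelZ gs2.
have ts := qhom_torsB gb' gb2.
have [i hi] := qdomP (dproj dsum j) (Y ^+ r *: (Y ^+ q *: s)); have [t3 pt3] := hi Y hY.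
apply: (loc_sat clz kj (hYX i) (nYX i)).
have ix3 := crelZ (Y ^+ i) (crelZ (Y ^+ r) ix).
have t31 := dproj_inj ix3 pt3.
have ps3 : dproj dsum j (Y ^+ i *: (pelt X z *: s2)) (pelt X z *: (Y ^+ i *: t2)).
  by rewrite scalerA mulrC -scalerA; do 2 apply: crelZ.
have t32 := qhom_tors (tors_scale (Y ^+ i) ts : tors S _) (_ : dproj dsum j _ (t3 - pelt X z *: (Y ^+ i *: t2))).
rewrite scalerBr in t32; have {}t32 := t32 (crelB pt3 ps3).
rewrite -[X in sat _ X](subKr t3); apply: gmemB; last exact: tors_sat.
rewrite -[t3](subrK (pelt X z *: (Y ^+ i *: t2))); apply: gmemD; first exact: tors_sat.
by apply: sat_sub; apply: gsub_addr; exists (Y ^+ i *: t2).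
Qed.
End Quotients.

(** * Annihilators from exact sequences, and the equivalence *)

Section Main.
Variables (k : finFieldType) (X : wpl k).
Local Notation A := (Aalg X).
Local Notation L := (Lgrp X).
Local Notation c := (cvec X).
Local Notation C := (coh X).
Local Notation O y := (shift (Osheaf X) y).

Lemma tube_kills z M : closed_point z -> @tube k X z M -> exists n, kills (pelt X z ^+ n) M.
Proof.
move=> clz [_ [n /qeq0P h]]; exists (pexp X z * n)%N => v.
rewrite exprM -zform_pelt.
by have /tors_shift := h v (zform X z ^+ n *: v) (erefl _).
Qed.

Lemma kills_tube z M n : finite_length (M : C) -> kills (zform X z ^+ n) M -> @tube k X z M.
Proof.
move=> fM kn; split=> //; exists n; apply/qeq0P => u v ->.
by apply/tors_shift; apply: kn.
Qed.

(** The composite from O(x) to [N] is a monomorphism, so the image of a power of Y1 is not torsion;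
    up to such powers it is the value of [psi] at a nonzero [b], which goes to zero in [S]. *)
Lemma kernel_nonzero x y M N S (phi : qhom (O x) M) (psi : qhom (O y) N)
    (f : qhom M N) (g : qhom N S) :
  qmono phi -> qsurj psi -> @short_exact C M N S f g ->
  exists (b : A) d, [/\ Ahomog d b, b != 0 & kills b S].
Proof.
move=> mphi spsi /short_exactP[mf sg fg kg].
have mff : qmono (qcomp f phi).
  by move=> u w [v pv fv] tw; apply: mphi pv _; apply: mf fv tw.
have [n hn] := qdomP (qcomp f phi) (1 : A); have [v0 fv0] := hn _ (isY1 X).
have hY j := AhomogX j (Ahomog_Y1 X).
pose D := c *+ n - x; pose v := gcomp D v0.
have fv : qcomp f phi (Y1 X ^+ n : A) v.
  have := crel_comp D fv0; rewrite [@gcomp _ _ (O x) _ _](_ : _ = Y1 X ^+ n) //.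
  by rewrite /= /GRing.scale /= mulr1 /D subrK (Acomp_id (hY n)).
have [q hq] := spsi v I; have [b0 _ pb0] := hq _ (isY1 X).
pose E := D + c *+ q; pose b : A := Acomp (E + y) b0.
have pb : psi b (Y1 X ^+ q *: v).
  have := crel_comp E pb0; by rewrite (gcompZr _ _ (hY q)) addrK gcomp_idem.
have [r hr] := qdomP g (Y1 X ^+ q *: v); have [s gs] := hr _ (isY1 X).
have ts : tors S s.
  by have [u pu fu] := fv; apply: fg (crelZ (Y1 X ^+ r) (crelZ (Y1 X ^+ q) fu)) gs.
have pb' : psi (Y1 X ^+ r * b : A) (Y1 X ^+ r *: (Y1 X ^+ q *: v)) by apply: crelZ pb.
exists (Y1 X ^+ r * b), (c *+ r + (E + y)); split.
- by apply: AhomogM (hY r) _; apply: Ahomog_comp.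
- apply: (Ahomog_mul_neq0 (hY r) (Ahomog_comp (E + y) b0)); first exact: Y1X_neq0.
  apply/eqP => b00; have pb00 : psi 0 (Y1 X ^+ q *: v) by have := pb; rewrite /b b00.
  have tv := qkerP pb00; have := mff _ _ (crelZ (Y1 X ^+ q) fv) tv.
  move=> /tors_O/eqP; apply/negP; rewrite -[_ *: _]/(Y1 X ^+ q * Y1 X ^+ n) -exprD.
  exact: Y1X_neq0.
- exact: (kills_of_kernel spsi sg pb' gs ts).
Qed.
End Main.

Theorem proposition3p4 (k : finFieldType) (X : wpl k) (L : coh X)
    (x y : Lgrp X) (m : nat) (S : coh X) (Ssum : 'I_m -> coh X)
    (inj : forall j, mor (Ssum j) S) :
  line_bundle L -> torsion S ->
  is_direct_sum inj -> (forall j, indecomposable (Ssum j)) ->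
  let Lx : coh X := shift L x in
  let Ly : coh X := shift L y in
  let exact_sequence := exists (f : mor Lx Ly) (g : mor Ly S), short_exact f g in
  (exact_sequence <->
     [/\ K0eq (K0add (K0cls Lx) (K0cls S)) (K0cls Ly),
         distinct_tubes Ssum &
         forall j, exists T : coh X, is_top (Ssum j) T /\
           exists h : mor Ly T, ~ heq h (zmor Ly T)]) /\
  (exact_sequence -> hall_number_is S Lx Ly 1).
Proof.
move=> [l isoL] torS dsum ind Lx Ly exact_sequence.
have [phi [mphi sphi]] := twist_line_bundle x isoL.
have [psi [mpsi spsi]] := twist_line_bundle y isoL.
split; last by move=> [f [g se]]; apply: hall_unique spsi se.
split=> [[f [g se]]|[K0e [z [zI zt]] tops]].
  (* A nonzero homogeneous annihilator of [S] kills every summand, which places each indecomposable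
     summand at one closed point. *)
  have [b [d [hb b0 kb]]] := kernel_nonzero mphi spsi se.
  have /short_exactP[mf sg fg kg] := se.
  have sp j := dproj_surj dsum (j := j).
  have /choice[z zP] : forall j, exists z, exists n, closed_point z /\ kills (zform X z ^+ n) (Ssum j).
    by move=> j; apply: indecomposable_tube (ind j) hb b0 (kills_surj (sp j) kb).
  have /choice[n nP] : forall j, exists n, closed_point (z j) /\ kills (zform X (z j) ^+ n) (Ssum j).
    by move=> j; apply: zP.
  have clz j : closed_point (z j) by case: (nP j).
  have kz j : kills (pelt X (z j) ^+ (pexp X (z j) * n j)) (Ssum j).
    by case: (nP j) => _; rewrite zform_pelt -exprM.
  have sG : qsurj (qcomp g psi) by apply: qcomp_qim.
  split; first exact/K0eq_sym/K0eq_exact/se.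
    exists z; split.
      move=> j i zji; apply/eqP; apply: contraT => ji; exfalso.
      (* The sum of the two exponents is a single one that kills both summands. *)
      apply: (surj_distinct dsum ind sG ji (clz j)
        (e := (pexp X (z j) * n j + pexp X (z i) * n i)%N)).
        by rewrite addnC exprD => v; rewrite -scalerA; apply/gmemZ/kz.
      by rewrite zji exprD => v; rewrite -scalerA; apply/gmemZ/kz.
    move=> j; split=> //; apply: (kills_tube (n := n j)); last by case: (nP j).
    exact: (finite_length_sub torS (inj_mono dsum (j := j))).
  move=> j; have [e [ke nke]] := min_kills (ind j) (kz j).
  have sGj : qsurj (qcomp (dproj dsum j) (qcomp g psi)) by apply: qcomp_qim.
  have [Y [q [w [dw [hw [_ _ _ gen]]]]]] := generator_of_surj (clz j) ke sGj.
  have [T [p [top spT nT]]] := top_cyclic (clz j) gen ke nke.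
  (* The composite onto a nonzero top is an epimorphism, hence not zero. *)
  exists T; split=> //; exists (qcomp p (qcomp (dproj dsum j) g)) => /qeq0P h0.
  have sh : qsurj (qcomp p (qcomp (dproj dsum j) g)) by do 2?apply: qcomp_qim.
  apply: nT => t; have [a ha] := sh t I; apply: (@sat_pow _ _ _ _ _ a) => Z hZ.
  by have [v _ hv] := ha Z hZ; apply: h0 hv.
have clz j : closed_point (z j) by case: (zt j).
have /choice[e eP] : forall j, exists e, kills (pelt X (z j) ^+ e.+1) (Ssum j) /\
    ~ kills (pelt X (z j) ^+ e) (Ssum j).
  move=> j; have [_ tj] := zt j; have [n kn] := tube_kills (clz j) tj.
  exact: min_kills (ind j) kn.
(* The nonzero map is pulled back along [psi]; it stays nonzero because [psi] is an epimorphism. *)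
have gex j : exists g : qhom (shift (Osheaf X) (y + l)) (Ssum j), qsurj g.
  have [T [top [h nh]]] := tops j; have [ke _] := eP j.
  apply: (lift_exists (h := qcomp h psi) (clz j) (ind j) ke top) => h0; apply: nh.
  apply: (qsurj_cancel spsi); apply: qeq_trans h0 (qeq_sym _).
  exact: qcomp0l.
pose g j := sval (cid (gex j)); have sg j : qsurj (g j) by rewrite /g; case: cid.
have ke j : kills (pelt X (z j) ^+ (e j).+1) (Ssum j) by case: (eP j).
have nke j : ~ kills (pelt X (z j) ^+ e j) (Ssum j) by case: (eP j).
have [D hF F0] := Fprod_homog X e clz.
have se := short_exact_mulF dsum clz zI ke nke sg hF F0.
(* The kernel found is O([y + l - D]); condition (1), with [S] cancelled, gives it the class of
   O([x + l]), and the class determines the twist. *)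
have ex : y + l - D = x + l.
  apply: K0eq_Osheaf; apply: (@K0_addI _ _ _ _ (K0cls (S : coh X))).
  apply: K0eq_trans (K0eq_sym (K0eq_exact se)) _.
  apply: K0eq_trans (K0_iso mpsi spsi) _; apply: K0eq_trans (K0eq_sym K0e) _.
  exact: K0eq_add (K0eq_sym (K0_iso mphi sphi)) (K0eq_refl _).
have [f' [g' se']] : exists (f' : qhom (shift (Osheaf X) (x + l)) (shift (Osheaf X) (y + l)))
    (g' : qhom (shift (Osheaf X) (y + l)) S), @short_exact (coh X) _ _ _ f' g'.
  by rewrite -ex; exists (qgraph (mulF_comp hF)), (qsum inj g).
exact: short_exact_transport mphi sphi mpsi spsi se'.
Qed.
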